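(* Let $I\ge1$ be an integer. There exist constants $C>0$ and $h_0>0$, not depending on $N$, $k$, $M$, such that for every $N$ with $h=T/N\le h_0$, every $k=0,\dots,N-1$ and every $M\ge1$, $$\mathbb E\left|Y^{N,I,I}_{t_k}-Y^{N,I,I,M}_{t_k}\right|^2+h\sum_{j=k}^{N-1}\mathbb E\left|Z^{N,I}_{t_j}-Z^{N,I,I,M}_{t_j}\right|^2$$ $$\le16\sum_{j=k}^{N-1}\mathbb E\left[\left(|\zeta^N_j|^2+|\rho^N_j|^2\right)1_{[A^M_k]^c}\right]+Ch^{I-1}\sum_{j=k}^{N-1}\left(h^2+h\,\mathbb E|\rho^N_{j+1}|^2+\mathbb E|\rho^N_j|^2+\mathbb E|\zeta^N_j|^2\right)+\frac{C}{hM}\sum_{j=k}^{N-1}\epsilon_j .$$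
   Context: Let $T>0$, $x\in\mathbb R$, and let $(W_t)$, $(B_t)$ be two independent standard real Brownian motions on $(\Omega,\mathcal F,\mathbb P)$ with null sets $\mathcal N$. Set $\mathcal F^W_t=\sigma(W_s;0\le s\le t)\vee\mathcal N$, $\mathcal F^B_{t,t'}=\sigma(B_s-B_{t'};t\le s\le t')\vee\mathcal N$, $\mathcal F_t=\mathcal F^W_t\vee\mathcal F^B_{t,T}$. Let $b,\sigma,\Phi:\mathbb R\to\mathbb R$, $f:\mathbb R^3\to\mathbb R$, $g:\mathbb R^2\to\mathbb R$ be functions and $X$ the solution of $X_t=x+\int_0^tb(X_s)ds+\int_0^t\sigma(X_s)dW_s$. Assumptions: $\Phi(X_T)\in L^2$; $|f(x,y,z)-f(x',y',z')|^2\le L_f(|x-x'|^2+|y-y'|^2+|z-z'|^2)$; $|g(x,y)-g(x',y')|^2\le L_g(|x-x'|^2+|y-y'|^2)$. For $N\ge1$: $h=T/N$, $t_k=kh$, $\Delta W_{k+1}=W_{t_{k+1}}-W_{t_k}$, $\Delta B_k=B_{t_{k+1}}-B_{t_k}$; $X^N_{t_0}=x$, $X^N_{t_{k+1}}=X^N_{t_k}+hb(X^N_{t_k})+\sigma(X^N_{t_k})\Delta W_{k+1}$. Function basis: for each $N$ and $k$, a real interval $[a_k,b_k]$ is partitioned into $\mathcal X^k_1,\dots,\mathcal X^k_L$, and $u_i(X^N_{t_k})=1_{\mathcal X^k_i}(X^N_{t_k})/\sqrt{\mathbb P(X^N_{t_k}\in\mathcal X^k_i)}$; a real interval $[a,b]$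 is partitioned into $\mathcal B_1,\dots,\mathcal B_L$, and for $G\sim\mathcal N(0,h)$, $v_i(G)=1_{\mathcal B_i}(G)/\sqrt{\mathbb P(G\in\mathcal B_i)}$. For each $k$, $p_k$ is the vector with components $u_{i_N}(X^N_{t_k})$ and, for $l=k,\dots,N-1$, $u_{i_N}(X^N_{t_k})\prod_{j=l+1}^{N-1}v_{i_j}(\Delta B_j)\frac{\Delta B_l}{\sqrt h}$, over all indices $i_N,\dots,i_{l+1}\in\{1,\dots,L\}$ (empty product $=1$); $\mathbb E\,p_kp_k^*=Id$. $P_k$ is the orthogonal projection of $L^2$ onto the span $\mathcal P_k\subset L^2(\mathcal F_{t_k})$ of the components of $p_k$. A dot denotes the Euclidean scalar product. Projected Picard scheme with $I$ iterations: $Z^{N,I}_{t_N}=0$, $Y^{N,i,I}_{t_N}=P_N\Phi(X^N_{t_N})$, $i=0,\dots,I$; for $k=N-1,\dots,0$, $Z^{N,I}_{t_k}=\frac1hP_k[Y^{N,I,I}_{t_{k+1}}\Delta W_{k+1}]+\frac1hP_k[\Delta B_kg(X^N_{t_{k+1}},Y^{N,I,I}_{t_{k+1}})\Delta W_{k+1}]$, $Y^{N,0,I}_{t_k}=0$, and for $i=1,\dots,I$, $Y^{N,i,I}_{t_k}=P_kY^{N,I,I}_{t_{k+1}}+hP_k[f(X^N_{t_k},Y^{N,i-1,I}_{t_k},Z^{N,I}_{t_k})]+P_k[\Delta B_kg(X^N_{t_{k+1}},Y^{N,I,I}_{t_{k+1}})]$. For $h$ small, $Y^{N,\infty,I}_{t_k}$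 ($k\le N-1$) is the unique $Y\in L^2(\mathcal F_{t_k})$ with $Y=P_k[Y^{N,I,I}_{t_{k+1}}+hf(X^N_{t_k},Y,Z^{N,I}_{t_k})+\Delta B_kg(X^N_{t_{k+1}},Y^{N,I,I}_{t_{k+1}})]$. $C_0$ is the constant in the following uniform bound, established in the paper: for large $N$ and every $I\ge1$, $\max_{0\le k\le N}\mathbb E|Y^{N,I,I}_{t_k}|^2+\max_{0\le k\le N-1}\mathbb E|Y^{N,\infty,I}_{t_k}|^2+\max_{0\le k\le N}h\,\mathbb E|Z^{N,I}_{t_k}|^2\le C_0$. Set $\zeta^N_k=\rho^N_k=(|p_k|\sqrt{C_0})\vee1$. Truncation: $\xi:\mathbb R\to\mathbb R$ is $C^2_b$, $\xi(x)=x$ for $|x|\le3/2$, $|\xi|_\infty\le2$, $|\xi'|_\infty\le1$; $\widehat\rho^N_k(x)=\rho^N_k\xi(x/\rho^N_k)$, $\widehat\zeta^N_k(x)=\zeta^N_k\xi(x/\zeta^N_k)$. Samples: $(W^m,B^m)$, $m=1,\dots,M$, are independent copies of $(W,B)$, independent of $(W,B)$; $X^{N,m},\Delta W^m_{k+1},\Delta B^m_k,p^m_k,\rho^{N,m}_k,\widehat\rho^{N,m}_k$ are defined from $(W^m,B^m)$ as $X^N,\Delta W_{k+1},\Delta B_k,p_k,\rho^N_k,\widehat\rho^N_k$ from $(W,B)$. Let $v_k=(p_k,p_k\frac{\Delta W_{k+1}}{\sqrt h})$, $v^m_k=(p^m_k,p^m_k\frac{\Delta W^m_{k+1}}{\sqrt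 h})$ (column vectors), $V^M_k=\frac1M\sum_{m=1}^Mv^m_k(v^m_k)^*$, $P^M_k=\frac1M\sum_{m=1}^Mp^m_k(p^m_k)^*$. With $\|\cdot\|$ the maximum absolute value of the eigenvalues of a symmetric matrix and $\|\cdot\|_F$ the Frobenius norm, $\mathfrak A_j=\{\|V^M_j-Id\|\le h,\ \|P^M_j-Id\|\le h\}$ and $A^M_k=\bigcap_{j=k}^{N-1}\mathfrak A_j$. Numerical scheme: $\alpha^{i,I,M}_N$ is defined by $\alpha^{i,I,M}_N.p_N=P_N\Phi(X^N_{t_N})$ and $\beta^{i,I,M}_N=0$ for $i=1,\dots,I$. For $k=N-1,\dots,0$, put $Y^{N,I,I,M,m}_{t_{k+1}}=\widehat\rho^{N,m}_{k+1}(\alpha^{I,I,M}_{k+1}.p^m_{k+1})$, $\alpha^{0,I,M}_k=\beta^{0,I,M}_k=0$, and for $i=1,\dots,I$ the vector $\theta^{i,I,M}_k=(\alpha^{i,I,M}_k,\sqrt h\beta^{i,I,M}_k)$ is defined as the arg min in $(\alpha,\beta)$ of $$\frac1M\sum_{m=1}^M\Big|Y^{N,I,I,M,m}_{t_{k+1}}-\alpha.p^m_k+hf(X^{N,m}_{t_k},\alpha^{i-1,I,M}_k.p^m_k,\beta^{i-1,I,M}_k.p^m_k)+\Delta B^m_kg(X^{N,m}_{t_{k+1}},Y^{N,I,I,M,m}_{t_{k+1}})-\beta.p^m_k\Delta W^m_{k+1}\Big|^2.$$ Finally $Y^{N,I,I,M}_{t_k}=\widehat\rho^N_k(\alpha^{I,I,M}_k.p_k)$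 and $\sqrt hZ^{N,I,I,M}_{t_k}=\widehat\zeta^N_k(\sqrt h\beta^{I,I,M}_k.p_k)$. Error quantity: write $v_k=(v^o_k,v^p_k)$ where $v^o_k$ collects the components independent of $\Delta B_k$ and $v^p_k=\frac{\Delta B_k}{\sqrt h}w^p_k$ with $w^p_k$ independent of $\Delta B_k$. For $k=0,\dots,N-1$, $$\epsilon_k=\mathbb E\|v_kv_k^*-Id\|_F^2\left(\mathbb E|\rho^N_k|^2+\mathbb E|\zeta^N_k|^2\right)+\mathbb E[|v_k|^2|p_{k+1}|^2]\,\mathbb E|\rho^N_{k+1}|^2$$ $$+h^2\,\mathbb E\Big[|v_k|^2\Big(1+|X^N_{t_k}|^2+|p_k|^2\mathbb E|\rho^N_k|^2+\tfrac1h|p_k|^2\mathbb E|\zeta^N_k|^2\Big)\Big]+h\,\mathbb E\Big[(|v_k|^2+|w^p_k|^2)\big(1+|X^N_{t_{k+1}}|^2+|p_{k+1}|^2\mathbb E|\rho^N_{k+1}|^2\big)\Big].$$ *)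

(* Defs.v *)
From HB Require Import structures.
From mathcomp Require Import all_boot all_order all_algebra.
From mathcomp Require Import all_classical all_reals all_analysis.

Set Implicit Arguments.
Unset Strict Implicit.
Unset Printing Implicit Defensive.

Import Order.TTheory GRing.Theory Num.Theory.
Import numFieldNormedType.Exports.

Local Open Scope classical_set_scope.
Local Open Scope ring_scope.

Section linear_algebra.
Context {R : realType}.

Definition dot n (a b : 'cV[R]_n) : R := \sum_(i < n) a i 0 * b i 0.

(* The library norm on matrices is the sup norm, hence these. *)
Definition enorm n (a : 'cV[R]_n) : R := Num.sqrt (dot a a).

Definition frobenius n (A : 'M[R]_n) : R :=
  Num.sqrt (\sum_(i < n) \sum_(j < n) A i j ^+ 2).

Definition eignorm n (A : 'M[R]_n) : R :=
  sup [set `|a| | a in [set a : R | eigenvalue A a]].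

End linear_algebra.

Section sigma_algebras.
Context {R : realType} {d : measure_display} {Omega : measurableType d}.
Variable P : probability Omega R.
Implicit Types (G H : set (set Omega)) (U : Omega -> R).

Definition preimages (D : set R) (V : R -> Omega -> R) : set (set Omega) :=
  [set A | exists2 t, D t & exists2 C, measurable C & A = V t @^-1` C].

Definition null_sets : set (set Omega) := [set A | measurable A /\ P A = 0%E].

Definition adapted_to G U := forall C : set R, measurable C -> G (U @^-1` C).

Definition independent2 G H :=
  forall A A', G A -> H A' -> P (A `&` A') = (P A * P A')%E.

Definition mutually_independent (J : finType) (G : J -> set (set Omega)) :=
  forall (K : {set J}) (A : J -> set Omega), (forall j, j \in K -> G j (A j)) ->
  P (\bigcap_(j in [set` K]) A j) = (\prod_(j in K) P (A j))%E.

Definition path_sigma (V : R -> Omega -> R) : set (set Omega) :=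
  <<s preimages `[0, +oo[ V >>.

Definition pair_sigma (V V' : R -> Omega -> R) : set (set Omega) :=
  <<s preimages `[0, +oo[ V `|` preimages `[0, +oo[ V' >>.

Definition FW (W : R -> Omega -> R) (t : R) : set (set Omega) :=
  <<s preimages `[0, t] W `|` null_sets >>.

Definition FB (B : R -> Omega -> R) (t t' : R) : set (set Omega) :=
  <<s preimages `[t, t'] (fun s w => B s w - B t' w) `|` null_sets >>.

(* Not monotone in t, hence not a filtration. *)
Definition FWB (W B : R -> Omega -> R) (T t : R) : set (set Omega) :=
  <<s FW W t `|` FB B t T >>.

(* The second argument of [normal_prob] is the standard deviation. *)
Definition brownian (V : R -> Omega -> R) :=
  [/\ forall t : R, 0 <= t -> measurable_fun setT (V t),
      V 0 = cst 0 %[ae P],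
      {ae P, forall w, {within `[0, +oo[, continuous (V ^~ w)}},
      forall s t : R, 0 <= s < t -> forall C : set R, measurable C ->
        P ((V t \- V s) @^-1` C) = normal_prob 0 (Num.sqrt (t - s)) C
    & forall s t : R, 0 <= s < t ->
        independent2 [set A | exists2 C, measurable C & A = (V t \- V s) @^-1` C]
                     <<s preimages `[0, s] V >> ].

(* Equality of the finite-dimensional laws. *)
Definition same_law (W B W' B' : R -> Omega -> R) :=
  forall n (t : 'I_n -> R) (C D : 'I_n -> set R), (forall i, 0 <= t i) ->
  (forall i, measurable (C i)) -> (forall i, measurable (D i)) ->
  P [set w | forall i, C i (W' (t i) w) /\ D i (B' (t i) w)] =
  P [set w | forall i, C i (W (t i) w) /\ D i (B (t i) w)].

Definition iid_copies M (W B : R -> Omega -> R) (Ws Bs : 'I_M -> R -> Omega -> R) :=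
  [/\ forall m (t : R), 0 <= t ->
        measurable_fun setT (Ws m t) /\ measurable_fun setT (Bs m t),
      forall m, same_law W B (Ws m) (Bs m)
    & mutually_independent (fun o : option 'I_M =>
        if o is Some m then pair_sigma (Ws m) (Bs m) else pair_sigma W B)].

End sigma_algebras.

Section ito.
Context {R : realType} {d : measure_display} {Omega : measurableType d}.
Variable P : probability Omega R.
Variable W : R -> Omega -> R.
Local Notation mu := (@lebesgue_measure R).

(* Simple process  sum_i eta_i 1_{]t_i, t_{i+1}]}. *)
Record simple_process := SimpleProcess {
  sp_size : nat;
  sp_time : nat -> R;
  sp_coef : nat -> Omega -> R }.

Definition simple_adapted (H : simple_process) :=
  [/\ 0 <= sp_time H 0,
      forall i, sp_time H i <= sp_time H i.+1
    & forall i, adapted_to (FW P W (sp_time H i)) (sp_coef H i) /\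
        exists K, forall w, `|sp_coef H i w| <= K ].

Definition simple_val (H : simple_process) (s : R) (w : Omega) : R :=
  \sum_(i < sp_size H)
    sp_coef H i w * \1_(`]sp_time H i, sp_time H i.+1]) s.

Definition simple_int (H : simple_process) (t : R) (w : Omega) : R :=
  \sum_(i < sp_size H) sp_coef H i w *
    (W (Num.min t (sp_time H i.+1)) w - W (Num.min t (sp_time H i)) w).

(* Convergence of U_n >= 0 to 0 in probability; the measurable covers A n avoid
   having to know that the sets {U_n >= e} are events. *)
Definition cvg0_in_prob (U : nat -> Omega -> \bar R) :=
  forall e : R, 0 < e -> exists A : nat -> set Omega,
    [/\ forall n, measurable (A n),
        forall n, [set w | (e%:E <= U n w)%E] `<=` A n
      & P (A n) @[n --> \oo] --> 0%E ].

(* J_t = int_0^t H_s dW_s for t in [0, T], as the limit in probability of the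
   integrals of simple adapted processes approximating H in L^2([0, T], ds) in
   probability. *)
Definition ito_integral (T : R) (H J : R -> Omega -> R) :=
  {ae P, forall w, measurable_fun (`[0, T] : set R) (H ^~ w) /\
     (\int[mu]_(s in `[0%R, T]) ((H s w) ^+ 2)%:E < +oo)%E} /\
  exists Hn : nat -> simple_process,
    [/\ forall n, simple_adapted (Hn n),
        cvg0_in_prob (fun n w =>
          \int[mu]_(s in `[0%R, T]) ((simple_val (Hn n) s w - H s w) ^+ 2)%:E)%E
      & forall t : R, 0 <= t <= T ->
          cvg0_in_prob (fun n w => (`|simple_int (Hn n) t w - J t w|)%:E) ].

Definition sde_solution (T x : R) (b sigma : R -> R) (X : R -> Omega -> R) :=
  [/\ forall t : R, 0 <= t <= T -> adapted_to (FW P W t) (X t),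
      {ae P, forall w, {within `[0, T], continuous (X ^~ w)}},
      {ae P, forall w, mu.-integrable `[0, T] (fun s => (b (X s w))%:E)}
    & exists2 J, ito_integral T (fun s w => sigma (X s w)) J &
      forall t : R, 0 <= t <= T ->
        {ae P, forall w, X t w =
           x + \int[mu]_(s in `[0, t]) b (X s w) + J t w} ].

End ito.

Section projection.
Context {R : realType} {d : measure_display} {Omega : measurableType d}.
Variable P : probability Omega R.

(* V is (a version of) the orthogonal projection of U in L^2 onto the span of
   the components of p. *)
Definition orth_proj n (p : Omega -> 'cV[R]_n) (U V : Omega -> R) :=
  [/\ U \in Lfun P 2%:E, V \in Lfun P 2%:E,
      exists a : 'cV[R]_n, V = (fun w => dot a (p w)) %[ae P]
    & forall c : 'cV[R]_n, ('E_P[(fun w => (U w - V w) * dot c (p w))%R] = 0)%E ].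

End projection.

Section truncation.
Context {R : realType}.

Definition C2b (xi : R -> R) :=
  [/\ forall x, derivable xi x 1,
      forall x, derivable (derive1 xi) x 1,
      continuous (derive1 (derive1 xi))
    & exists K, forall x,
        [/\ `|xi x| <= K, `|derive1 xi x| <= K & `|derive1 (derive1 xi) x| <= K] ].

Definition truncation_fun (xi : R -> R) :=
  [/\ C2b xi,
      forall x, `|x| <= 3 / 2 -> xi x = x,
      forall x, `|xi x| <= 2
    & forall x, `|derive1 xi x| <= 1 ].

Definition truncate (xi : R -> R) (r x : R) : R := r * xi (x / r).

End truncation.

Record coefs (R : realType) := Coefs {
  horizon : R;
  start_point : R;
  drift : R -> R;
  diffusion : R -> R;
  terminal : R -> R;
  driver : R -> R -> R -> R;
  bdriver : R -> R -> R }.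

(* The cells used for one value of N.  The number of cells may depend on k: with
   the normalisation E[p_k p_k^*] = Id all cells have positive probability, so
   that, X_{t_0} being deterministic, there can only be one cell at k = 0. *)
Record cell_basis (R : realType) := Basis {
  xsize : nat -> nat;
  xcell : forall k, 'I_(xsize k) -> set R;
  bsize : nat;
  bcell : 'I_bsize -> set R }.

Definition interval_partition (R : realType) n (c : 'I_n -> set R) :=
  (forall i, measurable (c i)) /\
  exists a b : R, a < b /\ partition setT c `[a, b].

Definition basis_wf (R : realType) (N : nat) (bs : cell_basis R) :=
  [/\ forall k, (k <= N)%N -> (0 < xsize bs k)%N /\ interval_partition (@xcell R bs k),
      (0 < bsize bs)%N & interval_partition (@bcell R bs)].

(* Indices (i_N, i_{k+1}, ..., i_{N-1}) of the products of cells. *)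
Definition widx (L L' N k : nat) : finType :=
  ('I_L * {ffun 'I_(N - k.+1) -> 'I_L'})%type.

(* inl i_N stands for u_{i_N}(X_k); inr (l, (i_N, i)) stands for
   u_{i_N}(X_k) prod_{j > k+l} v_{i_j}(dB_j) dB_{k+l} / sqrt h. *)
Definition pidx (L L' N k : nat) : finType :=
  ('I_L + {l : 'I_(N - k) & widx L L' N (k + l)})%type.

Section paths.
Context {R : realType}.

Definition mesh (cf : coefs R) (N : nat) : R := horizon cf / N%:R.

(* V_{t_{k+1}} - V_{t_k}: Delta B_k for V = B, and Delta W_{k+1} for V = W. *)
Definition incr (cf : coefs R) (N k : nat) (V : R -> R) : R :=
  V (k.+1%:R * mesh cf N) - V (k%:R * mesh cf N).

Fixpoint euler (cf : coefs R) (N k : nat) (W : R -> R) : R :=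
  if k is k'.+1 then
    let X := euler cf N k' W in
    X + mesh cf N * drift cf X + diffusion cf X * incr cf N k' W
  else start_point cf.

End paths.

(* Everything below is a function of a pair of paths w = (W, B), to be evaluated
   on the original Brownian motions as well as on the samples. *)
Section regression_basis.
Context {R : realType} {d : measure_display} {Omega : measurableType d}.
Variables (P : probability Omega R) (W : R -> Omega -> R).
Variables (cf : coefs R) (bs : cell_basis R) (N : nat).
Implicit Type w : ((R -> R) * (R -> R))%type.

Local Notation h := (mesh cf N).

Definition XN k w : R := euler cf N k w.1.
Definition dW k w : R := incr cf N k w.1.
Definition dB k w : R := incr cf N k w.2.

Definition ufun k (i : 'I_(xsize bs k)) (y : R) : R :=
  \1_(xcell i) y /
  Num.sqrt (fine (P [set o | xcell i (euler cf N k (W ^~ o))])).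

Definition vfun (i : 'I_(bsize bs)) (y : R) : R :=
  \1_(bcell i) y / Num.sqrt (fine (normal_prob 0 (Num.sqrt h) (bcell i))).

Definition wcomp k l w (e : widx (xsize bs k) (bsize bs) N l) : R :=
  ufun e.1 (XN k w) * \prod_(j < N - l.+1) vfun (e.2 j) (dB (l.+1 + j) w).

Definition pcoord k w (e : pidx (xsize bs k) (bsize bs) N k) : R :=
  match e with
  | inl i => ufun i (XN k w)
  | inr (existT l e') => wcomp w e' * (dB (k + l) w / Num.sqrt h)
  end.

Definition pdim k : nat := #|pidx (xsize bs k) (bsize bs) N k|.
Definition wdim k : nat := #|widx (xsize bs k) (bsize bs) N k|.

Definition pvec k w : 'cV[R]_(pdim k) := \col_a pcoord w (enum_val a).

Definition vvec k w : 'cV[R]_(pdim k + pdim k) :=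
  col_mx (pvec k w) ((dW k w / Num.sqrt h) *: pvec k w).

(* The components of p_k that involve Delta B_k are those with l = k; here they
   are without the factor Delta B_k / sqrt h. *)
Definition pvec_noinc k w : 'cV[R]_(wdim k) := \col_a wcomp w (enum_val a).

Definition wvec k w : 'cV[R]_(wdim k + wdim k) :=
  col_mx (pvec_noinc k w) ((dW k w / Num.sqrt h) *: pvec_noinc k w).

Definition rho (C0 : R) k w : R := Num.max (enorm (pvec k w) * Num.sqrt C0) 1.
Definition zeta := rho.

End regression_basis.

Section schemes.
Context {R : realType} {d : measure_display} {Omega : measurableType d}.
Variables (P : probability Omega R) (W B : R -> Omega -> R).
Variables (cf : coefs R) (bs : cell_basis R) (N : nat).

Local Notation h := (mesh cf N).
Local Notation f := (driver cf).
Local Notation g := (bdriver cf).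

Definition bpath (w : Omega) : (R -> R) * (R -> R) := (W ^~ w, B ^~ w).

Local Notation X k w := (XN cf N k (bpath w)).
Local Notation dWk k w := (dW cf N k (bpath w)).
Local Notation dBk k w := (dB cf N k (bpath w)).
Local Notation p k w := (pvec P W cf bs N k (bpath w)).
Local Notation v k w := (vvec P W cf bs N k (bpath w)).
Local Notation proj k := (orth_proj P (fun w => p k w)).

Definition orthonormal_basis :=
  forall k, (k <= N)%N -> forall a a' : 'I_(pdim bs N k),
    ('E_P[(fun w => p k w a 0 * p k w a' 0)%R] = (a == a')%:R%:E)%E.

Definition picard_scheme (I : nat) (Y : nat -> nat -> Omega -> R)
    (Z : nat -> Omega -> R) :=
  [/\ Z N = cst 0 %[ae P],
      forall i, (i <= I)%N -> proj N (fun w => terminal cf (X N w)) (Y i N)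
    & forall k, (k < N)%N ->
      [/\ measurable_fun setT (Z k) /\
          exists A1 A2,
          [/\ proj k (fun w => Y I k.+1 w * dWk k w) A1,
              proj k (fun w => dBk k w * g (X k.+1 w) (Y I k.+1 w) * dWk k w) A2
            & Z k = (fun w => h^-1 * A1 w + h^-1 * A2 w) %[ae P]],
          Y 0%N k = cst 0 %[ae P]
        & forall i, (1 <= i <= I)%N ->
          measurable_fun setT (Y i k) /\
          exists A1 A2 A3,
          [/\ proj k (Y I k.+1) A1,
              proj k (fun w => f (X k w) (Y i.-1 k w) (Z k w)) A2,
              proj k (fun w => dBk k w * g (X k.+1 w) (Y I k.+1 w)) A3
            & Y i k = (fun w => A1 w + h * A2 w + A3 w) %[ae P]] ]].

Definition picard_limit (I : nat) (Y : nat -> nat -> Omega -> R)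
    (Z Yinf : nat -> Omega -> R) :=
  forall k, (k < N)%N ->
    adapted_to (FWB P W B (horizon cf) (k%:R * h)) (Yinf k) /\
    proj k (fun w => Y I k.+1 w + h * f (X k w) (Yinf k w) (Z k w)
                     + dBk k w * g (X k.+1 w) (Y I k.+1 w)) (Yinf k).

Section sampled.
Variables (C0 : R) (xi : R -> R) (I M : nat) (Ws Bs : 'I_M -> R -> Omega -> R).
Variables (alpha beta : forall k, nat -> Omega -> 'cV[R]_(pdim bs N k)).

Definition spath (m : 'I_M) (w : Omega) : (R -> R) * (R -> R) :=
  (Ws m ^~ w, Bs m ^~ w).

Local Notation Xs k m w := (XN cf N k (spath m w)).
Local Notation ps k m w := (pvec P W cf bs N k (spath m w)).
Local Notation vs k m w := (vvec P W cf bs N k (spath m w)).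

Definition VM k (w : Omega) : 'M[R]_(pdim bs N k + pdim bs N k) :=
  M%:R^-1 *: \sum_(m < M) vs k m w *m (vs k m w)^T.

Definition PM k (w : Omega) : 'M[R]_(pdim bs N k) :=
  M%:R^-1 *: \sum_(m < M) ps k m w *m (ps k m w)^T.

Definition good_step j : set Omega :=
  [set w | eignorm (VM j w - 1%:M) <= h /\ eignorm (PM j w - 1%:M) <= h].

Definition good_event k : set Omega :=
  \bigcap_(j in [set j | (k <= j < N)%N]) good_step j.

(* Y^{N,I,I,M,m}_{t_k} *)
Definition YMs k (m : 'I_M) (w : Omega) : R :=
  truncate xi (rho P W cf bs N C0 k (spath m w)) (dot (alpha k I w) (ps k m w)).

Definition empirical_risk k i (w : Omega) (a b : 'cV[R]_(pdim bs N k)) : R :=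
  M%:R^-1 * \sum_(m < M)
   `| YMs k.+1 m w - dot a (ps k m w)
      + h * f (Xs k m w) (dot (alpha k i.-1 w) (ps k m w))
                         (dot (beta k i.-1 w) (ps k m w))
      + dB cf N k (spath m w) * g (Xs k.+1 m w) (YMs k.+1 m w)
      - dot b (ps k m w) * dW cf N k (spath m w) | ^+ 2.

(* The arg min may fail to be unique off the event [good_event k]; any
   measurable selection is allowed. *)
Definition regression_scheme :=
  [/\ forall k i a, (k <= N)%N -> (i <= I)%N ->
        measurable_fun setT (fun w => alpha k i w a 0) /\
        measurable_fun setT (fun w => beta k i w a 0),
      exists2 c : 'cV[R]_(pdim bs N N),
        proj N (fun w => terminal cf (X N w)) (fun w => dot c (p N w)) &
        forall i w, (1 <= i <= I)%N -> alpha N i w = c /\ beta N i w = 0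
    & forall k w, (k < N)%N ->
        [/\ alpha k 0 w = 0, beta k 0 w = 0
          & forall i, (1 <= i <= I)%N -> forall a b : 'cV[R]_(pdim bs N k),
              empirical_risk i w (alpha k i w) (beta k i w)
                <= empirical_risk i w a b ] ].

Definition YM k (w : Omega) : R :=
  truncate xi (rho P W cf bs N C0 k (bpath w)) (dot (alpha k I w) (p k w)).

Definition ZM k (w : Omega) : R :=
  truncate xi (zeta P W cf bs N C0 k (bpath w))
    (Num.sqrt h * dot (beta k I w) (p k w)) / Num.sqrt h.

End sampled.

Section error.
Variable C0 : R.

Definition rhoW k (w : Omega) : R := rho P W cf bs N C0 k (bpath w).
Definition zetaW k (w : Omega) : R := zeta P W cf bs N C0 k (bpath w).

Local Notation Erho2 k := ('E_P[(fun w => `|rhoW k w| ^+ 2)%R])%E.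
Local Notation Ezeta2 k := ('E_P[(fun w => `|zetaW k w| ^+ 2)%R])%E.
Local Notation vsq k w := (enorm (v k w) ^+ 2).
Local Notation psq k w := (enorm (p k w) ^+ 2).
Local Notation wsq k w := (enorm (wvec P W cf bs N k (bpath w)) ^+ 2).

Definition eps k : \bar R :=
  ('E_P[(fun w => frobenius (v k w *m (v k w)^T - 1%:M) ^+ 2)%R]
     * (Erho2 k + Ezeta2 k)
   + 'E_P[(fun w => vsq k w * psq k.+1 w)%R] * Erho2 k.+1
   + (h ^+ 2)%:E * \int[P]_w
       ((vsq k w)%:E * (1 + (`|X k w| ^+ 2)%:E + (psq k w)%:E * Erho2 k
                        + h^-1%:E * (psq k w)%:E * Ezeta2 k))
   + h%:E * \int[P]_w
       ((vsq k w + wsq k w)%:E *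
        (1 + (`|X k.+1 w| ^+ 2)%:E + (psq k.+1 w)%:E * Erho2 k.+1)))%E.

End error.

End schemes.

(* Main.v *)
Require Import Defs.
From HB Require Import structures.
From mathcomp Require Import all_boot all_order all_algebra.
From mathcomp Require Import all_classical all_reals all_analysis.
From mathcomp Require Import measurable_realfun.
From mathcomp Require Import ring lra.

(** Why the bound holds.

    Fix the mesh h.  The scheme and the samples only see the increments of the
    Brownian motions and of their copies over the grid, a finite family of
    independent centered Gaussian variables of variance h.  Measurability and
    independence are therefore expressed with the sigma-algebras generated by
    blocks of increments ([block_independent], [freezing]).

    The exact scheme.  As the components of p_k are orthonormal, projections
    are given by coefficients: Y_k = al_k . p_k, its Picard limit is
    ai_k . p_k, and Z_k = be_k . p_k ([picard_scheme_coordinates]).  The vector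
    theta_k = (ai_k, sqrt h be_k) consists of the coefficients, on the
    regressors v_k, of the target
    xi_k = Y_{k+1} + h f(X_k, ai_k . p_k, be_k . p_k) + dB_k g(X_{k+1}, Y_{k+1})
    ([theta_identity]), and stopping the Picard iterations costs
    |al_k - ai_k|^2 <= (h^2 Lf)^I |ai_k|^2 ([picard_contraction_coef]).

    One regression.  On the good event the empirical Gram matrices are within
    h of the identity, the normal equations determine the coefficients, and
    the driver, which carries a factor h, makes the iterations contract.
    [regression_step] bounds the squared error of the coefficients by
    (1 + C h) times the error of the data at step k+1, plus C/h times the
    squared defect, which is the empirical mean of v_k (xi_k - theta_k . v_k),
    plus C h^(I-1).  The defect is a mean of M independent centered copies,
    hence E |defect|^2 <= C eps_k / M ([defect_mean]).  The terms of eps_k with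
    w_k come from the components of v_k that contain dB_k: there dB_k^2 meets
    another dB_k^2 / h and a fourth moment of order h^2 is needed
    ([weighted_increment_mean]).

    Going back in time.  The data at step k+1 differ from the exact ones by
    dY + dB_k dg, where dB_k is independent of everything that the later
    regressions use.  The cross term vanishes, and the second moment is at most
    (1 + C h) E |dY|^2; the truncation does not spoil this, being Lipschitz
    with constant 1 and equal to the identity on the exact values
    ([propagated_error]).  The recursion [regression_recursion] follows, and a
    discrete Gronwall inequality sums it up.

    Back to Y and Z.  On the good event the coefficients are functions of the
    samples alone, so that the original path can be integrated out with the
    coefficients frozen ([frozen_second_moment]) and E |dY|^2 is E of the
    squared error of the coefficients.  Off the good event both Y and its
    approximation are bounded by multiples of rho, with a total of 9 rho^2, and
    likewise for sqrt h Z.  For I = 1 this crude bound alone is enough, since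
    h^(I-1) = 1. *)

Set Implicit Arguments.
Unset Strict Implicit.
Unset Printing Implicit Defensive.

Import Order.TTheory GRing.Theory Num.Theory.
Import numFieldNormedType.Exports.

Local Open Scope classical_set_scope.
Local Open Scope ring_scope.

(** * Independence and freezing *)
Section independence.
Context {R : realType} {d : measure_display} {Omega : measurableType d}.
Variable P : probability Omega R.

(** For fixed B, both sides are finite measures in A; they agree on a pi-system. *)
Lemma independent_generated (G H : set (set Omega)) :
  G `<=` measurable -> setI_closed G ->
  H `<=` measurable -> setI_closed H ->
  independent2 P G H -> independent2 P <<s G >> <<s H >>.
Proof.
move=> Gm GI Hm HI GH.
have ext (K : set (set Omega)) B : K `<=` measurable -> setI_closed K ->
    measurable B -> (forall A, K A -> P (A `&` B) = (P A * P B)%E) ->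
    forall A, <<s K >> A -> P (A `&` B) = (P A * P B)%E.
  move=> Km KI mB KB A sKA.
  have PBfin : P B \is a fin_num by exact: fin_num_measure.
  pose m2 := mscale (NngNum (fine_ge0 (measure_ge0 P B))) P.
  have m2E C : m2 C = (P C * P B)%E.
    by rewrite /m2 /mscale /= fineK// muleC.
  rewrite -m2E.
  have -> : P (A `&` B) = mrestr P mB A by [].
  pose K' := [set C | K C \/ C = setT].
  apply: (@g_sigma_algebra_measure_unique _ _ _ K' _ (fun=> setT)) => //.
  - by move=> C [/Km//|->].
  - by move=> i; right.
  - by rewrite bigcup_const.
  - move=> C D [KC|->] [KD|->]; rewrite ?setTI ?setIT; by [left; apply: KI|left|right].
  - move=> C K'C; rewrite -[RHS]/(m2 C) m2E /= /mrestr.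
    by case: K'C => [/KB//|->]; rewrite setTI probability_setT mul1e.
  - by move=> k; rewrite /= /mrestr setTI -ge0_fin_numE.
  - by move: A sKA; apply: sub_sigma_algebra2 => C; left.
have sG : <<s G >> `<=` measurable by apply: smallest_sub => //; exact: sigma_algebra_measurable.
have sH : <<s H >> `<=` measurable by apply: smallest_sub => //; exact: sigma_algebra_measurable.
move=> A B sA sB; apply: (ext G) => //; first exact: sH.
move=> {sA}A GA; rewrite setIC muleC.
apply: (ext H) => //; first exact: Gm.
by move=> C HC; rewrite setIC muleC; exact: GH.
Qed.

End independence.

(** * Sigma-algebras generated by families of real functions *)
Definition coord_sets (R : realType) (T J : Type) (x : J -> T -> R) (S : set J) :
    set (set T) :=
  [set A | exists2 j, S j & exists2 C, measurable C & A = x j @^-1` C].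

Section generated.
Context {R : realType} {T : pointedType} {J : Type} (x : J -> T -> R).
Implicit Types S : set J.

Lemma measurable_coord S j : S j ->
  measurable_fun (setT : set (g_sigma_algebraType (coord_sets x S))) (x j).
Proof.
move=> Sj _ C mC; rewrite setTI; apply: sub_gen_smallest.
by exists j => //; exists C.
Qed.

Lemma measurable_to_coord d' (T' : measurableType d') S (f : T' -> T) :
  (forall j, S j -> measurable_fun setT (x j \o f)) ->
  measurable_fun setT (f : T' -> g_sigma_algebraType (coord_sets x S)).
Proof.
move=> mf; apply: (@measurability _ _ T' (g_sigma_algebraType (coord_sets x S)) setT f
  (coord_sets x S) erefl) => _ [_ [j Sj [C mC ->]] <-].
exact: (mf j Sj measurableT C mC).
Qed.

(** The pi-system behind [coord_sets]. *)
Definition cylinders S : set (set T) :=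
  [set A | exists2 C : J -> set R, (forall j, measurable (C j)) &
           A = [set w | forall j, S j -> C j (x j w)]].

Lemma cylinders_setI S : setI_closed (cylinders S).
Proof.
move=> _ _ [C mC ->] [D mD ->]; exists (fun j => C j `&` D j).
  by move=> j; exact: measurableI.
apply/seteqP; split=> w /=.
  by move=> [Cw Dw] j Sj; split; [exact: Cw|exact: Dw].
by move=> CDw; split => j Sj; have [] := CDw j Sj.
Qed.

Lemma coord_sets_cylinders S : coord_sets x S `<=` cylinders S.
Proof.
move=> _ [j Sj [C mC ->]].
exists (fun i => if pselect (i = j) then C else setT).
  by move=> i; case: (pselect (i = j)) => [?|?] /=; [exact: mC|exact: measurableT].
apply/seteqP; split=> w /=.
  by move=> Cw i Si; case: pselect => //= ij; rewrite ij; exact: Cw.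
by move=> /(_ j Sj); case: pselect.
Qed.

Lemma sigma_coord_sub S : <<s coord_sets x S >> `<=` <<s cylinders S >>.
Proof. by apply: sub_sigma_algebra2; exact: coord_sets_cylinders. Qed.
End generated.

Section blocks.
Context {R : realType} {d : measure_display} {Omega : measurableType d}.
Variable P : probability Omega R.

Definition jointly_independent (J : finType) (x : J -> Omega -> R) :=
  forall C : J -> set R, (forall j, measurable (C j)) ->
  P [set w | forall j, C j (x j w)] = (\prod_(j : J) P (x j @^-1` C j))%E.

Context {J : finType} (x : J -> Omega -> R).
Hypothesis mx : forall j, measurable_fun setT (x j).

Lemma cylinders_measurable (S : set J) : cylinders x S `<=` measurable.
Proof.
move=> _ [C mC ->].
rewrite (_ : [set w | _] = \bigcap_(j in S) (x j @^-1` C j)).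
  apply: fin_bigcap_measurable => // j _.
  by rewrite -[X in measurable X]setTI; exact: mx.
by apply/seteqP; split=> w.
Qed.

Lemma coord_sets_measurable (S : set J) :
  <<s coord_sets x S >> `<=` measurable.
Proof.
apply: smallest_sub; first exact: sigma_algebra_measurable.
move=> A /coord_sets_cylinders; exact: cylinders_measurable.
Qed.

Lemma blocks_independent (S S' : set J) : jointly_independent x ->
  (forall j, S j -> ~ S' j) ->
  independent2 P <<s coord_sets x S >> <<s coord_sets x S' >>.
Proof.
move=> indep SS' A B /sigma_coord_sub sA /sigma_coord_sub sB.
apply: (independent_generated _ _ _ _ _ sA sB).
- exact: cylinders_measurable.
- exact: cylinders_setI.
- exact: cylinders_measurable.
- exact: cylinders_setI.
move=> {sA sB}_ _ [C mC ->] [D mD ->].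
pose CS j := if pselect (S j) then C j else setT.
pose DS j := if pselect (S' j) then D j else setT.
have cylE (U : set J) (E : J -> set R) :
    [set w | forall j, U j -> E j (x j w)] =
    [set w | forall j, (if pselect (U j) then E j else setT) (x j w)].
  apply/seteqP; split=> w /= Ew j; first by case: pselect => // Uj; exact: Ew.
  by move=> Uj; have := Ew j; case: pselect.
have mCS j : measurable (CS j) by rewrite /CS; case: pselect => [?|?] /=; [exact: mC|exact: measurableT].
have mDS j : measurable (DS j) by rewrite /DS; case: pselect => [?|?] /=; [exact: mD|exact: measurableT].
have -> : [set w | forall j, S j -> C j (x j w)] = [set w | forall j, CS j (x j w)].
  exact: cylE.
have -> : [set w | forall j, S' j -> D j (x j w)] = [set w | forall j, DS j (x j w)].
  exact: cylE.
rewrite (_ : _ `&` _ = [set w | forall j, (CS j `&` DS j) (x j w)]); last first.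
  apply/seteqP; split=> w /=; first by move=> [Cw Dw] j; split; [exact: Cw|exact: Dw].
  by move=> CDw; split => j; have [] := CDw j.
rewrite (indep (fun j => CS j `&` DS j)); last by move=> j; exact: measurableI.
rewrite (indep CS mCS) (indep DS mDS).
rewrite -big_split /=; apply: eq_bigr => j _.
rewrite /CS /DS; case: pselect => Sj; case: pselect => S'j.
- by case: (SS' j Sj).
- by rewrite setIT preimage_setT probability_setT mule1.
- by rewrite setTI preimage_setT probability_setT mul1e.
- by rewrite setTI preimage_setT probability_setT mule1.
Qed.

End blocks.

Section freezing.
Context {R : realType} {d : measure_display} {Omega : measurableType d}.
Variable P : probability Omega R.
Context {G1 G2 : set (set Omega)}.
Hypotheses (sG1 : <<s G1 >> `<=` measurable) (sG2 : <<s G2 >> `<=` measurable).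
Hypothesis G12 : independent2 P <<s G1 >> <<s G2 >>.
Let T1 := g_sigma_algebraType G1.
Let T2 := g_sigma_algebraType G2.

Let m1 : measurable_fun setT (id : Omega -> T1).
Proof. by move=> _ A /sG1; rewrite setTI. Qed.
Let m2 : measurable_fun setT (id : Omega -> T2).
Proof. by move=> _ A /sG2; rewrite setTI. Qed.
Let i1 : {mfun Omega >-> T1} := mfun_Sub (mem_set m1).
Let i2 : {mfun Omega >-> T2} := mfun_Sub (mem_set m2).
Let P1 : probability T1 R := distribution P i1.
Let P2 : probability T2 R := distribution P i2.
Let m12 : measurable_fun setT (fun w : Omega => (w : T1, w : T2)).
Proof. exact: measurable_fun_pair m1 m2. Qed.
Let i12 : {mfun Omega >-> (T1 * T2)%type} := mfun_Sub (mem_set m12).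

Let lawE X : measurable X -> (P1 \x P2)%E X = distribution P i12 X.
Proof.
apply: product_measure_unique => A B mA mB.
exact: G12.
Qed.

(** Independence says that the diagonal map sends P to the product of its
    restrictions to the two sigma-algebras; the rest is Tonelli. *)
Lemma freezing (F : Omega -> Omega -> \bar R) :
  @measurable_fun _ _ (T1 * T2)%type (\bar R) setT (fun z => F z.1 z.2) ->
  (forall w w', 0 <= F w w')%E ->
  (\int[P]_w F w w = \int[P]_w \int[P]_w' F w w')%E.
Proof.
move=> mF F0.
transitivity (\int[(P1 \x P2)%E]_z F z.1 z.2)%E.
  rewrite (eq_measure_integral (distribution P i12)); last by move=> A mA _; exact: lawE.
  by rewrite ge0_integral_distribution.
rewrite fubini_tonelli1 //.
have mF1 : measurable_fun setT (fubini_F P2 (fun z : (T1 * T2)%type => F z.1 z.2)).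
  exact: measurable_fun_fubini_tonelli_F.
rewrite ge0_integral_distribution //; last first.
  by move=> w; apply: integral_ge0.
apply: eq_integral => w _ /=.
rewrite /fubini_F ge0_integral_distribution //=.
exact: measurableT_comp mF (@pair1_measurable _ _ T1 T2 w).
Qed.

Lemma independent_integralM (U V : Omega -> R) :
  measurable_fun (setT : set T1) U -> measurable_fun (setT : set T2) V ->
  P.-integrable setT (EFin \o U) -> P.-integrable setT (EFin \o V) ->
  P.-integrable setT (fun w => (U w * V w)%:E) ->
  (\int[P]_w (U w * V w)%:E = \int[P]_w (U w)%:E * \int[P]_w (V w)%:E)%E.
Proof.
move=> mU mV iU iV iUV.
pose F (z : (T1 * T2)%type) := (U z.1 * V z.2)%:E.
have mF : measurable_fun setT F.
  apply/measurable_EFinP; apply: measurable_funM.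
    exact: measurableT_comp mU measurable_fst.
  exact: measurableT_comp mV measurable_snd.
have iF : (P1 \x P2)%E.-integrable setT F.
  apply/integrableP; split => //.
  rewrite (eq_measure_integral (distribution P i12)); last by move=> A mA _; exact: lawE.
  rewrite ge0_integral_distribution //; last exact: measurableT_comp.
  by have /integrableP[_] := iUV.
transitivity (\int[(P1 \x P2)%E]_z F z)%E.
  rewrite (eq_measure_integral (distribution P i12)); last by move=> A mA _; exact: lawE.
  by rewrite integral_distribution.
rewrite -integral12_prod_meas1 // /fubini_F.
have EV : (\int[P2]_y (V y)%:E = \int[P]_w (V w)%:E)%E.
  by rewrite integral_distribution//; exact/measurable_EFinP.
have iV2 : P2.-integrable setT (EFin \o V).
  apply/integrableP; split; first exact/measurable_EFinP.
  rewrite ge0_integral_distribution//; last by apply: measurableT_comp => //; exact/measurable_EFinP.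
  by have /integrableP[_] := iV.
under eq_integral => x _.
  under eq_integral do rewrite /F/= EFinM.
  rewrite integralZl// EV -(fineK (integrable_fin_num measurableT iV)).
  over.
rewrite integral_distribution//; last 2 first.
- by apply: emeasurable_funM => //; exact/measurable_EFinP.
- by apply: integrableZr => //.
by rewrite /= integralZr// fineK// integrable_fin_num.
Qed.

End freezing.

Section independent_products.
Context {R : realType} {d : measure_display} {Omega : measurableType d}.
Variable P : probability Omega R.
Context {G1 G2 : set (set Omega)}.
Hypotheses (sG1 : <<s G1 >> `<=` measurable) (sG2 : <<s G2 >> `<=` measurable).
Hypothesis G12 : independent2 P <<s G1 >> <<s G2 >>.
Let T1 := g_sigma_algebraType G1.
Let T2 := g_sigma_algebraType G2.

Let mfst (U : Omega -> R) : measurable_fun (setT : set T1) U ->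
  measurable_fun setT (fun z : (T1 * T2)%type => U z.1).
Proof. by move=> mU; apply: (measurableT_comp mU); exact: measurable_fst. Qed.
Let msnd (U : Omega -> R) : measurable_fun (setT : set T2) U ->
  measurable_fun setT (fun z : (T1 * T2)%type => U z.2).
Proof. by move=> mU; apply: (measurableT_comp mU); exact: measurable_snd. Qed.

Lemma measurable_sub1 (U : Omega -> R) :
  measurable_fun (setT : set T1) U -> measurable_fun setT U.
Proof. by move=> mU _ C mC; apply: sG1; exact: mU. Qed.
Lemma measurable_sub2 (U : Omega -> R) :
  measurable_fun (setT : set T2) U -> measurable_fun setT U.
Proof. by move=> mU _ C mC; apply: sG2; exact: mU. Qed.

Lemma independent_ge0_integralM (U V : Omega -> R) :
  measurable_fun (setT : set T1) U -> measurable_fun (setT : set T2) V ->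
  (forall w, 0 <= U w) -> (forall w, 0 <= V w) ->
  (\int[P]_w (U w * V w)%:E = \int[P]_w (U w)%:E * \int[P]_w (V w)%:E)%E.
Proof.
move=> mU mV U0 V0.
have mV' := measurable_sub2 mV; have mU' := measurable_sub1 mU.
rewrite (freezing sG1 sG2 G12 (F := fun w w' => (U w * V w')%:E)); last first.
- by move=> w w'; rewrite lee_fin mulr_ge0.
- by apply/measurable_EFinP/measurable_funM; [exact: mfst|exact: msnd].
under eq_integral => w _.
  under eq_integral do rewrite EFinM.
  rewrite ge0_integralZl//; last 3 first.
  - exact/measurable_EFinP.
  - by move=> x _; rewrite lee_fin.
  - by rewrite lee_fin.
  over.
rewrite ge0_integralZr//.
- exact/measurable_EFinP.
- by move=> x _; rewrite lee_fin.
- by apply: integral_ge0 => x _; rewrite lee_fin.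
Qed.

(** Freezing U and V, the cross term 2 U V E[Z] vanishes.  Working with
    extended nonnegative integrals lets U and V range over coefficients whose
    second moments are not known to be finite. *)
Lemma independent_second_moment (U V Z : Omega -> R) (s : R) :
  measurable_fun (setT : set T1) U -> measurable_fun (setT : set T1) V ->
  measurable_fun (setT : set T2) Z ->
  P.-integrable setT (EFin \o Z) ->
  (\int[P]_w (Z w)%:E = 0)%E -> (\int[P]_w (Z w ^+ 2)%:E = s%:E)%E ->
  (\int[P]_w ((U w + V w * Z w) ^+ 2)%:E =
   \int[P]_w (U w ^+ 2)%:E + s%:E * \int[P]_w (V w ^+ 2)%:E)%E.
Proof.
move=> mU mV mZ iZ EZ EZ2.
have s0 : 0 <= s by rewrite -lee_fin -EZ2; apply: integral_ge0 => w _; rewrite lee_fin sqr_ge0.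
have [[mU' mV'] mZ'] := (measurable_sub1 mU, measurable_sub1 mV, measurable_sub2 mZ).
have mZ2 : measurable_fun setT (fun w => Z w ^+ 2) by exact: measurable_funX.
rewrite (freezing sG1 sG2 G12 (F := fun w w' => ((U w + V w * Z w') ^+ 2)%:E)); last first.
- by move=> w w'; rewrite lee_fin sqr_ge0.
- apply/measurable_EFinP; apply: measurable_funX; apply: measurable_funD.
    exact: mfst.
  by apply: measurable_funM; [exact: mfst|exact: msnd].
have iZ2 : P.-integrable setT (fun w => (Z w ^+ 2)%:E).
  apply/integrableP; split; first exact/measurable_EFinP.
  under eq_integral do rewrite gee0_abs ?lee_fin ?sqr_ge0//.
  by rewrite EZ2 ltry.
have inner u v : (\int[P]_w ((u + v * Z w) ^+ 2)%:E = (u ^+ 2)%:E + s%:E * (v ^+ 2)%:E)%E.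
  under eq_integral => w _.
    rewrite (_ : ((u + v * Z w) ^+ 2)%:E =
      ((u ^+ 2)%:E + (2 * u * v)%:E * (Z w)%:E) + (v ^+ 2)%:E * (Z w ^+ 2)%:E)%E; last first.
      by rewrite -!EFinM -!EFinD; congr EFin; ring.
    over.
  have iu : P.-integrable setT (fun=> (u ^+ 2)%:E : \bar R).
    exact: finite_measure_integrable_cst.
  have iuv : P.-integrable setT (fun w => (2 * u * v)%:E * (Z w)%:E)%E.
    exact: integrableZl.
  rewrite integralD//; last 2 first.
  - exact: integrableD.
  - exact: integrableZl.
  have Eu : (\int[P]_w (u ^+ 2)%:E = (u ^+ 2)%:E)%E.
    by rewrite -[RHS](expectation_cst P) unlock.
  by rewrite integralD// !integralZl// EZ EZ2 Eu mule0 adde0 muleC.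
under eq_integral do rewrite inner.
rewrite ge0_integralD//; last 4 first.
- by move=> w _; rewrite lee_fin sqr_ge0.
- by apply/measurable_EFinP; exact: measurable_funX.
- by move=> w _; rewrite mule_ge0// lee_fin sqr_ge0.
- by apply: measurable_funeM; apply/measurable_EFinP; exact: measurable_funX.
congr (_ + _)%E; rewrite ge0_integralZl//.
- by apply/measurable_EFinP; exact: measurable_funX.
- by move=> w _; rewrite lee_fin sqr_ge0.
Qed.

End independent_products.

(** * Euclidean linear algebra *)
Section dot_theory.
Context {R : realType}.

Lemma dotE n (a b : 'cV[R]_n) : dot a b = (a^T *m b) 0 0.
Proof. by rewrite /dot !mxE; apply: eq_bigr => i _; rewrite mxE. Qed.

Lemma dotC n (a b : 'cV[R]_n) : dot a b = dot b a.
Proof. by rewrite /dot; apply: eq_bigr => i _; rewrite mulrC. Qed.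

Lemma dotDl n (a b c : 'cV[R]_n) : dot (a + b) c = dot a c + dot b c.
Proof. by rewrite !dotE linearD mulmxDl mxE. Qed.

Lemma dotDr n (a b c : 'cV[R]_n) : dot c (a + b) = dot c a + dot c b.
Proof. by rewrite dotC dotDl !(dotC c). Qed.

Lemma dotZl n (k : R) (a b : 'cV[R]_n) : dot (k *: a) b = k * dot a b.
Proof. by rewrite !dotE linearZ /= -scalemxAl mxE. Qed.

Lemma dotZr n (k : R) (a b : 'cV[R]_n) : dot a (k *: b) = k * dot a b.
Proof. by rewrite dotC dotZl dotC. Qed.

Lemma dotNl n (a b : 'cV[R]_n) : dot (- a) b = - dot a b.
Proof. by rewrite -scaleN1r dotZl mulN1r. Qed.

Lemma dotNr n (a b : 'cV[R]_n) : dot a (- b) = - dot a b.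
Proof. by rewrite dotC dotNl dotC. Qed.

Lemma dotBl n (a b c : 'cV[R]_n) : dot (a - b) c = dot a c - dot b c.
Proof. by rewrite dotDl dotNl. Qed.

Lemma dotBr n (a b c : 'cV[R]_n) : dot c (a - b) = dot c a - dot c b.
Proof. by rewrite dotDr dotNr. Qed.

Lemma dot0l n (a : 'cV[R]_n) : dot 0 a = 0.
Proof. by rewrite -(scale0r (0 : 'cV[R]_n)) dotZl mul0r. Qed.

Lemma dot0r n (a : 'cV[R]_n) : dot a 0 = 0.
Proof. by rewrite dotC dot0l. Qed.

Lemma dot_sumr n (J : Type) (r : seq J) (p : pred J) (F : J -> 'cV[R]_n) a :
  dot a (\sum_(j <- r | p j) F j) = \sum_(j <- r | p j) dot a (F j).
Proof.
by apply: (big_morph (dot a)) => [x y|]; rewrite ?dotDr ?dot0r.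
Qed.

Lemma dot_mulmx m n (a : 'cV[R]_m) (A : 'M[R]_(m, n)) (b : 'cV[R]_n) :
  dot a (A *m b) = dot (A^T *m a) b.
Proof. by rewrite !dotE trmx_mul trmxK mulmxA. Qed.

Lemma dot_col_mx m n (a c : 'cV[R]_m) (b e : 'cV[R]_n) :
  dot (col_mx a b) (col_mx c e) = dot a c + dot b e.
Proof. by rewrite !dotE tr_col_mx mul_row_col mxE. Qed.

Lemma dot_ge0 n (a : 'cV[R]_n) : 0 <= dot a a.
Proof. by apply: sumr_ge0 => i _; rewrite -expr2 sqr_ge0. Qed.

Lemma dot_eq0 n (a : 'cV[R]_n) : (dot a a == 0) = (a == 0).
Proof.
apply/idP/eqP => [|->]; last by rewrite dot0l eqxx.
rewrite psumr_eq0; last by move=> i _; rewrite -expr2 sqr_ge0.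
move=> /allP a0; apply/matrixP => i j; rewrite ord1 mxE.
by have := a0 i (mem_index_enum _); rewrite -expr2 sqrf_eq0 => /eqP.
Qed.

Lemma dot_sqr n (a : 'cV[R]_n) : dot a a = \sum_i a i 0 ^+ 2.
Proof. by apply: eq_bigr => i _; rewrite expr2. Qed.

Lemma enorm_sqr n (a : 'cV[R]_n) : enorm a ^+ 2 = dot a a.
Proof. by rewrite sqr_sqrtr// dot_ge0. Qed.

Lemma enorm_ge0 n (a : 'cV[R]_n) : 0 <= enorm a.
Proof. exact: sqrtr_ge0. Qed.

Lemma dot_CS n (a b : 'cV[R]_n) : dot a b ^+ 2 <= dot a a * dot b b.
Proof.
have [/eqP b0|b0] := boolP (dot b b == 0).
  have /eqP -> : b == 0 by rewrite -dot_eq0 b0.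
  by rewrite !dot0r mulr0 expr0n.
have bp : 0 < dot b b by rewrite lt_def b0 dot_ge0.
have := dot_ge0 (dot b b *: a - dot a b *: b).
rewrite dotBl !dotBr !dotZl !dotZr (dotC b a) => H.
have {}H : 0 <= dot b b * (dot a a * dot b b - dot a b ^+ 2) by lra.
by rewrite pmulr_rge0 // subr_ge0 in H.
Qed.

Lemma dot_CS_abs n (a b : 'cV[R]_n) : `|dot a b| <= enorm a * enorm b.
Proof.
rewrite -[leRHS]ger0_norm ?mulr_ge0 ?enorm_ge0// -ler_sqr ?nnegrE//.
by rewrite !real_normK ?num_real// exprMn !enorm_sqr dot_CS.
Qed.

Lemma dot_eps n (a b : 'cV[R]_n) (t : R) : 0 < t ->
  dot (a + b) (a + b) <= (1 + t) * dot a a + (1 + t^-1) * dot b b.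
Proof.
move=> t0; have := dot_ge0 (t *: a - b).
rewrite dotBl !dotBr !dotZl !dotZr (dotC b a) => H.
rewrite dotDl !dotDr (dotC b a) -subr_ge0 -(pmulr_rge0 _ t0).
have -> : t * ((1 + t) * dot a a + (1 + t^-1) * dot b b -
   (dot a a + dot a b + (dot a b + dot b b))) =
   t * (t * dot a a) - t * dot a b - (t * dot a b - dot b b).
  by field; rewrite gt_eqF.
by [].
Qed.

Lemma dot_add_le n (a b : 'cV[R]_n) :
  dot (a + b) (a + b) <= 2 * dot a a + 2 * dot b b.
Proof. by have := dot_eps a b (@ltr01 R); rewrite invr1. Qed.

End dot_theory.

Section symmetric_matrices.
Context {R : realType}.

Lemma continuous_dot_row n (S : 'M[R]_n) :
  continuous (fun x : 'rV[R]_n => dot (x^T) (S *m x^T)).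
Proof.
have cc (i : 'I_n) : continuous (fun x : 'rV[R]_n => x 0 i).
  exact: coord_continuous.
have csum (F : 'I_n -> 'rV[R]_n -> R) : (forall i, continuous (F i)) ->
    continuous (fun x => \sum_i F i x).
  move=> cF; apply: continuous_big => [|i _]; last exact: cF.
  by move=> z; exact: add_continuous.
apply: (csum (fun i x => x^T i 0 * (S *m x^T) i 0)) => i.
rewrite (_ : (fun x => _) =
    (fun x : 'rV[R]_n => x 0 i) \* (fun x => \sum_j S i j * x 0 j)); last first.
  apply/funext => x; rewrite /= !mxE; congr (_ * _).
  by apply: eq_bigr => j _; rewrite mxE.
move=> x; apply: continuousM; first exact: cc.
apply: (csum (fun j (x : 'rV[R]_n) => S i j * x 0 j)) => j y.
by apply: (@continuousM _ _ (cst (S i j))); [exact: cst_continuous|exact: cc].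
Qed.

Lemma quad_sum_bound n (S : 'M[R]_n) (x : 'cV[R]_n) :
  `|dot x (S *m x)| <= (\sum_i \sum_j `|S i j|) * dot x x.
Proof.
have xi i : `|x i 0| ^+ 2 <= dot x x.
  rewrite dot_sqr (bigD1 i)//= real_normK ?num_real// lerDl.
  by apply: sumr_ge0 => j _; exact: sqr_ge0.
rewrite {1}/dot mulr_suml (le_trans (ler_norm_sum _ _ _))// ler_sum// => i _.
rewrite mxE normrM (le_trans (ler_wpM2l (normr_ge0 _) (ler_norm_sum _ _ _)))//.
rewrite mulr_sumr mulr_suml ler_sum// => j _.
rewrite normrM mulrCA ler_wpM2l//.
have := xi i; have := xi j; have := sqr_ge0 (`|x i 0| - `|x j 0|); nra.
Qed.

(** A maximiser of the Rayleigh quotient is an eigenvector. *)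
Lemma rayleigh_max n (S : 'M[R]_n.+1) : S^T = S ->
  exists2 l : R, eigenvalue S l & forall x : 'cV[R]_n.+1,
    dot x (S *m x) <= l * dot x x.
Proof.
move=> symS.
pose A : set 'rV[R]_n.+1 := [set x | dot x^T x^T = 1].
have dot1 (x : 'rV[R]_n.+1) : dot x^T x^T = dot x^T (1%:M *m x^T).
  by rewrite mul1mx.
have A0 : A !=set0.
  exists (delta_mx 0 0); rewrite /A /= dot_sqr (bigD1 0)//= !mxE !eqxx expr1n.
  by rewrite big1 ?addr0// => i /negbTE i0; rewrite !mxE eqxx i0 expr0n.
have cA : compact A.
  apply: bounded_closed_compact.
    exists 1; split => // M M1 x /= Ax.
    rewrite /Num.norm /= mx_normrE; apply: bigmax_le; first by rewrite (le_trans ler01)// ltW.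
    move=> [i j] _ /=; rewrite ord1 (le_trans _ (ltW M1))//.
    rewrite -[leRHS](@normr1 R) -ler_sqr ?nnegrE// !real_normK ?num_real// expr1n.
    rewrite -Ax dot_sqr (bigD1 j)//= mxE lerDl.
    by apply: sumr_ge0 => k _; exact: sqr_ge0.
  rewrite (_ : A = (fun x : 'rV[R]_n.+1 => dot x^T (1%:M *m x^T)) @^-1` [set 1]).
    by apply: closed_comp => [x _|]; [exact: continuous_dot_row|exact: closed_eq].
  by apply/seteqP; split => x; rewrite /A /= dot1.
have [c /set_mem Ac cmax] := EVT_max_rV A0 cA
  (continuous_subspaceT (@continuous_dot_row _ S)).
pose l := dot c^T (S *m c^T).
have lmax (x : 'cV[R]_n.+1) : dot x (S *m x) <= l * dot x x.
  have [/eqP x0|x0] := boolP (dot x x == 0).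
    have /eqP -> : x == 0 by rewrite -dot_eq0 x0.
    by rewrite !dot0l mulr0.
  have xp : 0 < dot x x by rewrite lt_def x0 dot_ge0.
  have np : 0 < enorm x by rewrite sqrtr_gt0.
  have := cmax ((enorm x)^-1 *: x^T).
  rewrite inE /A /= linearZ /= trmxK dotZl dotZr -scalemxAr dotZl dotZr.
  have e2 : (enorm x)^-1 * (enorm x)^-1 = (dot x x)^-1.
    by rewrite -invfM -expr2 enorm_sqr.
  rewrite !mulrA e2 mulVf// => /(_ erefl).
  by rewrite ler_pdivrMl // mulrC.
exists l => //.
apply/eigenvalueP; exists c; last first.
  apply/eqP => c0; move: Ac; rewrite /A /= c0 linear0 dot0l => /eqP.
  by rewrite eq_sym oner_eq0.
(* first-order condition along every direction y *)
have ortho (y : 'cV[R]_n.+1) : dot y (l *: c^T - S *m c^T) = 0.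
  set g := dot y _.
  pose b := l * dot y y - dot y (S *m y).
  have H (t : R) : 0 <= 2 * t * g + t ^+ 2 * b.
    have := lmax (c^T + t *: y).
    rewrite mulmxDr -scalemxAr !dotDl !dotDr !dotZl !dotZr.
    have -> : dot c^T (S *m y) = dot y (S *m c^T).
      by rewrite dot_mulmx symS dotC.
    rewrite -/l Ac (dotC c^T y) /g /b dotBr dotZr.
    by rewrite -subr_ge0; set G := dot y _; nra.
  have b0 : 0 <= b by rewrite subr_ge0.
  have b1 : 0 < b + 1 by lra.
  have := H (- g / (b + 1)).
  have -> : 2 * (- g / (b + 1)) * g + (- g / (b + 1)) ^+ 2 * b =
     - (g ^+ 2 * (b + 2)) / (b + 1) ^+ 2 by field; rewrite gt_eqF.
  rewrite pmulr_lge0; last by rewrite invr_gt0 exprn_gt0.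
  rewrite oppr_ge0 => H2; apply/eqP; rewrite -sqrf_eq0 eq_le sqr_ge0 andbT.
  by rewrite pmulr_lle0 in H2 => //; lra.
have : l *: c^T - S *m c^T = 0 by apply/eqP; rewrite -dot_eq0 ortho.
move=> /eqP; rewrite subr_eq0 => /eqP e.
by apply: trmx_inj; rewrite trmx_mul symS -e linearZ.
Qed.

Lemma eignorm_ub n (S : 'M[R]_n) a : eigenvalue S a -> `|a| <= eignorm S.
Proof.
move=> Sa; apply: ub_le_sup; last by exists a.
exists (\sum_i \sum_j `|S^T i j|) => _ [b /eigenvalueP [v vS v0] <-].
have vp : 0 < dot v^T v^T.
  by rewrite lt_def dot_ge0 andbT dot_eq0 -(inj_eq (@trmx_inj _ _ _)) trmxK linear0.
rewrite -(ler_pM2r vp) (le_trans _ (quad_sum_bound _ _))//.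
have -> : S^T *m v^T = b *: v^T by rewrite -trmx_mul vS linearZ.
by rewrite dotZr normrM (ger0_norm (ltW vp)).
Qed.

(** An extremal value of the Rayleigh quotient is an eigenvalue, of S or of -S. *)
Lemma eignorm_quad n (S : 'M[R]_n) (e : R) : S^T = S ->
  eignorm S <= e -> forall x, `|dot x (S *m x)| <= e * dot x x.
Proof.
case: n S => [S _ _ x|n S symS Se x].
  by rewrite /dot !big_ord0 normr0 mulr0.
have [l Sl lmax] := rayleigh_max symS.
have [|l' Sl' lmin] := @rayleigh_max n (- S); first by rewrite linearN /= symS.
have Sl'' : eigenvalue S (- l').
  move: Sl' => /eigenvalueP [v vS v0]; apply/eigenvalueP; exists v => //.
  by rewrite scaleNr -vS mulmxN opprK.
have := le_trans (eignorm_ub Sl) Se; have := le_trans (eignorm_ub Sl'') Se.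
rewrite normrN => /(le_trans (ler_norm _)) l'e /(le_trans (ler_norm _)) le_.
have := lmin x; rewrite mulNmx dotNr => lx'; have lx := lmax x.
have x0 := dot_ge0 x.
rewrite ler_norml; apply/andP; split; last by rewrite (le_trans lx)// ler_wpM2r.
by rewrite lerNl (le_trans lx')// ler_wpM2r.
Qed.

Lemma quad_eignorm n (S : 'M[R]_n) (e : R) : 0 <= e -> S^T = S ->
  (forall x, `|dot x (S *m x)| <= e * dot x x) -> eignorm S <= e.
Proof.
move=> e0 symS Se; rewrite /eignorm.
set E := [set _ | _ in _].
have [->|/set0P E0] := eqVneq E set0; first by rewrite sup0.
apply: sup_le_ub => // _ [a /eigenvalueP [v vS v0] <-].
have vp : 0 < dot v^T v^T.
  by rewrite lt_def dot_ge0 andbT dot_eq0 -(inj_eq (@trmx_inj _ _ _)) trmxK linear0.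
rewrite -(ler_pM2r vp) (le_trans _ (Se _))//.
have -> : S *m v^T = a *: v^T by rewrite -[in LHS]symS -trmx_mul vS linearZ.
by rewrite dotZr normrM (ger0_norm (ltW vp)).
Qed.

End symmetric_matrices.

(** * Empirical least squares *)
Section least_squares.
Context {R : realType} {M : nat}.
Implicit Type y : 'I_M -> R.

Definition avg y : R := M%:R^-1 * \sum_(m < M) y m.

Definition gram q (v : 'I_M -> 'cV[R]_q) : 'M[R]_q :=
  M%:R^-1 *: \sum_(m < M) v m *m (v m)^T.

Definition moment q (v : 'I_M -> 'cV[R]_q) y : 'cV[R]_q :=
  M%:R^-1 *: \sum_(m < M) y m *: v m.

Lemma avgD y1 y2 : avg (fun m => y1 m + y2 m) = avg y1 + avg y2.
Proof. by rewrite /avg big_split mulrDr. Qed.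

Lemma avgZ k y : avg (fun m => k * y m) = k * avg y.
Proof. by rewrite /avg -mulr_sumr mulrCA. Qed.

Lemma avg_le y1 y2 : (forall m, y1 m <= y2 m) -> avg y1 <= avg y2.
Proof. by move=> y12; rewrite ler_wpM2l ?invr_ge0 ?ler0n// ler_sum. Qed.

Lemma avg_ge0 y : (forall m, 0 <= y m) -> 0 <= avg y.
Proof. by move=> y0; rewrite mulr_ge0 ?invr_ge0 ?ler0n// sumr_ge0. Qed.

Lemma eq_avg y1 y2 : y1 =1 y2 -> avg y1 = avg y2.
Proof. by move=> e; congr (_ * _); apply: eq_bigr => m _. Qed.

Section family.
Context {q : nat} (v : 'I_M -> 'cV[R]_q).

Lemma dot_moment x y : dot x (moment v y) = avg (fun m => y m * dot x (v m)).
Proof.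
rewrite /moment dotZr dot_sumr; congr (_ * _).
by apply: eq_bigr => m _; rewrite dotZr.
Qed.

Lemma momentD y1 y2 : moment v (fun m => y1 m + y2 m) = moment v y1 + moment v y2.
Proof.
rewrite /moment -scalerDr -big_split /=; congr (_ *: _).
by apply: eq_bigr => m _; rewrite scalerDl.
Qed.

Lemma momentB y1 y2 : moment v (fun m => y1 m - y2 m) = moment v y1 - moment v y2.
Proof.
rewrite /moment -scalerBr -sumrB; congr (_ *: _).
by apply: eq_bigr => m _; rewrite scalerBl.
Qed.

Lemma gram_moment x : gram v *m x = moment v (fun m => dot x (v m)).
Proof.
rewrite /gram /moment -scalemxAl mulmx_suml; congr (_ *: _).
apply: eq_bigr => m _; rewrite -mulmxA.
apply/matrixP => i j; rewrite ord1 !mxE big_ord1.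
rewrite mulrC; congr (_ * _).
by rewrite dotC dotE.
Qed.

Lemma gram_quad x : dot x (gram v *m x) = avg (fun m => dot x (v m) ^+ 2).
Proof.
by rewrite gram_moment dot_moment; apply: eq_avg => m; rewrite expr2.
Qed.

Lemma gram_sym : (gram v)^T = gram v.
Proof.
rewrite /gram linearZ /= linear_sum /=; congr (_ *: _).
by apply: eq_bigr => m _; rewrite trmx_mul trmxK.
Qed.

Lemma linear_part_eq0 (g b : R) : (forall t, 0 <= t * g + t ^+ 2 * b) -> g = 0.
Proof.
move=> H; have b0 : 0 <= b.
  by have := H 1; have := H (-1); nra.
have b1 : 0 < b + 1 by lra.
have := H (- g / (b + 1)).
have -> : - g / (b + 1) * g + (- g / (b + 1)) ^+ 2 * b =
   - (g ^+ 2) / (b + 1) ^+ 2 by field; rewrite gt_eqF.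
rewrite pmulr_lge0; last by rewrite invr_gt0 exprn_gt0.
rewrite oppr_ge0 => H2; apply/eqP; rewrite -sqrf_eq0 eq_le sqr_ge0 andbT.
exact: H2.
Qed.

(** The risk is a quadratic polynomial along every line through its minimiser,
    so its linear part vanishes in every direction. *)
Lemma normal_equation y (t : 'cV[R]_q) :
  (forall x, avg (fun m => (y m - dot t (v m)) ^+ 2) <=
             avg (fun m => (y m - dot x (v m)) ^+ 2)) ->
  gram v *m t = moment v y.
Proof.
move=> tmin.
have ortho x : dot x (moment v y - gram v *m t) = 0.
  have -> : dot x (moment v y - gram v *m t) =
      avg (fun m => (y m - dot t (v m)) * dot x (v m)).
    by rewrite gram_moment -momentB dot_moment.
  apply/eqP; rewrite -(mulrI_eq0 _ (@lregN _ 2 _)); last exact/lregP.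
  apply/eqP; apply: (@linear_part_eq0 _ (avg (fun m => dot x (v m) ^+ 2))) => s.
  have := tmin (t + s *: x); rewrite -subr_ge0.
  rewrite (_ : avg (fun m => (y m - dot (t + s *: x) (v m)) ^+ 2) =
     avg (fun m => (y m - dot t (v m)) ^+ 2) +
     (s * (- 2 * avg (fun m => (y m - dot t (v m)) * dot x (v m))) +
      s ^+ 2 * avg (fun m => dot x (v m) ^+ 2))); first by rewrite addrAC subrr add0r.
  rewrite mulrA -!avgZ -!avgD; apply: eq_avg => m.
  by rewrite dotDl dotZl; ring.
apply/eqP; rewrite eq_sym -subr_eq0 -dot_eq0; exact/eqP.
Qed.

(** Bessel's inequality for the empirical scalar product. *)
Lemma gram_solve_le (e : R) (u : 'cV[R]_q) y :
  (forall x, (1 - e) * dot x x <= dot x (gram v *m x)) ->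
  gram v *m u = moment v y -> (1 - e) * dot u u <= avg (fun m => y m ^+ 2).
Proof.
move=> Vge Vu.
apply: (le_trans (Vge u)).
have : dot u (gram v *m u) = avg (fun m => y m * dot u (v m)) by rewrite Vu dot_moment.
have : 2 * avg (fun m => y m * dot u (v m)) <= avg (fun m => y m ^+ 2) + dot u (gram v *m u).
  rewrite gram_quad -avgZ -avgD; apply: avg_le => m.
  by have := sqr_ge0 (y m - dot u (v m)); nra.
by move=> + e1; rewrite -e1; lra.
Qed.

Lemma gram_inv_le (e : R) (u z : 'cV[R]_q) : e < 1 ->
  (forall x, (1 - e) * dot x x <= dot x (gram v *m x)) ->
  gram v *m u = z -> (1 - e) ^+ 2 * dot u u <= dot z z.
Proof.
move=> e1 Vge Vu.
have := Vge u; rewrite Vu => H.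
have uu := dot_ge0 u; have CS := dot_CS u z.
have [u0|u0] := eqVneq (dot u u) 0; first by rewrite u0 mulr0 dot_ge0.
have up : 0 < dot u u by rewrite lt_def u0.
rewrite -(ler_pM2l up) (le_trans _ CS)//.
rewrite mulrCA -expr2 -exprMn ler_sqr ?nnegrE//.
  by rewrite mulr_ge0// subr_ge0 ltW.
by apply: le_trans H; rewrite mulr_ge0// subr_ge0 ltW.
Qed.

Lemma gram_unit (e : R) : e < 1 ->
  (forall x, (1 - e) * dot x x <= dot x (gram v *m x)) -> gram v \in unitmx.
Proof.
move=> e1 Vge; rewrite -unitmx_tr -row_free_unit -kermx_eq0.
apply/eqP/row_matrixP => i; rewrite row0.
have : row i (kermx (gram v)^T) *m (gram v)^T = 0.
  by rewrite -row_mul mulmx_ker row0.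
move=> /(congr1 trmx); rewrite trmx_mul trmxK linear0 => H.
have := gram_inv_le e1 Vge H; rewrite dot0l.
rewrite pmulr_rle0 ?exprn_gt0 ?subr_gt0// => H2.
apply: trmx_inj; rewrite linear0; apply/eqP.
by rewrite -dot_eq0 eq_le H2 dot_ge0.
Qed.

End family.

End least_squares.

(** * One Picard-type regression, deterministically *)
Section regression_step.
Context {R : realType} {M n : nat}.
Variables (p : 'I_M -> 'cV[R]_n) (s : 'I_M -> R) (F : 'I_M -> R -> R -> R).
Variables (L h : R).
Hypothesis h0 : 0 < h.
Hypothesis L0 : 0 <= L.
Hypothesis hL : (48 * L + 2) * h <= 1.
Hypothesis FL : forall m a b a' b',
  (F m a b - F m a' b') ^+ 2 <= L * ((a - a') ^+ 2 + (b - b') ^+ 2).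

Let v m := col_mx (p m) (s m *: p m).
Hypothesis Vge : forall x, (1 - h) * dot x x <= dot x (gram v *m x).
Hypothesis Ple : forall x, dot x (gram p *m x) <= (1 + h) * dot x x.

Let theta (a b : 'cV[R]_n) : 'cV[R]_(n + n) := col_mx a (Num.sqrt h *: b).
Let Fat (a b : 'cV[R]_n) m := F m (dot a (p m)) (dot b (p m)).

Let Lh0 : 0 <= L * h. Proof. by rewrite mulr_ge0// ltW. Qed.
Let h12 : h <= 1 / 2. Proof. have := Lh0; have := hL; lra. Qed.
Let Lh : 3 * L * h <= 1 / 16. Proof. have := Lh0; have := h0; have := hL; lra. Qed.
Let h1 : h < 1. Proof. have := h12; lra. Qed.

Let thetaB a b a' b' : theta a b - theta a' b' = theta (a - a') (b - b').
Proof. by rewrite /theta opp_col_mx add_col_mx scalerBr. Qed.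

Let theta_sqr a b : dot (theta a b) (theta a b) = dot a a + h * dot b b.
Proof.
by rewrite dot_col_mx dotZl dotZr mulrA -expr2 sqr_sqrtr// ltW.
Qed.

(** The driver enters with weight h, and the slope variable is weighted by
    sqrt h, so one regression contracts the squared distance by O(h); the
    position part even gains O(h ^ 2). *)
Lemma picard_contraction a b a' b' (w : 'cV[R]_(n + n)) :
  gram v *m w = moment v (fun m => h * (Fat a b m - Fat a' b' m)) ->
  dot w w <= 3 * L * h * (h * dot (a - a') (a - a') + h * dot (b - b') (b - b')).
Proof.
move=> Vw; have := gram_solve_le Vge Vw.
have A0 := dot_ge0 (a - a'); have B0 := dot_ge0 (b - b').
have w0 := dot_ge0 w.
have : avg (fun m => (h * (Fat a b m - Fat a' b' m)) ^+ 2) <=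
   h ^+ 2 * L * ((1 + h) * dot (a - a') (a - a') + (1 + h) * dot (b - b') (b - b')).
  apply: (@le_trans _ _ (h ^+ 2 * L * (avg (fun m => dot (a - a') (p m) ^+ 2)
                         + avg (fun m => dot (b - b') (p m) ^+ 2)))).
    rewrite -avgD -avgZ; apply: avg_le => m.
    rewrite exprMn -mulrA ler_wpM2l ?sqr_ge0// (le_trans (FL _ _ _ _ _))//.
    by rewrite !dotBl.
  apply: ler_wpM2l; first by rewrite mulr_ge0// sqr_ge0.
  by apply: lerD; rewrite -gram_quad; exact: Ple.
set A := dot (a - a') _ in A0 *; set B := dot (b - b') _ in B0 *.
set X := avg _ => XAB wX.
have {}wX : (1 - h) * dot w w <= h ^+ 2 * L * ((1 + h) * A + (1 + h) * B).
  exact: le_trans XAB.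
rewrite -(ler_pM2l (_ : 0 < 1 - h)); last by rewrite subr_gt0.
apply: (le_trans wX).
have -> : (1 - h) * (3 * L * h * (h * A + h * B)) =
  h ^+ 2 * L * ((3 * (1 - h)) * A + (3 * (1 - h)) * B) by ring.
have c : 1 + h <= 3 * (1 - h) by have := h12; lra.
apply: ler_wpM2l; first by rewrite mulr_ge0// sqr_ge0.
by apply: lerD; apply: ler_wpM2r.
Qed.

Variables (I : nat) (y y0 : 'I_M -> R) (al be : nat -> 'cV[R]_n) (a b : 'cV[R]_n).
Hypothesis I2 : (1 < I)%N.
Hypothesis al0 : al 0%N = 0.
Hypothesis be0 : be 0%N = 0.
Hypothesis normal : forall i, (i < I)%N ->
  gram v *m theta (al i.+1) (be i.+1) =
  moment v (fun m => y m + h * Fat (al i) (be i) m).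

Let defect : 'cV[R]_(n + n) :=
  moment v (fun m => y0 m + h * Fat a b m - dot (theta a b) (v m)).

Let kap := 48 * L + 2.
Let c1 := 1 + 2 * kap + 4 * L.
Definition step_const := 5 * c1 + 4 + 8 * (1 + c1) + 4 * (3 * L) ^+ (I - 1).

(** The error phi_I of the last iterate solves V phi_I = driver term + data error
    + defect.  The driver term is O(h) times the error of the iterate before the
    last, hence of phi_I up to the difference of the last two iterates, which is
    geometrically small.  The factor in front of the data must be 1 + O(h) and
    not a mere constant, as it will be raised to the power T/h. *)
Lemma regression_step :
  dot (al I - a) (al I - a) + 2^-1 * (h * dot (be I - b) (be I - b)) <=
  (1 + step_const * h) * avg (fun m => (y m - y0 m) ^+ 2)
  + step_const / h * dot defect defect
  + step_const * h ^+ (I - 1) * (dot a a + h * dot b b).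
Proof.
have uV := gram_unit h1 Vge.
pose sol (z : 'cV[R]_(n + n)) := invmx (gram v) *m z.
have solE z : gram v *m sol z = z by rewrite mulmxA mulmxV// mul1mx.
have inj u w : gram v *m u = gram v *m w -> u = w.
  by move=> /(congr1 (mulmx (invmx (gram v)))); rewrite !mulKmx.
pose phi i : 'cV[R]_(n + n) := theta (al i) (be i) - theta a b.
pose A i := dot (al i - a) (al i - a).
pose B i := h * dot (be i - b) (be i - b).
have A0 i : 0 <= A i by exact: dot_ge0.
have B0 i : 0 <= B i by rewrite mulr_ge0 ?dot_ge0// ltW.
have phiE i : dot (phi i) (phi i) = A i + B i by rewrite /phi thetaB theta_sqr.
pose w i := sol (moment v (fun m => h * (Fat (al i) (be i) m - Fat a b m))).
pose G1 := sol (moment v (fun m => y m - y0 m)).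
pose G : 'cV[R]_(n + n) := G1 + sol defect.
have phiS i : (i < I)%N -> phi i.+1 = w i + G.
  move=> iI; apply: inj; rewrite /phi mulmxBr normal // /G !mulmxDr !solE.
  rewrite /defect (gram_moment v (theta a b)) -!momentD -momentB.
  by congr (moment v _); apply/funext => m; ring.
have hw i : dot (w i) (w i) <= 3 * L * h * (h * A i + B i).
  exact: (picard_contraction (solE _)).
set T := dot a a + h * dot b b.
have TT : dot (theta a b) (theta a b) = T by exact: theta_sqr.
have T0 : 0 <= T by rewrite -TT dot_ge0.
have LL : 0 <= 3 * L * h by rewrite !mulr_ge0// ltW.
(* G is the part of the error that does not come from the driver: the data
   are estimated by Bessel's inequality, the defect by inverting V. *)
set Y2 := avg (fun m => (y m - y0 m) ^+ 2); set D2 := dot defect defect.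
have Y0 : 0 <= Y2 by apply: avg_ge0 => m; exact: sqr_ge0.
have D0 : 0 <= D2 by exact: dot_ge0.
have GG : dot G G <= (1 + 4 * h) * Y2 + 8 / h * D2.
  apply: (le_trans (dot_eps _ _ h0)); apply: lerD.
    have := gram_solve_le Vge (solE (moment v (fun m => y m - y0 m))).
    rewrite -/Y2 -/G1; have := dot_ge0 G1; set g := dot G1 G1 => g0 gY.
    have : g <= (1 + 2 * h) * Y2.
      rewrite -(ler_pM2l (_ : 0 < 1 - h)); last by rewrite subr_gt0.
      apply: (le_trans gY); rewrite mulrA ler_peMl//; have := h12; have := h0; nra.
    move=> gY'; apply: (@le_trans _ _ ((1 + h) * ((1 + 2 * h) * Y2))).
      by rewrite ler_wpM2l// addr_ge0// ltW.
    rewrite mulrA ler_wpM2r//; have := h12; have := h0; nra.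
  have := gram_inv_le h1 Vge (solE defect); rewrite -/D2.
  have := dot_ge0 (sol defect); set g := dot (sol defect) _ => g0 gD.
  have gD' : g <= 4 * D2.
    have : 1 / 4 * g <= (1 - h) ^+ 2 * g by rewrite ler_wpM2r//; have := h12; nra.
    by move=> H; have := le_trans H gD; lra.
  have hi : 1 <= h^-1 by rewrite invf_ge1 // ltW.
  apply: (@le_trans _ _ ((2 * h^-1) * (4 * D2))); last first.
    by rewrite (_ : 2 * h^-1 * (4 * D2) = 8 / h * D2)//; field; rewrite gt_eqF.
  by apply: ler_pM => //; lra.
(* Consecutive iterates contract by O(h); the last difference measures the
   error made by evaluating the driver at the previous iterate. *)
pose e i : 'cV[R]_(n + n) := phi i.+1 - phi i.
have eS i : (i.+1 < I)%N -> dot (e i.+1) (e i.+1) <= 3 * L * h * dot (e i) (e i).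
  move=> iI; apply: (@le_trans _ _ (3 * L * h *
     (h * dot (al i.+1 - al i) (al i.+1 - al i) + h * dot (be i.+1 - be i) (be i.+1 - be i)))).
    apply: picard_contraction; rewrite /e mulmxBr !phiS ?(ltnW iI)// !mulmxDr !solE.
    rewrite opprD addrACA subrr addr0 -momentB.
    by congr (moment v _); apply/funext => m; ring.
  rewrite ler_wpM2l// /e /phi opprB addrA subrK thetaB theta_sqr lerD2r.
  by rewrite ler_piMl ?dot_ge0// ltW.
have e0 : dot (e 0%N) (e 0%N) <= 2 * dot G G + 8 * T.
  have -> : e 0%N = G + (w 0%N + theta a b).
    rewrite /e phiS; last by rewrite ltnW.
    by rewrite /phi al0 be0 /theta scaler0 col_mx0 sub0r opprK addrAC addrC.
  apply: (le_trans (dot_add_le _ _)); rewrite lerD2l.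
  have w0 : dot (w 0%N) (w 0%N) <= T.
    apply: (le_trans (hw _)); rewrite /A /B al0 be0 !sub0r !dotNl !dotNr !opprK.
    have := dot_ge0 a; have := dot_ge0 b => b0 a0.
    have hb0 : 0 <= h * dot b b by rewrite mulr_ge0// ltW.
    apply: (@le_trans _ _ (1 * (h * dot a a + h * dot b b))).
      apply: ler_wpM2r; first by rewrite addr_ge0// mulr_ge0// ltW.
      by have := Lh; lra.
    by rewrite mul1r lerD2r ler_piMl// ltW.
  have := dot_add_le (w 0%N) (theta a b); rewrite TT -/T; lra.
have eI i : (i < I)%N -> dot (e i) (e i) <= (3 * L * h) ^+ i * (2 * dot G G + 8 * T).
  elim: i => [|i IH] iI; first by rewrite expr0 mul1r.
  apply: (le_trans (eS _ iI)); rewrite exprS -[leRHS]mulrA; apply: ler_wpM2l => //.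
  by apply: IH; exact: ltnW.
have [J JE] : exists J, I = J.+2 by case: (I) I2 => [|[|J]] // _; exists J.
have GG0 := dot_ge0 G.
have eJ : dot (e J.+1) (e J.+1) <= 6 * L * h * dot G G + 8 * (3 * L * h) ^+ J.+1 * T.
  apply: (le_trans (eI _ _)); first by rewrite JE.
  rewrite mulrDr; apply: lerD; last by rewrite mulrCA mulrA.
  rewrite exprS.
  have : (3 * L * h) ^+ J <= 1 by rewrite exprn_ile1//; have := Lh; lra.
  have := exprn_ge0 J LL; set r := _ ^+ J => r0 r1.
  have : 3 * L * h * r <= 3 * L * h by rewrite ler_piMr.
  move=> rL; rewrite (_ : 6 * L * h * dot G G = 3 * L * h * (2 * dot G G)); last by ring.
  by rewrite ler_wpM2r// mulr_ge0.
(* The driver evaluated at the last iterate is absorbed on the left: the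
   weight kap h leaves it with a factor at most 1/4. *)
have kap0 : 0 < kap by rewrite /kap; have := L0; lra.
have kh0 : 0 < kap * h by rewrite mulr_gt0.
have phiI : A I + B I <= (1 + kap * h) * dot G G
     + 4^-1 * (h * A I + B I + dot (e J.+1) (e J.+1)).
  rewrite -phiE; have -> : phi I = G + w J.+1 by rewrite JE phiS ?JE// addrC.
  apply: (le_trans (dot_eps _ _ kh0)); rewrite lerD2l.
  have hw1 := hw J.+1.
  have AB1 : h * A J.+1 + B J.+1 <= 2 * (h * A I + B I + dot (e J.+1) (e J.+1)).
    have eAB : dot (e J.+1) (e J.+1) = dot (al I - al J.+1) (al I - al J.+1)
       + h * dot (be I - be J.+1) (be I - be J.+1).
      by rewrite /e /phi opprB addrA subrK thetaB theta_sqr JE.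
    have z (x c j : 'cV[R]_n) : x - c + - (x - j) = j - c.
      by rewrite opprB addrC addrA subrK.
    have := dot_add_le (al I - a) (- (al I - al J.+1)).
    have := dot_add_le (be I - b) (- (be I - be J.+1)).
    rewrite !z !(dotNl, dotNr, opprK) -/(A J.+1) -/(A I) eAB.
    rewrite /B; have := dot_ge0 (al I - al J.+1).
    set e1 := dot (al I - al J.+1) _; set e2 := dot (be I - be J.+1) _.
    set b1 := dot (be J.+1 - b) _; set b2 := dot (be I - b) _.
    move=> e10 H1 H2.
    have : h * b1 <= h * (2 * b2 + 2 * e2) by rewrite ler_pM2l.
    have : h * A J.+1 <= h * (2 * A I + 2 * e1) by rewrite ler_pM2l.
    have : h * e1 <= e1 by rewrite ler_piMl// ltW.
    lra.
  set X := h * A I + B I + _ in AB1 *.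
  have X0 : 0 <= X by rewrite !addr_ge0 ?dot_ge0// mulr_ge0// ltW.
  apply: (@le_trans _ _ ((1 + (kap * h)^-1) * (3 * L * h * (2 * X)))).
    rewrite ler_wpM2l ?addr_ge0 ?invr_ge0 ?(ltW kh0)//.
    by apply: (le_trans hw1); rewrite ler_wpM2l.
  have -> : (1 + (kap * h)^-1) * (3 * L * h * (2 * X)) =
            (6 * L * h + 6 * L / kap) * X by field; rewrite !gt_eqF.
  rewrite ler_wpM2r//.
  have : 6 * L / kap <= 1 / 8 by rewrite ler_pdivrMr// /kap; have := L0; lra.
  have := Lh; lra.
rewrite -[dot _ _]/(A I) -/(B I).
have -> : (I - 1)%N = J.+1 by rewrite JE subSS subn0.
set E := dot (e J.+1) _ in eJ phiI *.
pose S := (3 * L) ^+ J.+1 * h ^+ J.+1.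
have SE : (3 * L * h) ^+ J.+1 = S by rewrite exprMn.
have S0 : 0 <= S by rewrite -SE exprn_ge0.
rewrite SE in eJ.
have c10 : 1 <= c1 by rewrite /c1 /kap; have := L0; lra.
have H1 : (1 - h / 4) * A I + 3 / 4 * B I <=
    (1 + (kap + 2 * L) * h) * dot G G + 2 * S * T.
  have := phiI; have := eJ; have := GG0; have := L0; have := h0.
  set g := dot G G; move=> hp Lp gp eJ' phiI'.
  have : 0 <= L * h * g by rewrite !mulr_ge0// ltW.
  lra.
have H2 : A I + 2^-1 * B I <= (1 + c1 * h) * dot G G + 4 * S * T.
  have ST0 : 0 <= S * T by exact: mulr_ge0.
  apply: (@le_trans _ _ ((1 + h) * ((1 - h / 4) * A I + 3 / 4 * B I))).
    have := A0 I; have := B0 I; have := h0; have := h1 => h1' hp Bp Ap.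
    have : 0 <= h * A I * (1 - h) by rewrite !mulr_ge0 ?subr_ge0// ltW.
    have : 0 <= h * A I by rewrite mulr_ge0 ?(ltW hp).
    have : 0 <= h * B I by rewrite mulr_ge0 ?(ltW hp).
    lra.
  apply: (@le_trans _ _ ((1 + h) * ((1 + (kap + 2 * L) * h) * dot G G + 2 * S * T))).
    by rewrite ler_wpM2l// addr_ge0// ltW.
  rewrite mulrDr; apply: lerD.
    rewrite mulrA ler_wpM2r// /c1.
    have := h1; have := h0; have := kap0; have := L0 => Lp kp hp hh.
    have : h * (kap + 2 * L) * h <= h * (kap + 2 * L) by rewrite ler_piMr ?mulr_ge0 ?ltW//; lra.
    lra.
  have := h1; have := h0; nra.
apply: (le_trans H2).
have pS : 0 <= (3 * L) ^+ J.+1 by rewrite exprn_ge0// mulr_ge0.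
have hJ : 0 <= h ^+ J.+1 by rewrite exprn_ge0// ltW.
have KE : step_const = 5 * c1 + 4 + 8 * (1 + c1) + 4 * (3 * L) ^+ J.+1.
  by rewrite /step_const JE subSS subn0.
apply: lerD; last first.
  apply: ler_wpM2r => //; rewrite /S mulrA ler_wpM2r// KE; lra.
apply: (@le_trans _ _ ((1 + c1 * h) * ((1 + 4 * h) * Y2 + 8 / h * D2))).
  by rewrite ler_wpM2l// addr_ge0// mulr_ge0 ?ltW//; lra.
have c1h : 0 <= c1 * h by rewrite mulr_ge0// ?ltW//; lra.
rewrite mulrDr; apply: lerD.
  rewrite mulrA ler_wpM2r//.
  have : c1 * h * h <= c1 * h by rewrite ler_piMr// ltW.
  have : (5 * c1 + 4) * h <= step_const * h by rewrite ler_pM2r// KE; lra.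
  lra.
rewrite mulrA ler_wpM2r// mulrA ler_wpM2r ?invr_ge0 ?(ltW h0)//.
have : c1 * h <= c1 by rewrite ler_piMr// ?ltW//; lra.
rewrite KE; lra.
Qed.

End regression_step.

(** * Gaussian moments *)
Section gaussian_moments.
Context {R : realType}.
Local Notation mu := (@lebesgue_measure R).
Variable s : R.
Local Notation pdf := (normal_pdf 0 s).
Local Notation gamma := (normal_prob 0 s).

Import HBNNSimple.

Let mpdf : measurable_fun setT (fun x => (pdf x)%:E : \bar R).
Proof. by apply/measurable_EFinP; exact: measurable_normal_pdf. Qed.

Let pdf0 x : (0 <= (pdf x)%:E)%E.
Proof. by rewrite lee_fin normal_pdf_ge0. Qed.

(** The Gaussian law has a density; the formula goes from indicators to simple
    functions and then to monotone limits. *)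
Lemma ge0_integral_normal_prob (f : R -> \bar R) :
  measurable_fun setT f -> (forall x, 0 <= f x)%E ->
  (\int[gamma]_x f x = \int[mu]_x (f x * (pdf x)%:E))%E.
Proof.
move=> mf f0; pose g := nnsfun_approx measurableT mf.
have indic (A : set R) : measurable A ->
    (\int[gamma]_x (\1_A x)%:E = \int[mu]_x ((\1_A x)%:E * (pdf x)%:E))%E.
  move=> mA; rewrite integral_indic// setIT.
  rewrite [RHS](_ : _ = \int[mu]_x (((fun x => (pdf x)%:E) \_ A) x))%E; last first.
    apply: eq_integral => x _; rewrite patchE indicE.
    by case: ifP => _; rewrite ?mul1e ?mul0e.
  by rewrite -integral_mkcond.
have sf (u : {nnsfun R >-> R}) :
    (\int[gamma]_x (u x)%:E = \int[mu]_x ((u x)%:E * (pdf x)%:E))%E.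
  under eq_integral do rewrite fimfunE -fsumEFin//.
  under [RHS]eq_integral => x _.
    rewrite fimfunE -fsumEFin// ge0_mule_fsuml; last first.
      by move=> r; rewrite EFinM nnfun_muleindic_ge0.
    over.
  have mu_ r : measurable_fun setT (fun x => (r * \1_(u @^-1` [set r]) x)%:E : \bar R).
    exact/measurable_EFinP/measurableT_comp.
  have mi r : measurable_fun setT (fun x => (\1_(u @^-1` [set r]) x)%:E : \bar R).
    exact/measurable_EFinP/measurable_indic.
  rewrite ge0_integral_fsum//; last by move=> r x _; rewrite EFinM nnfun_muleindic_ge0.
  rewrite ge0_integral_fsum//; last 2 first.
  - by move=> r; apply: emeasurable_funM => //; exact: mu_.
  - by move=> r x _; rewrite mule_ge0// EFinM nnfun_muleindic_ge0.
  apply: eq_fsbigr => r _.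
  have [r0|r0] := ltP r 0.
    rewrite !integral0_eq// => x _; by rewrite preimage_nnfun0// indic0 mulr0 ?mul0e.
  under eq_integral do rewrite EFinM.
  under [RHS]eq_integral do rewrite EFinM -muleA.
  rewrite !ge0_integralZl//; first by rewrite indic.
  - by apply: emeasurable_funM; [exact: mi|exact: mpdf].
  - by move=> x _; rewrite mule_ge0// lee_fin.
  - exact: mi.
have mg n : measurable_fun setT (fun x => (g n x)%:E : \bar R).
  exact/measurable_EFinP.
transitivity (limn (fun n => \int[gamma]_x (g n x)%:E))%E.
  rewrite -monotone_convergence//=.
  - apply: eq_integral => x _; apply/esym/cvg_lim => //=.
    exact: cvg_nnsfun_approx.
  - by move=> n x _; rewrite lee_fin.
  - by move=> x _ a b ab; rewrite lee_fin; exact: (lefP _ _ (nd_nnsfun_approx _ _ ab)).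
rewrite [LHS](_ : _ = limn (fun n => \int[mu]_x ((g n x)%:E * (pdf x)%:E)))%E; last first.
  by apply: congr_lim; apply/funext => n; exact: sf.
rewrite -monotone_convergence//=.
- apply: eq_integral => x _; apply/cvg_lim => //=.
  by apply: cvgeZr => //; exact: cvg_nnsfun_approx.
- by move=> n; apply: emeasurable_funM; [exact: mg|exact: mpdf].
- by move=> n x _; rewrite mule_ge0// lee_fin.
- move=> x _ a b ab; rewrite lee_wpmul2r// lee_fin; exact: (lefP _ _ (nd_nnsfun_approx _ _ ab)).
Qed.

End gaussian_moments.

Lemma normal_fourth_moment (R : realType) (s : R) : 0 < s ->
  (\int[normal_prob 0 s]_x (x ^+ 4)%:E <= (64 * s ^+ 4)%:E)%E.
Proof.
move=> s0; pose r := s * Num.sqrt 2.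
have r2 : r ^+ 2 = 2 * s ^+ 2 by rewrite exprMn sqr_sqrtr// mulrC.
have s20 : 0 < Num.sqrt 2 :> R by rewrite sqrtr_gt0.
have r0 : 0 < r by rewrite mulr_gt0.
have m4 : measurable_fun setT (fun x : R => (x ^+ 4)%:E : \bar R).
  by apply/measurable_EFinP; exact: exprn_measurable.
rewrite ge0_integral_normal_prob//; last first.
  by move=> x; rewrite lee_fin (exprM x 2 2) sqr_ge0.
apply: (@le_trans _ _ (\int[lebesgue_measure]_x ((64 * s ^+ 4)%:E * (normal_pdf 0 r x)%:E))%E); last first.
  rewrite ge0_integralZl//.
  - by rewrite integral_normal_pdf mule1.
  - by apply/measurable_EFinP; exact: measurable_normal_pdf.
  - by move=> x _; rewrite lee_fin normal_pdf_ge0.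
  - by rewrite lee_fin mulr_ge0// exprn_ge0// ltW.
apply: ge0_le_integral => //.
- move=> x _; rewrite -EFinM lee_fin mulr_ge0 ?normal_pdf_ge0//.
  by rewrite (exprM x 2 2) sqr_ge0.
- apply: emeasurable_funM => //.
  by apply/measurable_EFinP; exact: measurable_normal_pdf.
- apply: emeasurable_funM => //.
  by apply/measurable_EFinP; exact: measurable_normal_pdf.
move=> x _; rewrite -!EFinM lee_fin !normal_pdfE ?gt_eqF//.
rewrite /normal_fun !subr0.
pose y := x ^+ 2 / (4 * s ^+ 2).
have y0 : 0 <= y by rewrite divr_ge0 ?sqr_ge0// mulr_ge0// sqr_ge0.
have -> : - x ^+ 2 / (s ^+ 2 *+ 2) = - (y + y).
  by rewrite /y; field; rewrite gt_eqF.
have -> : - x ^+ 2 / (r ^+ 2 *+ 2) = - y.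
  by rewrite r2 /y; field; rewrite gt_eqF.
have -> : x ^+ 4 = 16 * s ^+ 4 * y ^+ 2 by rewrite /y; field; rewrite gt_eqF.
have pk : normal_peak s <= 2 * normal_peak r.
  rewrite /normal_peak r2.
  have -> : (2 * s ^+ 2) * pi *+ 2 = 2 * (s ^+ 2 * pi *+ 2) :> R by rewrite !mulr2n; ring.
  rewrite (sqrtrM _ (ler0n _ 2)) invfM mulrA ler_peMl ?invr_ge0 ?sqrtr_ge0//.
  rewrite ler_pdivlMr// mul1r.
  by rewrite -(ler_sqr (sqrtr_ge0 _)) ?nnegrE// sqr_sqrtr//; lra.
have p0 := normal_peak_ge0 s.
have ey : y ^+ 2 * expR (- y) <= 2.
  rewrite expRN ler_pdivrMr ?expR_gt0//.
  by have := @expR_ge1Dxn R y 1 y0; rewrite (_ : 2`!%N = 2%N) //; lra.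
rewrite opprD expRD.
have e0 : 0 <= expR (- y) by exact: expR_ge0.
have -> : 16 * s ^+ 4 * y ^+ 2 * (normal_peak s * (expR (- y) * expR (- y))) =
  16 * s ^+ 4 * (y ^+ 2 * expR (- y) * normal_peak s) * expR (- y) by ring.
have -> : 64 * s ^+ 4 * (normal_peak r * expR (- y)) =
  16 * s ^+ 4 * (2 * (2 * normal_peak r)) * expR (- y) by ring.
apply: ler_wpM2r => //; apply: ler_wpM2l; first by rewrite mulr_ge0// exprn_ge0// ltW.
by apply: ler_pM => //; rewrite mulr_ge0// sqr_ge0.
Qed.

(** * Brownian increments on a grid *)
Section grid.
Context {R : realType}.
Variables (cf : coefs R) (N : nat).
Local Notation h := (mesh cf N).
Definition path2 := ((R -> R) * (R -> R))%type.
HB.instance Definition _ := Pointed.on path2.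

(** Values at the grid points: equality in law of the samples is an assumption
    on values, independence is a property of increments. *)
Definition ev (e : bool * 'I_N.+1) (q : path2) : R :=
  (if e.1 then q.1 else q.2) (e.2%:R * h).

Definition inc (e : bool * 'I_N) (q : path2) : R :=
  incr cf N e.2 (if e.1 then q.1 else q.2).

Definition inc_path (S : set (bool * 'I_N)) := g_sigma_algebraType (coord_sets inc S).

Definition ev_path := g_sigma_algebraType (coord_sets ev setT).

Lemma measurable_inc_ev e : measurable_fun (setT : set ev_path) (inc e).
Proof.
have -> : inc e = fun q => ev (e.1, lift ord0 e.2) q - ev (e.1, widen_ord (leqnSn N) e.2) q.
  by apply/funext => q; rewrite /inc /incr /ev.
by apply: measurable_funB; exact: measurable_coord.
Qed.

End grid.

Section brownian_increments.
Context {R : realType} {d : measure_display} {Omega : measurableType d}.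
Variables (P : probability Omega R) (cf : coefs R) (N : nat).
Local Notation h := (mesh cf N).
Hypothesis h0 : 0 < h.
Local Notation gam := (normal_prob 0 (Num.sqrt h)).

(** By induction on n: the last increment is independent of the past of V, to
    which the earlier ones belong. *)
Lemma brownian_increments_iid (V : R -> Omega -> R) (C : nat -> set R) n :
  brownian P V -> (forall j, measurable (C j)) ->
  P [set w | forall j, (j < n)%N -> C j (incr cf N j (V ^~ w))] =
  (\prod_(j < n) gam (C j))%E.
Proof.
move=> [mV _ _ law ind] mC.
pose A m := [set w | forall j, (j < m)%N -> C j (incr cf N j (V ^~ w))].
have grid j : 0 <= j%:R * h by rewrite mulr_ge0// ltW.
have step j : 0 <= j%:R * h < j.+1%:R * h.
  by rewrite grid ltr_pM2r// ltr_nat ltnSn.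
have stepE j : j.+1%:R * h - j%:R * h = h by rewrite -mulrBl -natrB// subSnn mul1r.
pose G m : set (set Omega) := preimages `[0, m%:R * h] V.
have mAm m : <<s G m >> (A m).
  have mV' j : (j <= m)%N -> measurable_fun (setT : set (g_sigma_algebraType (G m))) (V (j%:R * h)).
    move=> jm _ D mD; rewrite setTI; apply: sub_gen_smallest.
    exists (j%:R * h); last by exists D.
    by rewrite /= in_itv/= grid ler_pM2r// ler_nat.
  have -> : A m = \bigcap_(j in `I_m) ((fun w => incr cf N j (V ^~ w)) @^-1` C j).
    by apply/seteqP; split.
  apply: (@bigcap_measurableType _ (g_sigma_algebraType (G m))) => j jm.
  rewrite -[X in measurable X]setTI.
  apply: (@measurable_funB _ (g_sigma_algebraType (G m)) R setT _ _ (mV' j.+1 jm) (mV' j (ltnW jm))) => //.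
elim: n => [|n IH].
  by rewrite big_ord0 (_ : [set w | _] = setT) ?probability_setT//; apply/seteqP; split.
rewrite big_ord_recr /= -IH -/(A n.+1).
have -> : A n.+1 = (V (n.+1%:R * h) \- V (n%:R * h)) @^-1` C n `&` A n.
  apply/seteqP; split => w /=.
    by move=> Aw; split; [exact: Aw|move=> j jn; apply: Aw; rewrite ltnS ltnW].
  by move=> [Cw Aw] j; rewrite ltnS leq_eqVlt => /orP[/eqP->//|]; exact: Aw.
rewrite (ind _ _ (step n)); [|by exists (C n)|exact: mAm].
by rewrite law// stepE muleC.
Qed.

End brownian_increments.

Section samples.
Context {R : realType} {d : measure_display} {Omega : measurableType d}.
Variables (P : probability Omega R) (W B : R -> Omega -> R) (cf : coefs R).
Variables (N M : nat) (Ws Bs : 'I_M -> R -> Omega -> R).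
Local Notation h := (mesh cf N).
Hypothesis h0 : 0 < h.
Hypotheses (hW : brownian P W) (hB : brownian P B).
Hypothesis hWB : independent2 P (path_sigma W) (path_sigma B).
Hypothesis iid : iid_copies P W B Ws Bs.
Local Notation gam := (normal_prob 0 (Num.sqrt h)).

Definition path_of (o : option 'I_M) (w : Omega) : path2 (R := R) :=
  if o is Some m then spath Ws Bs m w else bpath W B w.

Definition increment (e : option 'I_M * (bool * 'I_N)) (w : Omega) : R :=
  inc cf e.2 (path_of e.1 w).

Let grid j : 0 <= j%:R * h. Proof. by rewrite mulr_ge0// ltW. Qed.

Lemma measurable_path o :
  measurable_fun setT (path_of o : Omega -> ev_path cf N).
Proof.
apply: measurable_to_coord => -[b j] _.
have [_ /(_ _ (grid j)) mW] : True /\ (forall t, 0 <= t -> measurable_fun setT (W t)).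
  by split=> //; case: hW.
have mB : measurable_fun setT (B (j%:R * h)) by case: hB => /(_ _ (grid j)).
case: o => [m|]; last by case: b.
have [mWB _ _] := iid; have [mW' mB'] := mWB m _ (grid j).
by case: b.
Qed.

Lemma measurable_increment e : measurable_fun setT (increment e).
Proof. exact: measurableT_comp (measurable_inc_ev _) (measurable_path e.1). Qed.

Let mfun_path o : {mfun Omega >-> ev_path cf N} := mfun_Sub (mem_set (measurable_path o)).

Let path_law o (A : set (ev_path cf N)) : measurable A ->
  distribution P (mfun_path o) A = distribution P (mfun_path None) A.
Proof.
case: o => [m|//] mA.
have sA : <<s cylinders (@ev R cf N) setT >> A by exact: sigma_coord_sub.
apply: (@g_sigma_algebra_measure_unique _ R (ev_path cf N)
  (cylinders (@ev R cf N) setT) _ (fun=> setT) _ _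
  (distribution P (mfun_path (Some m))) (distribution P (mfun_path None))) => //.
- apply: (@cylinders_measurable _ _ (ev_path cf N) _ (@ev R cf N)) => e.
  exact: measurable_coord.
- by move=> _; exists (fun=> setT) => //; apply/seteqP; split.
- by rewrite bigcup_const.
- exact: cylinders_setI.
- move=> _ [C mC ->]; have [_ law _] := iid.
  have := law m N.+1 (fun j => j%:R * h) (fun j => C (true, j)) (fun j => C (false, j))
    (fun j => grid j) (fun j => mC _) (fun j => mC _).
  have cylE (f : Omega -> path2 (R := R)) : f @^-1` [set q : ev_path cf N | forall e, setT e -> C e (ev cf e q)] =
     [set w | forall j : 'I_N.+1, C (true, j) ((f w).1 (j%:R * h)) /\ C (false, j) ((f w).2 (j%:R * h))].
    apply/seteqP; split => w /= Cw; first by move=> j; split; [exact: (Cw (true, j))|exact: (Cw (false, j))].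
    by move=> [[] j] _; have [] := Cw j.
  by rewrite /= /distribution /pushforward !cylE.
- by move=> k; rewrite -ge0_fin_numE//; exact: fin_num_measure.
Qed.

(** The finite-dimensional laws on the grid coincide, and cylinders form a
    pi-system generating the sigma-algebra of [ev_path]. *)
Lemma ge0_integral_path o (f : path2 (R := R) -> \bar R) :
  measurable_fun (setT : set (ev_path cf N)) f -> (forall q, 0 <= f q)%E ->
  (\int[P]_w f (path_of o w) = \int[P]_w f (bpath W B w))%E.
Proof.
move=> mf f0.
rewrite -(ge0_integral_distribution (mfun_path o) mf f0).
rewrite -(ge0_integral_distribution (mfun_path None) mf f0).
by apply: eq_measure_integral => A mA _; exact: path_law.
Qed.

Lemma integral_path o (f : path2 (R := R) -> \bar R) :
  measurable_fun (setT : set (ev_path cf N)) f ->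
  P.-integrable setT (fun w => f (bpath W B w)) ->
  (\int[P]_w f (path_of o w) = \int[P]_w f (bpath W B w))%E.
Proof.
move=> mf fi.
have fo : P.-integrable setT (fun w => f (path_of o w)).
  apply/integrableP; split; first exact: measurableT_comp mf (measurable_path o).
  rewrite (ge0_integral_path o (f := fun q => `|f q|%E))//; last exact: measurableT_comp.
  by have /integrableP[] := fi.
rewrite -(integral_distribution (X := mfun_path o) mf fo).
rewrite -(integral_distribution (X := mfun_path None) mf fi).
by apply: eq_measure_integral => A mA _; exact: path_law.
Qed.

Let mcyl (C : bool * 'I_N -> set R) : (forall e, measurable (C e)) ->
  measurable ([set q | forall e, C e (inc cf e q)] : set (ev_path cf N)).
Proof.
move=> mC; apply: (@cylinders_measurable _ _ (ev_path cf N) _ (@inc R cf N) (@measurable_inc_ev _ _ _) setT).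
by exists C => //; apply/seteqP; split => q /= Cq e; [move=> _|]; exact: Cq.
Qed.

Let incs_original (C : bool * 'I_N -> set R) : (forall e, measurable (C e)) ->
  P [set w | forall e, C e (inc cf e (bpath W B w))] = (\prod_e gam (C e))%E.
Proof.
move=> mC.
pose D b (j : nat) := if insub j is Some i then C (b, i) else setT.
have mD b j : measurable (D b j).
  by rewrite /D; case: insubP => [i _ _|_]; [exact: mC|exact: measurableT].
have DE b (i : 'I_N) : D b i = C (b, i) by rewrite /D valK.
pose A V b := [set w : Omega | forall j, (j < N)%N -> D b j (incr cf N j (V ^~ w))].
have -> : [set w | forall e, C e (inc cf e (bpath W B w))] = A W true `&` A B false.
  apply/seteqP; split => w /=.
    by move=> Cw; split=> j jN; rewrite (DE _ (Ordinal jN)); exact: (Cw (_, Ordinal jN)).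
  by move=> [AW AB] [[] i]; [rewrite -DE; exact: AW|rewrite -DE; exact: AB].
have sA V b : path_sigma V (A V b).
  have mV j : measurable_fun (setT : set (g_sigma_algebraType (preimages `[0, +oo[ V))) (V (j%:R * h)).
    move=> _ E mE; rewrite setTI; apply: sub_gen_smallest.
    by exists (j%:R * h); [rewrite /= in_itv/= grid|exists E].
  have -> : A V b = \bigcap_(j in `I_N) ((fun w => incr cf N j (V ^~ w)) @^-1` D b j).
    by apply/seteqP; split.
  apply: (@bigcap_measurableType _ (g_sigma_algebraType (preimages `[0, +oo[ V))) => j jm.
  rewrite -[X in measurable X]setTI.
  exact: (@measurable_funB _ (g_sigma_algebraType (preimages `[0, +oo[ V)) R setT _ _ (mV j.+1) (mV j)).
rewrite (hWB (sA _ _) (sA _ _)) /A.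
rewrite (brownian_increments_iid h0 _ hW (mD true)) (brownian_increments_iid h0 _ hB (mD false)).
have -> : (\prod_e gam (C e) = \prod_(b : bool) \prod_(i < N) gam (C (b, i)))%E.
  by rewrite pair_bigA; apply: eq_bigr => -[].
rewrite big_bool /=.
by congr (_ * _)%E; apply: eq_bigr => i _; rewrite DE.
Qed.

Let path_cyl o (C : bool * 'I_N -> set R) : (forall e, measurable (C e)) ->
  P [set w | forall e, C e (inc cf e (path_of o w))] = (\prod_e gam (C e))%E.
Proof.
move=> mC; rewrite -(incs_original mC); exact: (path_law o (mcyl mC)).
Qed.

Lemma increment_law e (D : set R) : measurable D -> P (increment e @^-1` D) = gam D.
Proof.
move=> mD; case: e => o e.
pose C e' := if e' == e then D else setT.
have mC e' : measurable (C e') by rewrite /C; case: eqP => _; [exact: mD|exact: measurableT].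
rewrite (_ : _ @^-1` _ = [set w | forall e', C e' (inc cf e' (path_of o w))]).
  rewrite path_cyl// (bigD1 e)//= big1 /C ?eqxx ?mule1// => e' /negbTE ->.
  exact: probability_setT.
apply/seteqP; split => w /=; first by move=> Dw e'; rewrite /C; case: eqP => // ->.
by move=> /(_ e); rewrite /C eqxx.
Qed.

(** Over the copies this is the independence of the samples, within one copy that
    of W and B and of the increments of each. *)
Lemma increments_independent : jointly_independent P increment.
Proof.
move=> C mC.
under [RHS]eq_bigr do rewrite increment_law//.
have [_ _ ind] := iid.
pose A o := [set w | forall e, C (o, e) (inc cf e (path_of o w))].
pose K : {set option 'I_M} := finset.finset (fun=> true).
have -> : [set w | forall e, C e (increment e w)] = \bigcap_(o in [set` K]) A o.
  apply/seteqP; split => w /= Cw; first by move=> o _ e; exact: (Cw (o, e)).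
  by move=> [u e]; apply: (Cw u); rewrite /= inE.
rewrite ind; last first.
  move=> o _.
  have key (V V' : R -> Omega -> R) (C' : bool * 'I_N -> set R) : (forall e, measurable (C' e)) ->
     pair_sigma V V' [set w | forall e, C' e (inc cf e (V ^~ w, V' ^~ w))].
    move=> mC'.
    pose T := g_sigma_algebraType (preimages `[0, +oo[ V `|` preimages `[0, +oo[ V').
    have mf : measurable_fun setT ((fun w => (V ^~ w, V' ^~ w)) : T -> ev_path cf N).
      apply: measurable_to_coord => -[b j] _ _ E mE; rewrite setTI.
      apply: sub_gen_smallest; case: b.
        by left; exists (j%:R * h); [rewrite /= in_itv/= grid|exists E].
      by right; exists (j%:R * h); [rewrite /= in_itv/= grid|exists E].
    by have := mf measurableT _ (mcyl mC'); rewrite setTI.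
  case: o => [m|]; first exact: (key _ _ (fun e => C (Some m, e)) (fun e => mC _)).
  exact: (key _ _ (fun e => C (None, e)) (fun e => mC _)).
have -> : (\prod_e gam (C e) = \prod_(o : option 'I_M) \prod_e gam (C (o, e)))%E.
  by rewrite pair_bigA; apply: eq_bigr => -[].
rewrite (eq_bigl xpredT); last by move=> o; rewrite inE.
apply: eq_bigr => o _; exact: path_cyl.
Qed.

Lemma ge0_integral_increment e (f : R -> \bar R) :
  measurable_fun setT f -> (forall x, 0 <= f x)%E ->
  (\int[P]_w f (increment e w) = \int[gam]_x f x)%E.
Proof.
move=> mf f0.
have mX : @measurable_fun _ _ Omega (measurableTypeR R) setT (increment e).
  exact: measurable_increment.
pose X := @mfun_Sub _ _ Omega (measurableTypeR R) (increment e) (mem_set mX).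
transitivity (\int[distribution P X]_x f x)%E.
  by rewrite (@ge0_integral_distribution _ _ _ (measurableTypeR R) R P X f mf f0).
by apply: eq_measure_integral => A mA _; exact: increment_law.
Qed.

Lemma increment_fourth_moment e :
  (\int[P]_w (increment e w ^+ 4)%:E <= (64 * h ^+ 2)%:E)%E.
Proof.
rewrite (ge0_integral_increment e (f := fun x => (x ^+ 4)%:E)); last 2 first.
- by apply/measurable_EFinP; exact: exprn_measurable.
- by move=> x; rewrite lee_fin (exprM x 2 2) sqr_ge0.
have s0 : 0 < Num.sqrt h by rewrite sqrtr_gt0.
apply: (le_trans (normal_fourth_moment s0)).
by rewrite (exprM _ 2 2) sqr_sqrtr// ltW.
Qed.

End samples.

(** * Measurability of the regression basis *)
Section basis_measurability.
Context {R : realType} {d : measure_display} {Omega : measurableType d}.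
Variables (P : probability Omega R) (W : R -> Omega -> R).
Variables (cf : coefs R) (bs : cell_basis R) (N : nat).
Hypothesis wf : basis_wf N bs.
Hypotheses (mb : measurable_fun setT (drift cf)) (ms : measurable_fun setT (diffusion cf)).

Definition before_after (k : nat) : set (bool * 'I_N) :=
  [set e : bool * 'I_N | if e.1 then (e.2 < k)%N else (k <= e.2)%N].

Lemma measurable_dW (S : set (bool * 'I_N)) j (jN : (j < N)%N) : S (true, Ordinal jN) ->
  measurable_fun (setT : set (inc_path cf S)) (dW cf N j).
Proof. by move=> Sj; exact: (@measurable_coord R (path2 (R := R)) _ (@inc R cf N) S _ Sj). Qed.

Lemma measurable_dB (S : set (bool * 'I_N)) j (jN : (j < N)%N) : S (false, Ordinal jN) ->
  measurable_fun (setT : set (inc_path cf S)) (dB cf N j).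
Proof. by move=> Sj; exact: (@measurable_coord R (path2 (R := R)) _ (@inc R cf N) S _ Sj). Qed.

Lemma measurable_XN (S : set (bool * 'I_N)) k : (k <= N)%N ->
  (forall j : 'I_N, (j < k)%N -> S (true, j)) ->
  measurable_fun (setT : set (inc_path cf S)) (XN cf N k).
Proof.
elim: k => [|k IH] kN kS; first exact: measurable_cst.
have mX : measurable_fun (setT : set (inc_path cf S)) (XN cf N k).
  by apply: IH => [|j jk]; [exact: ltnW|apply: kS; rewrite ltnS ltnW].
apply: measurable_funD; first apply: measurable_funD => //.
- by apply: measurable_funM => //; exact: measurableT_comp mb mX.
- apply: measurable_funM; first exact: measurableT_comp ms mX.
  by apply: (measurable_dW (jN := kN)); apply: kS => /=.
Qed.

Lemma measurable_ufun k (i : 'I_(xsize bs k)) : (k <= N)%N ->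
  measurable_fun setT (ufun P W cf N i).
Proof.
move=> kN; have [/(_ k kN)[_ [mc _]] _ _] := wf.
by apply: measurable_funM => //; exact: measurable_indic (mc i).
Qed.

Lemma measurable_vfun (i : 'I_(bsize bs)) : measurable_fun setT (vfun cf N i).
Proof.
have [_ _ [mc _]] := wf.
by apply: measurable_funM => //; exact: measurable_indic (mc i).
Qed.

Lemma measurable_wcomp (S : set (bool * 'I_N)) k l
    (e : widx (xsize bs k) (bsize bs) N l) : (k <= N)%N ->
  (forall j : 'I_N, (j < k)%N -> S (true, j)) ->
  (forall j : 'I_N, (l < j)%N -> S (false, j)) ->
  measurable_fun (setT : set (inc_path cf S)) (fun q => wcomp P W cf q e).
Proof.
move=> kN kS lS; apply: measurable_funM.
  exact: measurableT_comp (measurable_ufun e.1 kN) (measurable_XN kN kS).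
apply: measurable_prod => j _.
apply: measurableT_comp (measurable_vfun (e.2 j)) _.
have jN : (l.+1 + j < N)%N by rewrite -ltn_subRL.
by apply: (measurable_dB (jN := jN)); apply: lS; rewrite /= leq_addr.
Qed.

Lemma measurable_pcoord (S : set (bool * 'I_N)) k
    (e : pidx (xsize bs k) (bsize bs) N k) : (k <= N)%N ->
  before_after k `<=` S ->
  measurable_fun (setT : set (inc_path cf S)) (fun q => pcoord P W cf q e).
Proof.
move=> kN kS; case: e => [i|[l e]].
  apply: measurableT_comp (measurable_ufun i kN) (measurable_XN kN _).
  by move=> j jk; exact: kS.
apply: measurable_funM.
  apply: measurable_wcomp => // j; first by move=> jk; exact: kS.
  by move=> lj; apply: kS; exact: (leq_trans (leq_addr l k) (ltnW lj)).
apply: measurable_funM => //.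
have lN : (k + l < N)%N by rewrite -ltn_subRL.
by apply: (measurable_dB (jN := lN)); apply: kS; exact: (leq_addr l k).
Qed.

Lemma measurable_pvec (S : set (bool * 'I_N)) k a : (k <= N)%N ->
  before_after k `<=` S ->
  measurable_fun (setT : set (inc_path cf S)) (fun q => pvec P W cf bs N k q a 0).
Proof.
move=> kN kS; under eq_fun do rewrite mxE.
exact: measurable_pcoord.
Qed.

Lemma measurable_pvec_noinc (S : set (bool * 'I_N)) k a : (k <= N)%N ->
  (forall j : 'I_N, (j < k)%N -> S (true, j)) ->
  (forall j : 'I_N, (k < j)%N -> S (false, j)) ->
  measurable_fun (setT : set (inc_path cf S)) (fun q => pvec_noinc P W cf bs N k q a 0).
Proof.
move=> kN kS kS'; under eq_fun do rewrite mxE.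
exact: measurable_wcomp.
Qed.

End basis_measurability.

(** * Measurable matrix calculus *)
Section matrix_measurability.
Context {R : realType} {d : measure_display} {T : measurableType d}.

Definition mx_measurable m n (A : T -> 'M[R]_(m, n)) :=
  forall i j, measurable_fun setT (fun w => A w i j).

Lemma measurable_invr (f : T -> R) :
  measurable_fun setT f -> measurable_fun setT (fun w => (f w)^-1).
Proof.
move=> mf.
have -> : (fun w => (f w)^-1) = (fun w => f w * (f w ^+ 2) `^ (-1)).
  apply/funext => w; rewrite powR_inv1 ?sqr_ge0//.
  have [->|f0] := eqVneq (f w) 0; first by rewrite invr0 mul0r.
  by field.
apply: measurable_funM => //.
exact: (measurableT_comp (@measurable_powR R (-1)) (measurable_funX 2 mf)).
Qed.

Lemma mx_measurable_cst m n (A : 'M[R]_(m, n)) : mx_measurable (fun=> A).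
Proof. by move=> i j; exact: measurable_cst. Qed.

Lemma mx_measurableD m n (A B : T -> 'M[R]_(m, n)) :
  mx_measurable A -> mx_measurable B -> mx_measurable (fun w => A w + B w).
Proof.
move=> mA mB i j; under eq_fun do rewrite mxE; exact: measurable_funD.
Qed.

Lemma mx_measurableZ m n (k : T -> R) (A : T -> 'M[R]_(m, n)) :
  measurable_fun setT k -> mx_measurable A -> mx_measurable (fun w => k w *: A w).
Proof.
move=> mk mA i j; under eq_fun do rewrite mxE; exact: measurable_funM.
Qed.

Lemma mx_measurableN m n (A : T -> 'M[R]_(m, n)) :
  mx_measurable A -> mx_measurable (fun w => - A w).
Proof.
move=> mA; under eq_fun do rewrite -scaleN1r.
by apply: mx_measurableZ => //; exact: measurable_cst.
Qed.

Lemma mx_measurableB m n (A B : T -> 'M[R]_(m, n)) :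
  mx_measurable A -> mx_measurable B -> mx_measurable (fun w => A w - B w).
Proof. by move=> mA mB; apply: mx_measurableD => //; exact: mx_measurableN. Qed.

Lemma mx_measurable_sum (I : Type) (r : seq I) m n (A : I -> T -> 'M[R]_(m, n)) :
  (forall i, mx_measurable (A i)) -> mx_measurable (fun w => \sum_(i <- r) A i w).
Proof.
move=> mA i j; under eq_fun do rewrite summxE.
by apply: measurable_sum => k; exact: mA.
Qed.

Lemma mx_measurableM m n q (A : T -> 'M[R]_(m, n)) (B : T -> 'M[R]_(n, q)) :
  mx_measurable A -> mx_measurable B -> mx_measurable (fun w => A w *m B w).
Proof.
move=> mA mB i j; under eq_fun do rewrite mxE.
by apply: measurable_sum => k; exact: measurable_funM.
Qed.

Lemma mx_measurable_tr m n (A : T -> 'M[R]_(m, n)) :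
  mx_measurable A -> mx_measurable (fun w => (A w)^T).
Proof. by move=> mA i j; under eq_fun do rewrite mxE; exact: mA. Qed.

Lemma mx_measurable_col m1 m2 n (A : T -> 'M[R]_(m1, n)) (B : T -> 'M[R]_(m2, n)) :
  mx_measurable A -> mx_measurable B -> mx_measurable (fun w => col_mx (A w) (B w)).
Proof.
move=> mA mB i j; under eq_fun do rewrite mxE.
by case: (fintype.split i) => k; [exact: mA|exact: mB].
Qed.

Lemma measurable_det n (A : T -> 'M[R]_n) :
  mx_measurable A -> measurable_fun setT (fun w => \det (A w)).
Proof.
move=> mA; rewrite /determinant.
apply: measurable_sum => s; apply: measurable_funM => //.
by apply: measurable_prod => i _; exact: mA.
Qed.

(** Used in place of [invmx] because its measurability in the matrix is plain. *)
Definition cramer n (A : 'M[R]_n) (z : 'cV[R]_n) := (\det A)^-1 *: (\adj A *m z).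

Lemma cramerE n (A : 'M[R]_n) x z : A \in unitmx -> A *m x = z -> x = cramer A z.
Proof.
move=> uA <-; rewrite /cramer mulmxA mul_adj_mx mul_scalar_mx scalerA mulVr ?scale1r//.
Qed.

Lemma mx_measurable_cramer n (A : T -> 'M[R]_n) (z : T -> 'cV[R]_n) :
  mx_measurable A -> mx_measurable z -> mx_measurable (fun w => cramer (A w) (z w)).
Proof.
move=> mA mz; apply: mx_measurableZ.
  exact/measurable_invr/measurable_det.
apply: mx_measurableM => // i j; under eq_fun do rewrite mxE.
rewrite /cofactor; apply: measurable_funM => //.
apply: measurable_det => a b; under eq_fun do rewrite !mxE; exact: mA.
Qed.

Lemma measurable_dot n (a b : T -> 'cV[R]_n) :
  mx_measurable a -> mx_measurable b -> measurable_fun setT (fun w => dot (a w) (b w)).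
Proof.
by move=> ma mb; apply: measurable_sum => i; exact: measurable_funM.
Qed.

Lemma measurable_enorm n (a : T -> 'cV[R]_n) :
  mx_measurable a -> measurable_fun setT (fun w => enorm (a w)).
Proof.
move=> ma; apply: measurableT_comp (measurable_dot ma ma).
by apply: continuous_measurable_fun; exact: sqrt_continuous.
Qed.

End matrix_measurability.

Section spectral_events.
Context {R : realType}.

(** By density, countably many vectors decide whether the quadratic form of S is
    bounded by e; this makes the events on the spectral norm measurable. *)
Lemma rational_quad n (S : 'M[R]_n) (e : R) :
  (forall x : 'rV[rat]_n, let y := map_mx ratr x^T in `|dot y (S *m y)| <= e * dot y y) ->
  forall x, `|dot x (S *m x)| <= e * dot x x.
Proof.
move=> Sx x.
pose D := [set y : 'rV[R]_n | `|dot y^T (S *m y^T)| <= e * dot y^T y^T].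
have cD : closed D.
  rewrite (_ : D = ((fun y : 'rV[R]_n => cst e y * dot y^T (1%:M *m y^T)) \-
     (Num.norm \o (fun y : 'rV[R]_n => dot y^T (S *m y^T)))) @^-1` [set r | 0 <= r]).
    apply: closed_comp; last exact: closed_ge.
    move=> y _; apply: continuousB.
      by apply: (@continuousM _ _ (cst e)); [exact: cst_continuous|exact: continuous_dot_row].
    by apply: continuous_comp; [exact: continuous_dot_row|exact: norm_continuous].
  by apply/seteqP; split => y; rewrite /D /= mul1mx subr_ge0.
suff : D x^T by rewrite /D /= trmxK.
apply: cD => A [E Ex EA].
have /choice [r Er] : forall i : 'I_n, exists q : rat, E ord0 i (ratr q).
  move=> i; have : nbhs (x i 0) (E ord0 i) by have := Ex ord0 i; rewrite mxE.
  rewrite nbhsE => -[Q0 [opQ Qx] QE].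
  have [r [Qr [q _ rq]]] := @dense_rat R Q0 (ex_intro _ _ Qx) opQ.
  by exists q; apply: QE; rewrite rq.
exists (map_mx ratr (\row_i r i)); split.
  rewrite /D /=; have := Sx (\row_i r i); rewrite /= map_trmx; exact.
by apply: EA => i j; rewrite ord1 !mxE.
Qed.

Lemma measurable_eignorm_le d (T : measurableType d) n (S : T -> 'M[R]_n) (e : R) :
  0 <= e -> (forall w, (S w)^T = S w) -> mx_measurable S ->
  measurable [set w | eignorm (S w) <= e].
Proof.
move=> e0 symS mS.
rewrite (_ : [set w | _] = \bigcap_(x in [set: 'rV[rat]_n])
   [set w | `|dot (map_mx ratr x^T) (S w *m map_mx ratr x^T)|
            <= e * dot (map_mx ratr x^T) (map_mx ratr x^T : 'cV[R]_n)]); last first.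
  apply/seteqP; split => w /=; first by move=> Sw x _ /=; exact: eignorm_quad.
  move=> Sw; apply: quad_eignorm => //; apply: rational_quad => x; exact: Sw.
rewrite -[X in measurable X]setCK setC_bigcap; apply: measurableC.
apply: countable_bigcupT_measurable => [|x]; first exact: countableP.
apply: measurableC; set y := map_mx ratr _.
rewrite (_ : mkset _ = (fun w => `|dot y (S w *m y)|) @^-1` `]-oo, e * dot y y]%classic).
  rewrite -[X in measurable X]setTI.
  have mf : measurable_fun setT (fun w => `|dot y (S w *m y)|).
    apply: measurableT_comp => //; apply: measurable_dot; first exact: mx_measurable_cst.
    by apply: mx_measurableM => //; exact: mx_measurable_cst.
  by apply: mf => //; exact: measurable_itv.
by apply/seteqP; split => w /=; rewrite in_itv.
Qed.

End spectral_events.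

(** * Orthonormal families in L^2 *)
Section square_integrable.
Context {R : realType} {d : measure_display} {Omega : measurableType d}.
Variable P : probability Omega R.
Implicit Types U V : Omega -> R.

Definition sqint U := measurable_fun setT U /\
  P.-integrable setT (EFin \o (fun w => U w ^+ 2)).

Lemma Lfun2_sqint U : U \in Lfun P 2%:E -> sqint U.
Proof.
move=> LU; split; last exact: Lfun2_integrable_sqr.
by move: LU; rewrite inE => /andP[]; rewrite inE.
Qed.

Lemma integrable_ge0 U : measurable_fun setT U -> (forall w, 0 <= U w) ->
  (\int[P]_w (U w)%:E < +oo)%E -> P.-integrable setT (EFin \o U).
Proof.
move=> mU U0 Uoo; apply/integrableP; split; first exact/measurable_EFinP.
by under eq_integral do rewrite /= ger0_norm//.
Qed.

Lemma sqintM_integrable U V : sqint U -> sqint V ->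
  P.-integrable setT (EFin \o (fun w => U w * V w)).
Proof.
move=> [mU iU] [mV iV].
apply: (@le_integrable _ _ _ _ _ _ _ (fun w => (U w ^+ 2)%:E + (V w ^+ 2)%:E)%E) => //.
- by apply/measurable_EFinP; exact: measurable_funM.
- move=> w _; rewrite -EFinD /= lee_fin normrM.
  rewrite [leRHS]ger0_norm ?addr_ge0 ?sqr_ge0//.
  rewrite -(real_normK (num_real (U w))) -(real_normK (num_real (V w))).
  have := sqr_ge0 (`|U w| - `|V w|); have := sqr_ge0 `|U w|; have := sqr_ge0 `|V w|; nra.
- exact: integrableD.
Qed.

Lemma sqint_cst c : sqint (fun=> c).
Proof.
split; first exact: measurable_cst.
exact: finite_measure_integrable_cst.
Qed.

Lemma sqint_integrable U : sqint U -> P.-integrable setT (EFin \o U).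
Proof.
move=> sU; have := sqintM_integrable sU (sqint_cst 1).
by apply: eq_integrable => // w _; rewrite /= mulr1.
Qed.

Lemma sqintZ c U : sqint U -> sqint (fun w => c * U w).
Proof.
move=> [mU iU]; split; first exact: measurable_funM.
have -> : EFin \o (fun w => (c * U w) ^+ 2) = (fun w => (c ^+ 2)%:E * (U w ^+ 2)%:E)%E.
  by apply/funext => w; rewrite /= exprMn EFinM.
exact: integrableZl.
Qed.

Lemma sqintD U V : sqint U -> sqint V -> sqint (fun w => U w + V w).
Proof.
move=> sU sV; have iUV := sqintM_integrable sU sV.
case: sU sV => [mU iU] [mV iV]; split; first exact: measurable_funD.
have -> : EFin \o (fun w => (U w + V w) ^+ 2) =
   (fun w => ((U w ^+ 2)%:E + (V w ^+ 2)%:E) + 2%:E * (U w * V w)%:E)%E.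
  by apply/funext => w; rewrite /= -EFinM -!EFinD; congr EFin; ring.
by apply: integrableD => //; [exact: integrableD|exact: integrableZl].
Qed.

Lemma sqintB U V : sqint U -> sqint V -> sqint (fun w => U w - V w).
Proof.
move=> sU sV; have -> : (fun w => U w - V w) = (fun w => U w + (-1) * V w).
  by apply/funext => w; rewrite mulN1r.
by apply: sqintD => //; exact: sqintZ.
Qed.

Lemma sqint_sum (J : Type) (r : seq J) (F : J -> Omega -> R) :
  (forall j, sqint (F j)) -> sqint (fun w => \sum_(j <- r) F j w).
Proof.
move=> sF; elim: r => [|j r IH].
  by under eq_fun do rewrite big_nil; exact: sqint_cst.
by under eq_fun do rewrite big_cons; exact: sqintD.
Qed.

Lemma eq_sqint U V : sqint U -> measurable_fun setT V -> U = V %[ae P] -> sqint V.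
Proof.
move=> [mU iU] mV UV; split => //.
have mU2 : measurable_fun setT (fun w => (U w ^+ 2)%:E : \bar R).
  by apply/measurable_EFinP; exact: measurable_funX.
have mV2 : measurable_fun setT (fun w => (V w ^+ 2)%:E : \bar R).
  by apply/measurable_EFinP; exact: measurable_funX.
apply: integrable_ge0; [exact: measurable_funX|by move=> w; exact: sqr_ge0|].
rewrite (ge0_ae_eq_integral (g := fun w => (U w ^+ 2)%:E))//.
- by have := integrable_lty measurableT iU.
- by move=> w _; rewrite lee_fin sqr_ge0.
- by move=> w _; rewrite lee_fin sqr_ge0.
- by apply: filterS UV => w /= UVw _; rewrite UVw.
Qed.

Lemma sqint_Lipschitz (L : R) U V : measurable_fun setT V -> sqint U ->
  (forall w, V w ^+ 2 <= L * U w ^+ 2) -> sqint V.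
Proof.
move=> mV [mU iU] VU; split => //.
apply: (@le_integrable _ _ _ _ _ _ _ (fun w => L%:E * (U w ^+ 2)%:E)%E) => //.
- by apply/measurable_EFinP; exact: measurable_funX.
- move=> w _; rewrite -EFinM /= lee_fin ger0_norm ?sqr_ge0//.
  exact: le_trans (VU w) (ler_norm _).
- exact: integrableZl.
Qed.

Lemma Rintegral_sum (J : Type) (r : seq J) (F : J -> Omega -> R) :
  (forall j, P.-integrable setT (EFin \o F j)) ->
  (\int[P]_w (\sum_(j <- r) F j w) = \sum_(j <- r) \int[P]_w F j w)%R.
Proof.
move=> iF; have iS s : P.-integrable setT (EFin \o (fun w => \sum_(j <- s) F j w)).
  rewrite (_ : _ \o _ = (fun w => \sum_(j <- s) (F j w)%:E)%E); last first.
    by apply/funext => w; rewrite /= sumEFin.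
  by apply: (integrable_sum measurableT) => j _; exact: iF.
elim: r => [|j r IH].
  by under eq_Rintegral do rewrite big_nil; rewrite big_nil Rintegral_cst// mul0r.
under eq_Rintegral do rewrite big_cons.
by rewrite RintegralD// IH big_cons.
Qed.

Lemma EFin_Rintegral U : P.-integrable setT (EFin \o U) ->
  ((\int[P]_w U w)%R%:E = \int[P]_w (U w)%:E)%E.
Proof. by move=> iU; rewrite fineK//; exact: integrable_fin_num. Qed.

Lemma ae_eq_Rintegral U V : measurable_fun setT U -> measurable_fun setT V ->
  U = V %[ae P] -> (\int[P]_w U w = \int[P]_w V w)%R.
Proof.
move=> mU mV UV; congr fine; apply: ae_eq_integral => //.
- exact/measurable_EFinP.
- exact/measurable_EFinP.
- by apply: filterS UV => w /= UVw _; rewrite UVw.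
Qed.

End square_integrable.

Section orthonormal_family.
Context {R : realType} {d : measure_display} {Omega : measurableType d}.
Variable P : probability Omega R.
Context {n : nat} (p : Omega -> 'cV[R]_n).
Hypothesis sp : forall a, sqint P (fun w => p w a 0).
Hypothesis op : forall a b, (\int[P]_w (p w a 0 * p w b 0) = (a == b)%:R)%R.

(** The coefficients of the orthogonal projection of U on the span of p. *)
Definition coefs_of (U : Omega -> R) : 'cV[R]_n := \col_j (\int[P]_w (U w * p w j 0))%R.

Lemma sqint_dot c : sqint P (fun w => dot c (p w)).
Proof. by apply: sqint_sum => j; exact: sqintZ. Qed.

Lemma dot_coefs_of U c : sqint P U ->
  (\int[P]_w (U w * dot c (p w)) = dot (coefs_of U) c)%R.
Proof.
move=> sU; rewrite dotC /dot.
under eq_Rintegral => w _.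
  rewrite mulr_sumr; under eq_bigr do rewrite mulrCA.
  over.
rewrite Rintegral_sum => [|j]; last first.
  have := sqintM_integrable (sqintZ (c j 0) sU) (sp j).
  by apply: eq_integrable => // w _; rewrite /= mulrA.
apply: eq_bigr => j _; rewrite mxE RintegralZl//.
exact: sqintM_integrable.
Qed.

Lemma coefs_of_dot c : coefs_of (fun w => dot c (p w)) = c.
Proof.
apply/matrixP => i j; rewrite ord1 mxE.
under eq_Rintegral do rewrite mulrC.
under eq_Rintegral => w _.
  rewrite /dot mulr_sumr; under eq_bigr do rewrite mulrCA.
  over.
rewrite Rintegral_sum => [|l]; last first.
  have := sqintM_integrable (sqintZ (c l 0) (sp i)) (sp l).
  by apply: eq_integrable => // w _; rewrite /= mulrA.
rewrite (bigD1 i)//= big1 ?addr0 => [|l li].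
  rewrite RintegralZl//; last exact: sqintM_integrable.
  by rewrite op eqxx mulr1.
rewrite RintegralZl//; last exact: sqintM_integrable.
by rewrite op eq_sym (negbTE li) mulr0.
Qed.

Lemma dot_dot c e : (\int[P]_w (dot c (p w) * dot e (p w)) = dot c e)%R.
Proof. by rewrite dot_coefs_of ?coefs_of_dot//; exact: sqint_dot. Qed.

Lemma integral_dot_sqr c : (\int[P]_w (dot c (p w) ^+ 2)%:E = (dot c c)%:E)%E.
Proof.
rewrite -dot_dot EFin_Rintegral; last by apply: sqintM_integrable; exact: sqint_dot.
by apply: eq_integral => w _; rewrite expr2.
Qed.

Lemma coefs_ofD U V : sqint P U -> sqint P V ->
  coefs_of (fun w => U w + V w) = coefs_of U + coefs_of V.
Proof.
move=> sU sV; apply/matrixP => i j; rewrite !mxE.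
rewrite -RintegralD//; try exact: sqintM_integrable.
by apply: eq_Rintegral => w _; rewrite mulrDl.
Qed.

Lemma coefs_ofZ c U : sqint P U -> coefs_of (fun w => c * U w) = c *: coefs_of U.
Proof.
move=> sU; apply/matrixP => i j; rewrite !mxE.
rewrite -RintegralZl//; last exact: sqintM_integrable.
by apply: eq_Rintegral => w _; rewrite mulrA.
Qed.

Lemma coefs_of_ae U V : measurable_fun setT U -> measurable_fun setT V ->
  U = V %[ae P] -> coefs_of U = coefs_of V.
Proof.
move=> mU mV UV; apply/matrixP => i j; rewrite !mxE.
have mp a := (sp a).1.
apply: ae_eq_Rintegral; [exact: measurable_funM|exact: measurable_funM|].
by apply: filterS UV => w /= UVw _; rewrite UVw.
Qed.

Lemma bessel U : sqint P U -> dot (coefs_of U) (coefs_of U) <= (\int[P]_w (U w ^+ 2))%R.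
Proof.
move=> sU; set c := coefs_of U.
have sc := sqint_dot c.
have h1 := dot_coefs_of c sU; rewrite -/c in h1.
have h2 := dot_dot c c.
have i1 : P.-integrable setT (EFin \o (fun w => U w * dot c (p w))).
  exact: sqintM_integrable.
have i2 : P.-integrable setT (EFin \o (fun w => dot c (p w) * dot c (p w))).
  exact: sqintM_integrable.
have : (\int[P]_w (U w * dot c (p w) + U w * dot c (p w)) <=
        \int[P]_w (U w ^+ 2 + dot c (p w) * dot c (p w)))%R.
  apply: le_Rintegral => //; first exact: (integrableD _ i1 i1).
    exact: (integrableD _ sU.2 i2).
  by move=> w _; have := sqr_ge0 (U w - dot c (p w)); nra.
by rewrite RintegralD// RintegralD// ?h1 ?h2; [lra|exact: sU.2].
Qed.

(** The coefficients given by the definition of a projection are read off by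
    testing its orthogonality against each component of p. *)
Lemma orth_proj_coefs U V : orth_proj P p U V -> V = (fun w => dot (coefs_of U) (p w)) %[ae P].
Proof.
move=> [/Lfun2_sqint sU /Lfun2_sqint sV [c Vc] ort].
suff -> : coefs_of U = c by [].
rewrite -(coefs_of_dot c) -(coefs_of_ae sV.1 (sqint_dot c).1 Vc).
apply/matrixP => j k; rewrite !mxE {k}.
apply/eqP; rewrite -subr_eq0 -RintegralB//; try exact: sqintM_integrable.
have := ort (delta_mx j 0); rewrite unlock => /(congr1 fine) /= H.
apply/eqP; rewrite -[RHS]H; apply: eq_Rintegral => w _.
rewrite -mulrBl; congr (_ * _).
rewrite /dot (bigD1 j)//= mxE !eqxx mul1r big1 ?addr0// => i /negbTE ij.
by rewrite mxE ij mul0r.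
Qed.

End orthonormal_family.

(** * Independent blocks of increments *)
Section independent_square_integrable.
Context {R : realType} {d : measure_display} {Omega : measurableType d}.
Variable P : probability Omega R.
Context {G1 G2 : set (set Omega)}.
Hypotheses (sG1 : <<s G1 >> `<=` measurable) (sG2 : <<s G2 >> `<=` measurable).
Hypothesis G12 : independent2 P <<s G1 >> <<s G2 >>.
Variables (U V : Omega -> R).
Hypothesis mU : measurable_fun (setT : set (g_sigma_algebraType G1)) U.
Hypothesis mV : measurable_fun (setT : set (g_sigma_algebraType G2)) V.

Lemma independentM_integrable :
  P.-integrable setT (EFin \o U) -> P.-integrable setT (EFin \o V) ->
  P.-integrable setT (EFin \o (fun w => U w * V w)).
Proof.
move=> iU iV; have [mU' mV'] : measurable_fun setT U /\ measurable_fun setT V.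
  by split; [exact: measurable_sub1 mU|exact: measurable_sub2 mV].
apply/integrableP; split; first by apply/measurable_EFinP; exact: measurable_funM.
under eq_integral do rewrite /= normrM.
rewrite (independent_ge0_integralM sG1 sG2 G12 (U := fun w => `|U w|) (V := fun w => `|V w|))//.
- have /integrableP[_ Uoo] := iU; have /integrableP[_ Voo] := iV.
  by apply: lte_mul_pinfty => //; [exact: integral_ge0|rewrite ge0_fin_numE//; exact: integral_ge0].
- exact: measurableT_comp.
- exact: measurableT_comp.
Qed.

Lemma independentM_Rintegral :
  P.-integrable setT (EFin \o U) -> P.-integrable setT (EFin \o V) ->
  (\int[P]_w (U w * V w) = (\int[P]_w U w) * (\int[P]_w V w))%R.
Proof.
move=> iU iV.
rewrite /Rintegral (independent_integralM sG1 sG2 G12 mU mV iU iV).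
  by rewrite fineM//; exact: integrable_fin_num.
exact: independentM_integrable.
Qed.

End independent_square_integrable.

Lemma independentM_sqint {R : realType} {d} {Omega : measurableType d} (P : probability Omega R)
  (G1 G2 : set (set Omega)) (U V : Omega -> R) :
  <<s G1 >> `<=` measurable -> <<s G2 >> `<=` measurable ->
  independent2 P <<s G1 >> <<s G2 >> ->
  measurable_fun (setT : set (g_sigma_algebraType G1)) U ->
  measurable_fun (setT : set (g_sigma_algebraType G2)) V ->
  sqint P U -> sqint P V -> sqint P (fun w => U w * V w).
Proof.
move=> sG1 sG2 G12 mU mV [mU' iU] [mV' iV]; split; first exact: measurable_funM.
have := independentM_integrable sG1 sG2 G12 (measurable_funX 2 mU) (measurable_funX 2 mV) iU iV.
by apply: eq_integrable => // w _; rewrite /= exprMn.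
Qed.

Record regression_setting {R : realType} {d : measure_display} {Omega : measurableType d}
    (P : probability Omega R) (W B : R -> Omega -> R) (cf : coefs R) (bs : cell_basis R)
    (N M : nat) (Ws Bs : 'I_M -> R -> Omega -> R) : Prop := RegressionSetting {
  mesh_gt0 : 0 < mesh cf N;
  steps_gt0 : (0 < N)%N;
  setting_W : brownian P W;
  setting_B : brownian P B;
  setting_WB : independent2 P (path_sigma W) (path_sigma B);
  setting_iid : iid_copies P W B Ws Bs;
  setting_wf : basis_wf N bs;
  setting_drift : measurable_fun setT (drift cf);
  setting_diffusion : measurable_fun setT (diffusion cf);
  setting_ortho : orthonormal_basis P W B cf bs N }.

Section setting.
Context {R : realType} {d : measure_display} {Omega : measurableType d}.
Context {P : probability Omega R} {W B : R -> Omega -> R} {cf : coefs R}.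
Context {bs : cell_basis R} {N M : nat} {Ws Bs : 'I_M -> R -> Omega -> R}.
Hypothesis H : regression_setting P W B cf bs N Ws Bs.
Local Notation h := (mesh cf N).
Local Notation inco := (increment W B cf (N := N) Ws Bs).
Local Notation qo := (path_of W B Ws Bs).
Implicit Types U : set (option 'I_M * (bool * 'I_N)).

Definition block U : set (set Omega) := coord_sets inco U.

Lemma block_sub U : <<s block U >> `<=` measurable.
Proof.
apply: coord_sets_measurable.
exact: (measurable_increment (mesh_gt0 H) (setting_W H) (setting_B H) (setting_iid H)).
Qed.

Lemma block_independent U U' : (forall e, U e -> ~ U' e) ->
  independent2 P <<s block U >> <<s block U' >>.
Proof.
move=> UU'; apply: blocks_independent => //.
- exact: (measurable_increment (mesh_gt0 H) (setting_W H) (setting_B H) (setting_iid H)).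
- exact: (increments_independent (mesh_gt0 H) (setting_W H) (setting_B H) (setting_WB H) (setting_iid H)).
Qed.

Lemma block_path d' (T' : measurableType d') (S : set (bool * 'I_N)) U o (F : path2 (R := R) -> T') :
  measurable_fun (setT : set (inc_path cf S)) F -> (forall e, S e -> U (o, e)) ->
  measurable_fun (setT : set (g_sigma_algebraType (block U))) (fun w => F (qo o w)).
Proof.
move=> mF SU.
have mq : measurable_fun setT (qo o : g_sigma_algebraType (block U) -> inc_path cf S).
  apply: measurable_to_coord => e Se.
  exact: (@measurable_coord R Omega _ inco U (o, e) (SU e Se)).
exact: measurableT_comp mF mq.
Qed.

Lemma measurable_block d' (T' : measurableType d') U (F : Omega -> T') :
  measurable_fun (setT : set (g_sigma_algebraType (block U))) F -> measurable_fun setT F.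
Proof. by move=> mF _ C mC; apply: (@block_sub U); exact: mF. Qed.

Lemma measurable_inc_path d' (T' : measurableType d') (S : set (bool * 'I_N)) (F : path2 (R := R) -> T') :
  measurable_fun (setT : set (inc_path cf S)) F ->
  measurable_fun (setT : set (ev_path cf N)) F.
Proof.
move=> mF.
have mq : measurable_fun setT (id : ev_path cf N -> inc_path cf S).
  by apply: measurable_to_coord => e Se; exact: measurable_inc_ev.
exact: measurableT_comp mF mq.
Qed.

Lemma block_increment U e : U e ->
  measurable_fun (setT : set (g_sigma_algebraType (block U))) (inco e).
Proof. by move=> Ue; exact: (@measurable_coord R Omega _ inco U e Ue). Qed.

Let mp := measurable_pvec P W (setting_wf H) (setting_drift H) (setting_diffusion H).

Lemma original_basis_sqint k a : (k <= N)%N ->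
  sqint P (fun w => pvec P W cf bs N k (bpath W B w) a 0).
Proof.
move=> kN; have mpa : measurable_fun setT (fun w => pvec P W cf bs N k (bpath W B w) a 0).
  by apply: (@measurable_block _ _ setT); apply: (block_path (S := before_after k) (o := None)
    (F := fun q => pvec P W cf bs N k q a 0)) => //; exact: mp.
split=> //; apply: integrable_ge0; first exact: measurable_funX.
  by move=> w; exact: sqr_ge0.
have := setting_ortho H kN a a; rewrite unlock eqxx => e1.
by under eq_integral do rewrite expr2; rewrite e1 ltry.
Qed.

Lemma original_basis_ortho k a b : (k <= N)%N ->
  (\int[P]_w (pvec P W cf bs N k (bpath W B w) a 0 * pvec P W cf bs N k (bpath W B w) b 0)
   = (a == b)%:R)%R.
Proof. by move=> kN; have := setting_ortho H kN a b; rewrite unlock /Rintegral => ->. Qed.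

Let meas_mean e : measurable_fun setT (inco e).
Proof. exact: (measurable_increment (mesh_gt0 H) (setting_W H) (setting_B H) (setting_iid H)). Qed.

Let inc_int e f := @ge0_integral_increment _ _ _ P W B cf N M Ws Bs (mesh_gt0 H)
  (setting_W H) (setting_B H) (setting_WB H) (setting_iid H) e f.

(** The first two moments of the increments are encoded in the orthonormality
    of the basis: at the last step the components u and u * dB / sqrt h are
    orthonormal, and u is independent of dB. *)
Let last_step_moments : exists e,
  sqint P (inco e) /\ (\int[P]_w inco e w = 0)%R /\ (\int[P]_w (inco e w ^+ 2) = h)%R.
Proof.
have N0 := steps_gt0 H; have h0 := mesh_gt0 H.
have kN : (N.-1 < N)%N by rewrite prednK.
have [xs b0 _] := setting_wf H.
have [x0 _] := xs N.-1 (ltnW kN).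
have lN : (0 < N - N.-1)%N by rewrite subn_gt0.
pose i0 := Ordinal x0; pose l0 := Ordinal lN.
pose ee : widx (xsize bs N.-1) (bsize bs) N (N.-1 + l0) := (i0, [ffun=> Ordinal b0]).
pose a := enum_rank (inl i0 : pidx (xsize bs N.-1) (bsize bs) N N.-1).
pose b := enum_rank (inr (existT (fun l : 'I_(N - N.-1) => widx (xsize bs N.-1) (bsize bs) N (N.-1 + l)) l0 ee)
   : pidx (xsize bs N.-1) (bsize bs) N N.-1).
pose e : option 'I_M * (bool * 'I_N) := (None, (false, Ordinal kN)).
exists e.
pose u w := ufun P W cf N i0 (XN cf N N.-1 (bpath W B w)).
pose p w := pvec P W cf bs N N.-1 (bpath W B w).
have pa w : p w a 0 = u w by rewrite mxE enum_rankK.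
have pb w : p w b 0 = u w * (inco e w / Num.sqrt h).
  rewrite mxE enum_rankK /= /wcomp big1 ?mulr1; last first.
    by move=> j _; exfalso; case: j => j; rewrite addn0 prednK// subnn.
  by congr (_ * (_ / _)); rewrite /dB addn0.
have su : sqint P u.
  have := original_basis_sqint a (ltnW kN).
  by rewrite (_ : (fun w => _) = u)//; apply/funext => w; exact: pa.
have u1 : (\int[P]_w (u w ^+ 2) = 1)%R.
  transitivity ((a == a)%:R : R); last by rewrite eqxx.
  rewrite -(original_basis_ortho a a (ltnW kN)).
  by apply: eq_Rintegral => w _; rewrite -/(p w) pa expr2.
have s0 : Num.sqrt h != 0 by rewrite sqrtr_eq0 -ltNge.
pose U1 : set (option 'I_M * (bool * 'I_N)) := [set e' : option 'I_M * (bool * 'I_N) | e'.2.1].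
pose U2 := [set e].
have U12 : forall e', U1 e' -> ~ U2 e' by move=> e' + ee'; rewrite ee'.
have mu : measurable_fun (setT : set (g_sigma_algebraType (block U1))) u.
  apply: (block_path (S := [set e : bool * 'I_N | e.1]) (o := None) (F := fun q => ufun P W cf N i0 (XN cf N N.-1 q))) => //.
  have mX : measurable_fun (setT : set (inc_path cf [set e : bool * 'I_N | e.1])) (XN cf N N.-1).
    exact: (measurable_XN (setting_drift H) (setting_diffusion H) (ltnW kN)).
  exact: (measurableT_comp (measurable_ufun P W cf (setting_wf H) i0 (ltnW kN)) mX).
have mi : measurable_fun (setT : set (g_sigma_algebraType (block U2))) (inco e).
  exact: block_increment.
have sp := original_basis_sqint b (ltnW kN).
have ind := block_independent U12.
have E2 : (\int[P]_w (inco e w ^+ 2)%:E = h%:E)%E.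
  have := independent_ge0_integralM (@block_sub U1) (@block_sub U2) ind
     (U := fun w => u w ^+ 2) (V := fun w => inco e w ^+ 2).
  move=> /(_ (measurable_funX 2 mu) (measurable_funX 2 mi) (fun w => sqr_ge0 _) (fun w => sqr_ge0 _)).
  rewrite -(EFin_Rintegral su.2) u1 mul1e => <-.
  have e1 : (\int[P]_w (p w b 0 * p w b 0) = 1)%R.
    by rewrite (original_basis_ortho b b (ltnW kN)) eqxx.
  rewrite -[h]mulr1 -[X in (h * X)]e1 -RintegralZl//; last exact: sqintM_integrable.
  rewrite EFin_Rintegral; last first.
    have := sqintM_integrable (sqintZ h sp) sp.
    by apply: eq_integrable => // w _; rewrite /= mulrA.
  apply: eq_integral => w _; rewrite -/(p w) pb; congr EFin.
  have : Num.sqrt h ^+ 2 = h by rewrite sqr_sqrtr// ltW.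
  by move=> {1}<-; field.
have si : sqint P (inco e).
  split=> //; apply: integrable_ge0; [exact: measurable_funX|by move=> w; exact: sqr_ge0|].
  by rewrite E2 ltry.
split=> //; split; last by rewrite /Rintegral E2.
have sab := original_basis_ortho a b (ltnW kN).
have ab : a == b = false by apply/negbTE; rewrite (inj_eq enum_rank_inj).
have iu2 : P.-integrable setT (EFin \o (fun w => u w * u w)) by exact: sqintM_integrable.
have := independentM_Rintegral (@block_sub U1) (@block_sub U2) ind
   (U := fun w => u w * u w) (measurable_funM mu mu) mi iu2 (sqint_integrable si).
have -> : (\int[P]_w (u w * u w) = 1)%R.
  by rewrite -u1; apply: eq_Rintegral => w _; rewrite expr2.
rewrite mul1r => <-.
rewrite ab in sab.
rewrite -[RHS](mulr0 (Num.sqrt h)) -[X in _ = _ * X]sab -RintegralZl//; last first.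
  exact: sqintM_integrable (original_basis_sqint a (ltnW kN)) sp.
apply: eq_Rintegral => w _; rewrite -/(p w) pa pb.
by field.
Qed.

Lemma increment_moments e : sqint P (inco e) /\
  (\int[P]_w inco e w = 0)%R /\ (\int[P]_w (inco e w ^+ 2) = h)%R.
Proof.
have [e0 [s0 [m0 v0]]] := last_step_moments.
have m2 : measurable_fun setT (fun x : R => (x ^+ 2)%:E : \bar R).
  by apply/measurable_EFinP; exact: exprn_measurable.
have tr (f : R -> \bar R) : measurable_fun setT f -> (forall x, 0 <= f x)%E ->
   (\int[P]_w f (inco e w) = \int[P]_w f (inco e0 w))%E.
  by move=> mf f0; rewrite !(inc_int _ mf f0).
have E2 : (\int[P]_w (inco e w ^+ 2)%:E = \int[P]_w (inco e0 w ^+ 2)%:E)%E.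
  by apply: (tr (fun x => (x ^+ 2)%:E)) => // x; rewrite lee_fin sqr_ge0.
split; [|split].
- split=> //; apply: integrable_ge0; [exact: measurable_funX|by move=> w; exact: sqr_ge0|].
  by rewrite E2; have := integrable_lty measurableT s0.2.
- rewrite -m0 /Rintegral; congr fine.
  rewrite integralE [RHS]integralE !numfun.funepos.unlock !numfun.funeneg.unlock; congr (_ - _)%E.
  + apply: (tr (fun x => maxe x%:E 0)%E) => [|x]; last by rewrite le_max lexx orbT.
    by apply: measurable_maxe => //; exact/measurable_EFinP.
  + apply: (tr (fun x => maxe (- x%:E) 0)%E) => [|x]; last by rewrite le_max lexx orbT.
    by apply: measurable_maxe => //; apply/measurable_EFinP; exact: oppr_measurable.
- by rewrite -v0 /Rintegral E2.
Qed.

End setting.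

(** * Measurability of Lipschitz functions of several variables *)
Section lipschitz_measurability.
Context {R : realType} {d : measure_display} {T : measurableType d}.

(** F is the infimum of the functions F(q) + K |. - q| over rational triples q, so
    its sublevel sets are countable unions. *)
Lemma measurable_lipschitz3 (F : R -> R -> R -> R) (K : R) (a b c : T -> R) :
  0 <= K ->
  (forall x y z x' y' z', `|F x y z - F x' y' z'| <=
     K * (`|x - x'| + `|y - y'| + `|z - z'|)) ->
  measurable_fun setT a -> measurable_fun setT b -> measurable_fun setT c ->
  measurable_fun setT (fun w => F (a w) (b w) (c w)).
Proof.
move=> K0 FK ma mb mc.
apply: (measurability _ (RGenInftyO.measurableE R)) => _ [_ [r ->] <-].
rewrite setTI.
pose dist (q : rat * rat * rat) w : R :=
  `|a w - ratr q.1.1| + `|b w - ratr q.1.2| + `|c w - ratr q.2|.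
pose Fq (q : rat * rat * rat) := F (ratr q.1.1) (ratr q.1.2) (ratr q.2).
have -> : (fun w => F (a w) (b w) (c w)) @^-1` `]-oo, r[%classic =
   \bigcup_q ((fun w => Fq q + K * dist q w) @^-1` `]-oo, r[%classic).
  apply/seteqP; split => w /=; rewrite ?in_itv/=.
    move=> Fr; pose e := (r - F (a w) (b w) (c w)) / (6 * (K + 1)).
    have e0 : 0 < e by rewrite divr_gt0 ?subr_gt0// mulr_gt0// ltr_wpDl.
    have near (x : R) : exists q : rat, `|x - ratr q| < e.
      have [q] : exists q : rat, ratr q \in `]x - e, x + e[ by apply: rat_in_itvoo; lra.
      by rewrite in_itv /= => /andP[q1 q2]; exists q; rewrite ltr_norml; apply/andP; split; lra.
    have [[q1 h1] [q2 h2] [q3 h3]] := And3 (near (a w)) (near (b w)) (near (c w)).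
    exists ((q1, q2), q3) => //=; rewrite in_itv/= /Fq /dist /=.
    have := FK (ratr q1) (ratr q2) (ratr q3) (a w) (b w) (c w).
    rewrite (distrC (ratr q1)) (distrC (ratr q2)) (distrC (ratr q3)) => /ler_normlP[_ H].
    have H3 : K * (`|a w - ratr q1| + `|b w - ratr q2| + `|c w - ratr q3|) <= K * (3 * e).
      by rewrite ler_wpM2l//; lra.
    have eE : 6 * (K + 1) * e = r - F (a w) (b w) (c w).
      by rewrite mulrC divfK// gt_eqF// mulr_gt0// ltr_wpDl.
    have Ke : 0 <= K * e by rewrite mulr_ge0// ltW.
    lra.
  move=> [q _] /=; rewrite in_itv/= => qr.
  apply: le_lt_trans qr; rewrite /Fq /dist.
  have := FK (a w) (b w) (c w) (ratr q.1.1) (ratr q.1.2) (ratr q.2) => /ler_normlP[_ H].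
  lra.
apply: countable_bigcupT_measurable => [|q]; first exact: countableP.
rewrite -[X in measurable X]setTI.
have mf : measurable_fun setT (fun w => Fq q + K * dist q w).
  apply: measurable_funD => //; apply: measurable_funM => //.
  by do 2 (apply: measurable_funD; last (apply: measurableT_comp => //; exact: measurable_funB));
    apply: measurableT_comp => //; exact: measurable_funB.
exact: mf.
Qed.

Lemma lipschitz_sqr_abs (L u x y z : R) : 0 <= L ->
  `|u| ^+ 2 <= L * (`|x| ^+ 2 + `|y| ^+ 2 + `|z| ^+ 2) ->
  `|u| <= Num.sqrt L * (`|x| + `|y| + `|z|).
Proof.
move=> L0 H; rewrite -ler_sqr ?nnegrE ?mulr_ge0 ?sqrtr_ge0 ?addr_ge0//.
rewrite exprMn sqr_sqrtr//; apply: (le_trans H); rewrite ler_wpM2l//.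
have [x0 y0 z0] := And3 (normr_ge0 x) (normr_ge0 y) (normr_ge0 z).
have := mulr_ge0 x0 y0; have := mulr_ge0 x0 z0; have := mulr_ge0 y0 z0; nra.
Qed.

End lipschitz_measurability.

(** * Orthonormality of the regressors *)
Section regressors.
Context {R : realType} {d : measure_display} {Omega : measurableType d}.
Context {P : probability Omega R} {W B : R -> Omega -> R} {cf : coefs R}.
Context {bs : cell_basis R} {N M : nat} {Ws Bs : 'I_M -> R -> Omega -> R}.
Hypothesis H : regression_setting P W B cf bs N Ws Bs.
Local Notation h := (mesh cf N).
Local Notation inco := (increment W B cf (N := N) Ws Bs).
Local Notation qo := (path_of W B Ws Bs).
Local Notation p k w := (pvec P W cf bs N k (bpath W B w)).
Local Notation v k w := (vvec P W cf bs N k (bpath W B w)).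

Lemma vvec_l k q j : vvec P W cf bs N k q (lshift _ j) 0 = pvec P W cf bs N k q j 0.
Proof. by rewrite /vvec col_mxEu. Qed.

Lemma vvec_r k q j : vvec P W cf bs N k q (rshift _ j) 0 =
  pvec P W cf bs N k q j 0 * (dW cf N k q / Num.sqrt h).
Proof. by rewrite /vvec col_mxEd mxE mulrC. Qed.

Lemma mesh_sqrt : Num.sqrt h != 0 /\ Num.sqrt h ^+ 2 = h.
Proof.
have h0 := mesh_gt0 H.
by rewrite sqr_sqrtr 1?ltW// sqrtr_eq0 -ltNge.
Qed.

Definition basis_block k : set (option 'I_M * (bool * 'I_N)) :=
  [set e | before_after k e.2].

Lemma basis_block_dW k (kN : (k < N)%N) e : basis_block k e -> ~ [set (None, (true, Ordinal kN))] e.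
Proof. by move=> + ee; rewrite ee /basis_block /before_after /= ltnn. Qed.

Lemma block_basis k a : (k <= N)%N ->
  measurable_fun (setT : set (g_sigma_algebraType (block (Ws := Ws) (Bs := Bs) (W := W) (B := B) (cf := cf) (basis_block k))))
    (fun w => p k w a 0).
Proof.
move=> kN; apply: (block_path (S := before_after k) (o := None) (F := fun q => pvec P W cf bs N k q a 0)) => //.
exact: (measurable_pvec P W (setting_wf H) (setting_drift H) (setting_diffusion H)).
Qed.

Lemma regressors_sqint k a : (k < N)%N -> sqint P (fun w => v k w a 0).
Proof.
move=> kN; rewrite -(splitK a); case: (fintype.split a) => j /=.
  under eq_fun do rewrite vvec_l.
  exact: (original_basis_sqint H _ (ltnW kN)).
under eq_fun do rewrite vvec_r.
pose e : option 'I_M * (bool * 'I_N) := (None, (true, Ordinal kN)).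
apply: (independentM_sqint (@block_sub _ _ _ _ _ _ _ _ _ _ _ _ H (basis_block k)) (@block_sub _ _ _ _ _ _ _ _ _ _ _ _ H [set e])).
- by apply: (block_independent H) => e'; exact: basis_block_dW.
- exact: block_basis (ltnW kN).
- by apply: measurable_funM => //; apply: (block_increment (e := e)).
- exact: (original_basis_sqint H _ (ltnW kN)).
- have [si _] := increment_moments H e.
  have := sqintZ (Num.sqrt h)^-1 si.
  by under eq_fun do rewrite mulrC.
Qed.

(** The increment of W after t_k is centered with variance h and independent of
    p_k, whose components are orthonormal. *)
Lemma regressors_ortho k a b : (k < N)%N ->
  (\int[P]_w (v k w a 0 * v k w b 0) = (a == b)%:R)%R.
Proof.
move=> kN; have [s0 s2] := mesh_sqrt.
pose e : option 'I_M * (bool * 'I_N) := (None, (true, Ordinal kN)).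
have [si [m1 m2]] := increment_moments H e.
have sb1 : <<s block (W := W) (B := B) (cf := cf) (Ws := Ws) (Bs := Bs) (basis_block k) >> `<=` measurable.
  exact: (block_sub H).
have sb2 : <<s block (W := W) (B := B) (cf := cf) (Ws := Ws) (Bs := Bs) [set e] >> `<=` measurable.
  exact: (block_sub H).
have incoE w : inco e w = dW cf N k (bpath W B w) by [].
have op i j := original_basis_ortho H i j (ltnW kN).
have sp i := original_basis_sqint H i (ltnW kN).
have ind : independent2 P <<s block (W := W) (B := B) (cf := cf) (Ws := Ws) (Bs := Bs) (basis_block k) >>
   <<s block (W := W) (B := B) (cf := cf) (Ws := Ws) (Bs := Bs) [set e] >>.
  by apply: (block_independent H) => e'; exact: basis_block_dW.
have mi : measurable_fun (setT : set (g_sigma_algebraType (block (W := W) (B := B) (cf := cf) (Ws := Ws) (Bs := Bs) [set e]))) (inco e).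
  exact: block_increment.
have mpp i j : measurable_fun (setT : set (g_sigma_algebraType (block (W := W) (B := B) (cf := cf) (Ws := Ws) (Bs := Bs) (basis_block k))))
    (fun w => p k w i 0 * p k w j 0).
  by apply: measurable_funM; exact: block_basis (ltnW kN).
have cross i j : (\int[P]_w (p k w i 0 * (p k w j 0 * (dW cf N k (bpath W B w) / Num.sqrt h))) = 0)%R.
  transitivity ((Num.sqrt h)^-1 * \int[P]_w ((p k w i 0 * p k w j 0) * inco e w))%R.
    rewrite -RintegralZl//; first by apply: eq_Rintegral => w _; rewrite incoE; ring.
    apply: (independentM_integrable sb1 sb2 ind (mpp i j) mi).
      exact: sqintM_integrable.
    exact: sqint_integrable.
  rewrite (independentM_Rintegral sb1 sb2 ind (mpp i j) mi).
  - by rewrite m1 !mulr0.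
  - exact: sqintM_integrable.
  - exact: sqint_integrable.
rewrite -(splitK a) -(splitK b); case: (fintype.split a) => i; case: (fintype.split b) => j /=.
- under eq_Rintegral do rewrite !vvec_l.
  by rewrite op (inj_eq (@lshift_inj _ _)).
- under eq_Rintegral do rewrite vvec_l vvec_r.
  by rewrite cross eq_lrshift.
- under eq_Rintegral do rewrite vvec_l vvec_r mulrC.
  by rewrite cross eq_rlshift.
- rewrite (inj_eq (@rshift_inj _ _)) -(op i j).
  transitivity (h^-1 * \int[P]_w ((p k w i 0 * p k w j 0) * (inco e w ^+ 2)))%R.
    rewrite -RintegralZl//.
      apply: eq_Rintegral => w _; rewrite !vvec_r -{3}s2 incoE.
      by field.
    apply: (independentM_integrable sb1 sb2 ind (mpp i j) (measurable_funX 2 mi)).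
      exact: sqintM_integrable.
    exact: si.2.
  rewrite (independentM_Rintegral sb1 sb2 ind (mpp i j) (measurable_funX 2 mi)).
  - by rewrite m2 mulrC mulfK// gt_eqF// (mesh_gt0 H).
  - exact: sqintM_integrable.
  - exact: si.2.
Qed.

End regressors.

(** * The projected Picard scheme in coordinates *)
Section picard.
Context {R : realType} {d : measure_display} {Omega : measurableType d}.
Context {P : probability Omega R} {W B : R -> Omega -> R} {cf : coefs R}.
Context {bs : cell_basis R} {N M : nat} {Ws Bs : 'I_M -> R -> Omega -> R}.
Hypothesis H : regression_setting P W B cf bs N Ws Bs.
Variables (Lf Lg : R).
Local Notation f := (driver cf).
Local Notation g := (bdriver cf).
Hypothesis hf : forall x y z x' y' z',
   `|f x y z - f x' y' z'| ^+ 2 <= Lf * (`|x - x'| ^+ 2 + `|y - y'| ^+ 2 + `|z - z'| ^+ 2).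
Hypothesis hg : forall x y x' y',
   `|g x y - g x' y'| ^+ 2 <= Lg * (`|x - x'| ^+ 2 + `|y - y'| ^+ 2).
Local Notation h := (mesh cf N).
Local Notation p k w := (pvec P W cf bs N k (bpath W B w)).
Local Notation v k w := (vvec P W cf bs N k (bpath W B w)).
Local Notation blk U := (block (W := W) (B := B) (cf := cf) (N := N) (Ws := Ws) (Bs := Bs) U).
Local Notation X k w := (XN cf N k (bpath W B w)).
Local Notation dWk k w := (dW cf N k (bpath W B w)).
Local Notation dBk k w := (dB cf N k (bpath W B w)).

Lemma driver_const_ge0 : 0 <= Lf.
Proof.
have := hf 1 0 0 0 0 0; rewrite !subrr !subr0 normr1 normr0 expr0n expr1n !addr0 mulr1.
exact: le_trans (sqr_ge0 _).
Qed.

Lemma bdriver_const_ge0 : 0 <= Lg.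
Proof.
have := hg 1 0 0 0; rewrite !subrr !subr0 normr1 normr0 expr0n expr1n !addr0 mulr1.
exact: le_trans (sqr_ge0 _).
Qed.

Lemma measurable_driver d' (T : measurableType d') (a b c : T -> R) :
  measurable_fun setT a -> measurable_fun setT b -> measurable_fun setT c ->
  measurable_fun setT (fun w => f (a w) (b w) (c w)).
Proof.
apply: (@measurable_lipschitz3 _ _ _ f (Num.sqrt Lf)); first exact: sqrtr_ge0.
move=> *; exact: lipschitz_sqr_abs driver_const_ge0 (hf _ _ _ _ _ _).
Qed.

Lemma measurable_bdriver d' (T : measurableType d') (a b : T -> R) :
  measurable_fun setT a -> measurable_fun setT b ->
  measurable_fun setT (fun w => g (a w) (b w)).
Proof.
move=> ma mb.
apply: (@measurable_lipschitz3 _ _ _ (fun x y _ => g x y) (Num.sqrt Lg) a b b) => //.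
move=> x y z x' y' z'; apply: (lipschitz_sqr_abs bdriver_const_ge0).
apply: (le_trans (hg _ _ _ _)); rewrite ler_wpM2l ?bdriver_const_ge0//.
by rewrite lerDl sqr_ge0.
Qed.

Lemma measurable_original d' (T : measurableType d') (S : set (bool * 'I_N)) (F : path2 (R := R) -> T) :
  measurable_fun (setT : set (inc_path cf S)) F ->
  measurable_fun setT (fun w => F (bpath W B w)).
Proof.
move=> mF; have SU e : S e -> (setT : set (option 'I_M * (bool * 'I_N))) (None, e) by [].
exact: (measurable_block H (block_path (W := W) (B := B) (Ws := Ws) (Bs := Bs) (o := None) mF SU)).
Qed.

Lemma measurable_X k : (k <= N)%N -> measurable_fun setT (fun w => X k w).
Proof.
move=> kN; apply: (measurable_original (S := setT) (F := XN cf N k)).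
exact: (measurable_XN (setting_drift H) (setting_diffusion H)).
Qed.

Lemma measurable_dBk k : (k < N)%N -> measurable_fun setT (fun w => dBk k w).
Proof. by move=> kN; apply: (measurable_original (S := setT) (F := dB cf N k)); exact: (measurable_dB (jN := kN)). Qed.

Lemma measurable_dWk k : (k < N)%N -> measurable_fun setT (fun w => dWk k w).
Proof. by move=> kN; apply: (measurable_original (S := setT) (F := dW cf N k)); exact: (measurable_dW (jN := kN)). Qed.

Variables (I : nat) (Y : nat -> nat -> Omega -> R) (Z Yinf : nat -> Omega -> R) (C0 : R).
Hypothesis I0 : (0 < I)%N.
Hypothesis pic : picard_scheme P W B cf bs N I Y Z.
Hypothesis lim : picard_limit P W B cf bs N I Y Z Yinf.
Hypothesis bY : forall k, (k <= N)%N -> ('E_P[(fun w => `|Y I k w| ^+ 2)%R] <= C0%:E)%E.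
Hypothesis bYinf : forall k, (k < N)%N -> ('E_P[(fun w => `|Yinf k w| ^+ 2)%R] <= C0%:E)%E.
Hypothesis bZ : forall k, (k <= N)%N -> (h%:E * 'E_P[(fun w => `|Z k w| ^+ 2)%R] <= C0%:E)%E.

Let sp k (kN : (k <= N)%N) a := original_basis_sqint H a kN.
Let op k (kN : (k <= N)%N) a b := original_basis_ortho H a b kN.
Local Notation cof k := (coefs_of P (fun w => p k w)).

Definition al k := cof k (Y I k).
Definition ai k := cof k (Yinf k).
Definition be k := cof k (Z k).

Let cof_unique k U c : (k <= N)%N -> measurable_fun setT U -> U = (fun w => dot c (p k w)) %[ae P] ->
  sqint P U /\ cof k U = c.
Proof.
move=> kN mU Uc; split.
  apply: eq_sqint (sqint_dot (sp kN) c) mU _.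
  by apply: filterS Uc => w /= ->.
rewrite (coefs_of_ae (sp kN) mU (sqint_dot (sp kN) c).1 Uc).
exact: (coefs_of_dot (sp kN) (op kN)).
Qed.

Let proj_coef k U V : (k <= N)%N -> orth_proj P (fun w => p k w) U V ->
  [/\ sqint P U, sqint P V & V = (fun w => dot (cof k U) (p k w)) %[ae P]].
Proof.
move=> kN UV; have VU := orth_proj_coefs (sp kN) (op kN) UV.
by case: UV => /Lfun2_sqint sU /Lfun2_sqint sV _ _.
Qed.

Let c1 k := cof k (Y I k.+1).
Let c3 k := cof k (fun w => dBk k w * g (X k.+1 w) (Y I k.+1 w)).
Let Fk k V w := f (X k w) (V w) (Z k w).

(** Besides the coefficients, this records that the two projected products are
    square integrable, which is part of the existence of their projections. *)
Lemma picard_Z k : (k < N)%N -> [/\ sqint P (Z k), Z k = (fun w => dot (be k) (p k w)) %[ae P],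
  sqint P (fun w => Y I k.+1 w * dWk k w),
  sqint P (fun w => dBk k w * g (X k.+1 w) (Y I k.+1 w) * dWk k w) &
  be k = h^-1 *: (cof k (fun w => Y I k.+1 w * dWk k w) +
                  cof k (fun w => dBk k w * g (X k.+1 w) (Y I k.+1 w) * dWk k w))].
Proof.
move=> kN; have [_ _ /(_ k kN) [[mZ [A1 [A2 [/(proj_coef (ltnW kN))[s1 _ E1] /(proj_coef (ltnW kN))[s2 _ E2] E3]]]] _ _]] := pic.
set b := h^-1 *: _.
have Zb : Z k = (fun w => dot b (p k w)) %[ae P].
  apply: filterS3 E1 E2 E3 => w e1 e2 e3 _.
  by rewrite e3// e1// e2// /b scalerDr dotDl !dotZl.
have [sZ Zc] := cof_unique (ltnW kN) mZ Zb.
by split => //; rewrite /be Zc.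
Qed.

Let measurable_Fk k V : (k < N)%N -> measurable_fun setT V -> measurable_fun setT (Fk k V).
Proof.
move=> kN mV; apply: measurable_driver => //; first exact: measurable_X (ltnW kN).
by have [[]] := picard_Z kN.
Qed.

Let iterate k i : (k < N)%N -> (0 < i <= I)%N ->
  [/\ sqint P (Y I k.+1), sqint P (Fk k (Y i.-1 k)),
      sqint P (fun w => dBk k w * g (X k.+1 w) (Y I k.+1 w)), sqint P (Y i k) &
      Y i k = (fun w => dot (c1 k + h *: cof k (Fk k (Y i.-1 k)) + c3 k) (p k w)) %[ae P]].
Proof.
move=> kN iI; have [_ _ /(_ k kN) [_ _ /(_ i iI)]] := pic.
move=> [mY [A1 [A2 [A3 [/(proj_coef (ltnW kN))[s1 _ E1] /(proj_coef (ltnW kN))[s2 _ E2]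
  /(proj_coef (ltnW kN))[s3 _ E3] E4]]]]].
have Yi : Y i k = (fun w => dot (c1 k + h *: cof k (Fk k (Y i.-1 k)) + c3 k) (p k w)) %[ae P].
  have E12 : (fun w => A1 w + h * A2 w) =
      (fun w => dot (c1 k + h *: cof k (Fk k (Y i.-1 k))) (p k w)) %[ae P].
    by apply: filterS2 E1 E2 => w e1 e2 _; rewrite e1// e2// dotDl dotZl.
  apply: filterS3 E12 E3 E4 => w e12 e3 e4 _.
  by rewrite e4// e12// e3// -dotDl.
by split => //; have [] := cof_unique (ltnW kN) mY Yi.
Qed.

Lemma picard_Y k : (k <= N)%N -> sqint P (Y I k) /\ Y I k = (fun w => dot (al k) (p k w)) %[ae P].
Proof.
rewrite leq_eqVlt => /orP[/eqP ->|kN].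
  have [_ /(_ I (leqnn I)) /(proj_coef (leqnn N))[_ sY YE] _] := pic.
  by split => //; have [_ e] := cof_unique (leqnn N) sY.1 YE; rewrite /al e.
have iI : (0 < I <= I)%N by rewrite I0 leqnn.
have [_ _ _ sY YE] := iterate kN iI.
by split => //; have [_ e] := cof_unique (ltnW kN) sY.1 YE; rewrite /al e.
Qed.

(** The scheme projects f(X, Y^0, Z) with Y^0 = 0, which is therefore square
    integrable; f is Lipschitz, so this carries over to every other Y. *)
Lemma sqint_driver k V : (k < N)%N -> sqint P V -> sqint P (Fk k V).
Proof.
move=> kN sV.
have iI : (0 < 1 <= I)%N by [].
have [_ s0 _ _ _] := iterate kN iI.
have [_ _ /(_ k kN) [_ Y0 _]] := pic.
have sF0 : sqint P (Fk k (fun=> 0)).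
  apply: (eq_sqint s0); first by apply: measurable_Fk => //; exact: measurable_cst.
  by apply: filterS Y0 => w; rewrite /Fk /= => ->.
have -> : Fk k V = (fun w => Fk k (fun=> 0) w + (Fk k V w - Fk k (fun=> 0) w)).
  by apply/funext => w; rewrite addrC subrK.
apply: sqintD => //.
apply: (sqint_Lipschitz (L := Lf) _ sV).
  by apply: measurable_funB; [exact: measurable_Fk sV.1|exact: sF0.1].
move=> w; have := hf (X k w) (V w) (Z k w) (X k w) 0 (Z k w).
by rewrite !subrr subr0 normr0 expr0n add0r addr0 !real_normK ?num_real.
Qed.

Lemma picard_Yinf k : (k < N)%N ->
  [/\ sqint P (Yinf k), Yinf k = (fun w => dot (ai k) (p k w)) %[ae P] &
      ai k = c1 k + h *: cof k (Fk k (Yinf k)) + c3 k].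
Proof.
move=> kN; have [_ pr] := lim kN; have [sU sV VU] := proj_coef (ltnW kN) pr.
have [_ e] := cof_unique (ltnW kN) sV.1 VU.
split => //; first by rewrite /ai e.
have iI : (0 < 1 <= I)%N by [].
have [sY _ sg _ _] := iterate kN iI.
rewrite /ai e.
have sF := sqint_driver kN sV.
have sh := sqintZ h sF.
rewrite (coefs_ofD (sp (ltnW kN)) (sqintD sY sh) sg) (coefs_ofD (sp (ltnW kN)) sY sh).
by rewrite (coefs_ofZ (sp (ltnW kN))).
Qed.

(** A Picard iteration changes Y only through h P_k f, and projections do not
    increase norms, so each iteration gains h^2 Lf on squared distances. *)
Lemma picard_contraction_coef k : (k < N)%N ->
  dot (al k - ai k) (al k - ai k) <= (h ^+ 2 * Lf) ^+ I * dot (ai k) (ai k).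
Proof.
move=> kN; have [sYi Yia aiE] := picard_Yinf kN.
have hL : 0 <= h ^+ 2 * Lf by rewrite mulr_ge0 ?sqr_ge0 ?driver_const_ge0.
have key i : (i <= I)%N -> exists2 c, Y i k = (fun w => dot c (p k w)) %[ae P] &
     dot (c - ai k) (c - ai k) <= (h ^+ 2 * Lf) ^+ i * dot (ai k) (ai k).
  elim: i => [|i IH] iI.
    have [_ _ /(_ k kN) [_ Y0 _]] := pic.
    exists 0; last by rewrite sub0r dotNl dotNr opprK expr0 mul1r.
    by apply: filterS Y0 => w /= e _; rewrite e// dot0l.
  have [c Yc cle] := IH (ltnW iI).
  have [sY sF sg sYi1 E] := iterate kN (iI : (0 < i.+1 <= I)%N).
  exists (c1 k + h *: cof k (Fk k (Y i k)) + c3 k); first exact: E.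
  have sc := sqint_dot (sp (ltnW kN)) c.
  have sa := sqint_dot (sp (ltnW kN)) (ai k).
  have sFc := sqint_driver kN sc.
  have sFa := sqint_driver kN sa.
  have -> : cof k (Fk k (Y i k)) = cof k (Fk k (fun w => dot c (p k w))).
    apply: (coefs_of_ae (sp (ltnW kN)) sF.1 sFc.1).
    by apply: filterS Yc => w; rewrite /Fk /= => ->.
  have ai' : ai k = c1 k + h *: cof k (Fk k (fun w => dot (ai k) (p k w))) + c3 k.
    rewrite {1}aiE; congr (_ + _ *: _ + _).
    apply: (coefs_of_ae (sp (ltnW kN)) (sqint_driver kN sYi).1 sFa.1).
    by apply: filterS Yia => w; rewrite /Fk /= => ->.
  set D := fun w => Fk k (fun w => dot c (p k w)) w - Fk k (fun w => dot (ai k) (p k w)) w.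
  have sD : sqint P D by exact: sqintB.
  have -> : c1 k + h *: cof k (Fk k (fun w => dot c (p k w))) + c3 k - ai k = h *: cof k D.
    rewrite {1}ai' opprD addrACA subrr addr0 opprD addrACA subrr add0r -scalerBr.
    congr (_ *: _); apply/matrixP => a b; rewrite !mxE -RintegralB//.
    - by apply: eq_Rintegral => w _; rewrite /D mulrBl.
    - exact: sqintM_integrable sFc (sp (ltnW kN) a).
    - exact: sqintM_integrable sFa (sp (ltnW kN) a).
  rewrite dotZl dotZr mulrA -expr2 [_ ^+ i.+1]exprS -[leRHS]mulrA -[leRHS]mulrA.
  apply: ler_wpM2l; first exact: sqr_ge0.
  apply: (le_trans (bessel (sp (ltnW kN)) (op (ltnW kN)) sD)).
  have sca := sqint_dot (sp (ltnW kN)) (c - ai k).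
  apply: (@le_trans _ _ (\int[P]_w (Lf * (dot (c - ai k) (p k w) * dot (c - ai k) (p k w))))%R).
    apply: le_Rintegral => //; first exact: sD.2.
      have := sqintM_integrable (sqintZ Lf sca) sca.
      by apply: eq_integrable => // w _; rewrite /= mulrA.
    move=> w _; rewrite /D /Fk.
    have := hf (X k w) (dot c (p k w)) (Z k w) (X k w) (dot (ai k) (p k w)) (Z k w).
    by rewrite !subrr normr0 expr0n add0r addr0 !real_normK ?num_real// -dotBl [in leRHS]expr2.
  rewrite RintegralZl//; last exact: sqintM_integrable.
  rewrite (dot_dot (sp (ltnW kN)) (op (ltnW kN))).
  by rewrite ler_wpM2l ?driver_const_ge0.
have [c Yc cle] := key I (leqnn I).
have [sY _] := picard_Y (ltnW kN).
by have [_ e] := cof_unique (ltnW kN) sY.1 Yc; rewrite /al e.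
Qed.

Let second_moment_coef k U : (k <= N)%N -> sqint P U -> U = (fun w => dot (cof k U) (p k w)) %[ae P] ->
  ('E_P[(fun w => `|U w| ^+ 2)%R] = (dot (cof k U) (cof k U))%:E)%E.
Proof.
move=> kN sU Uc; rewrite unlock -(integral_dot_sqr (sp kN) (op kN)).
have sc := sqint_dot (sp kN) (cof k U).
apply: ge0_ae_eq_integral => //.
- apply/measurable_EFinP; apply: measurable_funX; apply: measurableT_comp => //; exact: sU.1.
- by apply/measurable_EFinP; apply: measurable_funX; exact: sc.1.
- by move=> w _; rewrite lee_fin sqr_ge0.
- by apply: filterS Uc => w /= e _; rewrite -e// real_normK ?num_real.
Qed.

Lemma al_bound k : (k <= N)%N -> dot (al k) (al k) <= C0.
Proof.
move=> kN; have [sY Ya] := picard_Y kN.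
by have := bY kN; rewrite (second_moment_coef kN sY Ya) lee_fin.
Qed.

Lemma ai_bound k : (k < N)%N -> dot (ai k) (ai k) <= C0.
Proof.
move=> kN; have [sY Ya _] := picard_Yinf kN.
by have := bYinf kN; rewrite (second_moment_coef (ltnW kN) sY Ya) lee_fin.
Qed.

Lemma be_bound k : (k < N)%N -> h * dot (be k) (be k) <= C0.
Proof.
move=> kN; have [sZ Za _ _ _] := picard_Z kN.
by have := bZ (ltnW kN); rewrite (second_moment_coef (ltnW kN) sZ Za) -EFinM lee_fin.
Qed.

(** The part of the regression target that does not involve the coefficients
    of the current step. *)
Definition target k (c : 'cV[R]_(pdim bs N k.+1)) (q : path2 (R := R)) : R :=
  let y := dot c (pvec P W cf bs N k.+1 q) in
  y + dB cf N k q * g (XN cf N k.+1 q) y.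

Definition driver_at k (a b : 'cV[R]_(pdim bs N k)) (q : path2 (R := R)) : R :=
  f (XN cf N k q) (dot a (pvec P W cf bs N k q)) (dot b (pvec P W cf bs N k q)).

Definition theta k (a b : 'cV[R]_(pdim bs N k)) := col_mx a (Num.sqrt h *: b).

Let target_parts k : (k < N)%N ->
  let y := fun w => dot (al k.+1) (p k.+1 w) in
  let G := fun w => dBk k w * g (X k.+1 w) (y w) in
  let F := fun w => driver_at (ai k) (be k) (bpath W B w) in
  [/\ sqint P y, sqint P G, sqint P F &
   [/\ cof k y = c1 k, cof k G = c3 k, cof k F = cof k (Fk k (Yinf k)),
     sqint P (fun w => y w * dWk k w) /\
     cof k (fun w => y w * dWk k w) = cof k (fun w => Y I k.+1 w * dWk k w) &
     sqint P (fun w => G w * dWk k w) /\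
     cof k (fun w => G w * dWk k w) =
     cof k (fun w => dBk k w * g (X k.+1 w) (Y I k.+1 w) * dWk k w)]].
Proof.
move=> kN y G F.
have [sY Ya] := picard_Y kN.
have [sYi Yia _] := picard_Yinf kN.
have [sZ Za sYW sGW _] := picard_Z kN.
have [_ _ sG _ _] := iterate kN (I0 : (0 < 1 <= I)%N).
have spk := sp (ltnW kN).
have sy : sqint P y by exact: sqint_dot (sp kN) _.
have mG : measurable_fun setT G.
  apply: measurable_funM; first exact: measurable_dBk.
  by apply: measurable_bdriver; [exact: measurable_X|exact: sy.1].
have GE : (fun w => dBk k w * g (X k.+1 w) (Y I k.+1 w)) = G %[ae P].
  by apply: filterS Ya => w /= e _; rewrite /G /y -e.
have sG' : sqint P G := eq_sqint sG mG GE.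
have sFk := sqint_driver kN sYi.
have mF : measurable_fun setT F.
  apply: measurable_driver; first exact: measurable_X (ltnW kN).
    exact: (sqint_dot spk _).1.
  exact: (sqint_dot spk _).1.
have FE : Fk k (Yinf k) = F %[ae P].
  by apply: filterS2 Yia Za => w /= e e' _; rewrite /F /driver_at /Fk -e// -e'.
have YWE : (fun w => Y I k.+1 w * dWk k w) = (fun w => y w * dWk k w) %[ae P].
  by apply: filterS Ya => w /= e _; rewrite /y -e.
have GWE : (fun w => dBk k w * g (X k.+1 w) (Y I k.+1 w) * dWk k w) =
    (fun w => G w * dWk k w) %[ae P].
  by apply: filterS Ya => w /= e _; rewrite /G /y -e.
have mW := measurable_dWk kN.
have myW := measurable_funM sy.1 mW.
have mGW := measurable_funM mG mW.
split => //; first exact: (eq_sqint sFk mF FE).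
split; [| | |split|split].
- by apply: (coefs_of_ae spk sy.1 sY.1); apply: filterS Ya => w /= e _; rewrite /y -e.
- by rewrite /c3 (coefs_of_ae spk sG.1 mG GE).
- by rewrite (coefs_of_ae spk sFk.1 mF FE).
- exact: (eq_sqint sYW myW YWE).
- by rewrite (coefs_of_ae spk sYW.1 myW YWE).
- exact: (eq_sqint sGW mGW GWE).
- by rewrite (coefs_of_ae spk sGW.1 mGW GWE).
Qed.

Definition full_target k (c : 'cV[R]_(pdim bs N k.+1)) (a b : 'cV[R]_(pdim bs N k))
  (q : path2 (R := R)) : R := target c q + h * driver_at a b q.

Lemma measurable_driver_at k a b : (k <= N)%N ->
  measurable_fun (setT : set (g_sigma_algebraType
    (blk (basis_block k))))
    (fun w => driver_at (k := k) a b (bpath W B w)).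
Proof.
move=> kN; apply: measurable_driver.
- apply: (block_path (S := before_after k) (o := None) (F := fun q => XN cf N k q)) => //.
  exact: (measurable_XN (setting_drift H) (setting_diffusion H)).
- by apply: measurable_sum => j; apply: measurable_funM => //; exact: block_basis.
- by apply: measurable_sum => j; apply: measurable_funM => //; exact: block_basis.
Qed.

Lemma sqint_full_target k : (k < N)%N ->
  sqint P (fun w => full_target (al k.+1) (ai k) (be k) (bpath W B w)).
Proof.
move=> kN; have [sy sG sF _] := target_parts kN.
exact: (sqintD (sqintD sy sG) (sqintZ h sF)).
Qed.

(** The coefficients of the exact scheme are those of the L^2 projection of the
    target on the regressors v_k: the second block is read off from the
    definition of Z because the driver, which is independent of the increment
    of W, does not contribute to it. *)
Lemma theta_identity k : (k < N)%N ->
  coefs_of P (fun w => v k w) (fun w => full_target (al k.+1) (ai k) (be k) (bpath W B w)) =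
  theta (ai k) (be k).
Proof.
move=> kN; have [sy sG sF [cy cG cF [syW cyW] [sGW cGW]]] := target_parts kN.
have [s0 s2] := mesh_sqrt H.
have spk := sp (ltnW kN).
have hn0 : h != 0 by rewrite gt_eqF// (mesh_gt0 H).
set y := fun w => dot (al k.+1) (p k.+1 w) in sy syW cy cyW *.
set G := fun w => dBk k w * g (X k.+1 w) (y w) in sG sGW cG cGW *.
set F := fun w => driver_at (ai k) (be k) (bpath W B w) in sF cF *.
have [_ _ _ _ beE] := picard_Z kN.
have [_ _ aiE] := picard_Yinf kN.
have sFT : sqint P (fun w => y w + G w + h * F w).
  exact: (sqintD (sqintD sy sG) (sqintZ h sF)).
apply/matrixP => j z; rewrite ord1 /theta {z} -[LHS]/(coefs_of P _ (fun w => y w + G w + h * F w) j 0).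
rewrite -(splitK j); case: (fintype.split j) => {}j /=.
- rewrite col_mxEu.
  transitivity (cof k (fun w => y w + G w + h * F w) j 0).
    by rewrite !mxE; apply: eq_Rintegral => w _; rewrite vvec_l.
  rewrite (coefs_ofD spk (sqintD sy sG) (sqintZ h sF)) (coefs_ofD spk sy sG).
  by rewrite (coefs_ofZ spk)// cy cG cF addrAC -aiE.
rewrite col_mxEd [in RHS]mxE.
have sb U : <<s blk U >> `<=` measurable.
  exact: (block_sub H).
pose e : option 'I_M * (bool * 'I_N) := (None, (true, Ordinal kN)).
have ind : independent2 P <<s blk (basis_block k) >>
   <<s blk [set e] >>.
  by apply: (block_independent H) => e'; exact: basis_block_dW.
have mF := measurable_driver_at (ai k) (be k) (ltnW kN).
have [si [m1 _]] := increment_moments H e.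
have mi : measurable_fun (setT : set (g_sigma_algebraType (blk [set e]))) (fun w => dWk k w).
  exact: (block_increment (e := e)).
have sFW : sqint P (fun w => F w * dWk k w).
  exact: (independentM_sqint (sb _) (sb _) ind mF mi sF si).
have FW0 : cof k (fun w => F w * dWk k w) = 0.
  apply/matrixP => i z; rewrite ord1 !mxE {z}.
  transitivity (\int[P]_w ((F w * p k w i 0) * dWk k w))%R.
    by apply: eq_Rintegral => w _; rewrite mulrAC.
  have mFp : measurable_fun (setT : set (g_sigma_algebraType
    (blk (basis_block k))))
    (fun w => F w * p k w i 0).
    by apply: measurable_funM; [exact: mF|exact: block_basis (ltnW kN)].
  rewrite (independentM_Rintegral (sb _) (sb _) ind mFp mi).
  - by have m1' : (\int[P]_w dWk k w = 0)%R := m1; rewrite m1' mulr0.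
  - exact: sqintM_integrable sF (spk i).
  - exact: sqint_integrable si.
transitivity ((Num.sqrt h)^-1 * cof k (fun w => y w * dWk k w + G w * dWk k w + h * (F w * dWk k w)) j 0).
  rewrite [cof k _ j 0]mxE -RintegralZl//.
    by rewrite mxE; apply: eq_Rintegral => w _; rewrite vvec_r; ring.
  exact: sqintM_integrable (sqintD (sqintD syW sGW) (sqintZ h sFW)) (spk j).
rewrite (coefs_ofD spk (sqintD syW sGW) (sqintZ h sFW)) (coefs_ofD spk syW sGW).
rewrite (coefs_ofZ spk)// FW0 scaler0 addr0 cyW cGW.
have -> : cof k (fun w => Y I k.+1 w * dWk k w) +
   cof k (fun w => dBk k w * g (X k.+1 w) (Y I k.+1 w) * dWk k w) = h *: be k.
  by rewrite beE scalerA divff// scale1r.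
have s1 : (Num.sqrt h)^-1 * h = Num.sqrt h by rewrite -[in LHS]s2 sqrtr_sqr ger0_norm ?sqrtr_ge0// expr2 mulKf.
by rewrite mxE mulrA s1.
Qed.

End picard.

(** * Means of nonnegative functions *)
Section nonnegative_means.
Context {R : realType} {d : measure_display} {Omega : measurableType d}.
Variable P : probability Omega R.
Local Notation E F := (\int[P]_w (F w)%:E)%E.
Implicit Types F G : Omega -> R.

Lemma mean_ge0 F : (forall w, 0 <= F w) -> (0 <= E F)%E.
Proof. by move=> F0; apply: integral_ge0 => w _; rewrite lee_fin. Qed.

Lemma mean_le F G : measurable_fun setT F -> measurable_fun setT G ->
  (forall w, 0 <= F w) -> (forall w, F w <= G w) -> (E F <= E G)%E.
Proof.
move=> mF mG F0 FG; apply: ge0_le_integral => //.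
- by move=> w _; rewrite lee_fin.
- exact/measurable_EFinP.
- exact/measurable_EFinP.
- by move=> w _; rewrite lee_fin.
Qed.

Lemma meanD F G : measurable_fun setT F -> measurable_fun setT G ->
  (forall w, 0 <= F w) -> (forall w, 0 <= G w) ->
  E (fun w => F w + G w) = (E F + E G)%E.
Proof.
move=> mF mG F0 G0; rewrite -ge0_integralD//.
- by move=> w _; rewrite lee_fin.
- exact/measurable_EFinP.
- by move=> w _; rewrite lee_fin.
- exact/measurable_EFinP.
Qed.

Lemma meanZ (c : R) F : 0 <= c -> measurable_fun setT F -> (forall w, 0 <= F w) ->
  E (fun w => c * F w) = (c%:E * E F)%E.
Proof.
move=> c0 mF F0; rewrite -ge0_integralZl//.
- exact/measurable_EFinP.
- by move=> w _; rewrite lee_fin.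
Qed.

Lemma mean_sum (J : Type) (r : seq J) (F : J -> Omega -> R) :
  (forall j, measurable_fun setT (F j)) -> (forall j w, 0 <= F j w) ->
  E (fun w => \sum_(j <- r) F j w) = (\sum_(j <- r) E (F j))%E.
Proof.
move=> mF F0; rewrite -ge0_integral_sum//.
- by apply: eq_integral => w _; rewrite sumEFin.
- by move=> j; exact/measurable_EFinP.
- by move=> j w _; rewrite lee_fin.
Qed.

Lemma mean_cst (c : R) : E (fun=> c) = c%:E.
Proof.
transitivity (c%:E * P setT)%E; first exact: (integral_cst P measurableT c%:E).
by rewrite probability_setT mule1.
Qed.

Lemma sqint_fin F : measurable_fun setT F -> E (fun w => F w ^+ 2) != +oo%E -> sqint P F.
Proof.
move=> mF Foo; split=> //; apply: integrable_ge0; first exact: measurable_funX.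
  by move=> w; exact: sqr_ge0.
by rewrite ltey.
Qed.

Lemma variance_le F (c : R) : measurable_fun setT F -> (\int[P]_w F w = c)%R ->
  (E (fun w => (F w - c) ^+ 2) <= E (fun w => F w ^+ 2))%E.
Proof.
move=> mF Fc; have [->|Foo] := eqVneq (E (fun w => F w ^+ 2)) +oo%E; first exact: leey.
have sF := sqint_fin mF Foo.
have iFc := sqintM_integrable sF (sqint_cst P c).
have sFc := sqintB sF (sqint_cst P c).
rewrite -(EFin_Rintegral sF.2) -(EFin_Rintegral sFc.2) lee_fin.
have i2 : P.-integrable setT (EFin \o (fun w => 2 * (F w * c))) := integrableZl measurableT 2 iFc.
have i3 := (sqint_cst P c).2.
have eq1 : (\int[P]_w ((F w - c) ^+ 2) = \int[P]_w (F w ^+ 2 - 2 * (F w * c) + c ^+ 2))%R.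
  by apply: eq_Rintegral => w _; ring.
rewrite eq1 RintegralD//; last exact: (integrableB measurableT sF.2 i2).
rewrite RintegralB//; last exact: sF.2.
rewrite RintegralZl// RintegralZr//; last exact: sqint_integrable.
rewrite Fc Rintegral_cst// /= probability_setT mulr1.
by have := sqr_ge0 c; lra.
Qed.

End nonnegative_means.

(** * Empirical means over the samples *)
Section empirical.
Context {R : realType} {d : measure_display} {Omega : measurableType d}.
Context {P : probability Omega R} {W B : R -> Omega -> R} {cf : coefs R}.
Context {bs : cell_basis R} {N M : nat} {Ws Bs : 'I_M -> R -> Omega -> R}.
Hypothesis H : regression_setting P W B cf bs N Ws Bs.
Local Notation qo := (path_of W B Ws Bs).
Local Notation blk U := (block (W := W) (B := B) (cf := cf) (N := N) (Ws := Ws) (Bs := Bs) U).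

Lemma measurable_path_fun d' (T : measurableType d') (S : set (bool * 'I_N)) (F : path2 (R := R) -> T) o :
  measurable_fun (setT : set (inc_path cf S)) F -> measurable_fun setT (fun w => F (qo o w)).
Proof.
move=> mF.
have SU e : S e -> (setT : set (option 'I_M * (bool * 'I_N))) (o, e) by [].
exact: (measurable_block H (block_path (W := W) (B := B) (Ws := Ws) (Bs := Bs) (o := o) mF SU)).
Qed.

Lemma mean_path (S : set (bool * 'I_N)) (F : path2 (R := R) -> R) o :
  measurable_fun (setT : set (inc_path cf S)) F -> (forall q, 0 <= F q) ->
  (\int[P]_w (F (qo o w))%:E = \int[P]_w (F (bpath W B w))%:E)%E.
Proof.
move=> mF F0.
have mF' : measurable_fun (setT : set (ev_path cf N)) (fun q => (F q)%:E).
  by apply/measurable_EFinP; exact: measurable_inc_path mF.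
have F0' q : (0 <= (F q)%:E)%E by rewrite lee_fin.
exact: (ge0_integral_path (mesh_gt0 H) (setting_W H) (setting_B H) (setting_iid H) o mF' F0').
Qed.

(** Adding the copies one at a time, [independent_second_moment] removes each
    cross term. *)
Lemma empirical_second_moment (S : set (bool * 'I_N)) (G : path2 (R := R) -> R) : (0 < M)%N ->
  measurable_fun (setT : set (inc_path cf S)) G ->
  P.-integrable setT (fun w => (G (bpath W B w))%:E) -> (\int[P]_w (G (bpath W B w)) = 0)%R ->
  (\int[P]_w (avg (fun m => G (spath Ws Bs m w)) ^+ 2)%:E <=
   M%:R^-1%:E * \int[P]_w (G (bpath W B w) ^+ 2)%:E)%E.
Proof.
move=> M0 mG iG G0.
have Mp : 0 < M%:R^-1 :> R by rewrite invr_gt0 ltr0n.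
have mG2 : measurable_fun (setT : set (inc_path cf S)) (fun q => G q ^+ 2) by exact: measurable_funX.
have [->|Goo] := eqVneq (\int[P]_w (G (bpath W B w) ^+ 2)%:E)%E +oo%E.
  by rewrite gt0_muley ?leey ?lte_fin.
have [r rE] : exists r, (\int[P]_w (G (bpath W B w) ^+ 2)%:E)%E = r%:E.
  exists (fine (\int[P]_w (G (bpath W B w) ^+ 2)%:E)%E); rewrite fineK//.
  rewrite ge0_fin_numE ?ltey//; apply: mean_ge0 => w; exact: sqr_ge0.
pose U (n : nat) := [set e : option 'I_M * (bool * 'I_N) | if e.1 is Some m then (m < n)%N else false].
pose V (n : 'I_M) := [set e : option 'I_M * (bool * 'I_N) | e.1 = Some n].
have sb X : <<s blk X >> `<=` measurable by exact: (block_sub H).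
pose S' n w := \sum_(m < M | (m < n)%N) G (qo (Some m) w).
have mS n : measurable_fun (setT : set (g_sigma_algebraType (blk (U n)))) (S' n).
  rewrite /S'; under eq_fun do rewrite big_mkcond.
  apply: measurable_sum => m; case mn: (m < n)%N; last exact: measurable_cst.
  exact: (block_path mG).
have S2 n : (n <= M)%N -> (\int[P]_w (S' n w ^+ 2)%:E = (n%:R * r)%:E)%E.
  elim: n => [_|n IH nM].
    rewrite mul0r -[RHS](mean_cst P 0); apply: eq_integral => w _.
    by rewrite /S' big_pred0// expr0n.
  pose m := Ordinal nM.
  have ind : independent2 P <<s blk (U n) >> <<s blk (V m) >>.
    apply: (block_independent H) => e + em; rewrite /U /= em /=.
    by rewrite ltnn.
  have mGm : measurable_fun (setT : set (g_sigma_algebraType (blk (V m)))) (fun w => G (qo (Some m) w)).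
    exact: (block_path mG).
  have iGm : P.-integrable setT (EFin \o (fun w => G (qo (Some m) w))).
    apply/integrableP; split; first by apply/measurable_EFinP; exact: measurable_path_fun mG.
    have /integrableP[_] := iG; rewrite /=.
    by rewrite (mean_path (F := fun q => `|G q|) (Some m) (measurableT_comp (@normr_measurable R setT) mG)).
  have G0' : (\int[P]_w (G (qo (Some m) w))%:E = 0)%E.
    have -> := integral_path (mesh_gt0 H) (setting_W H) (setting_B H) (setting_iid H)
      (Some m) (f := fun q => (G q)%:E) _ iG.
      by rewrite -(EFin_Rintegral (U := fun w => G (bpath W B w)) iG) G0.
    by apply/measurable_EFinP; exact: measurable_inc_path mG.
  have Gr : (\int[P]_w (G (qo (Some m) w) ^+ 2)%:E = r%:E)%E.
    by rewrite (mean_path (Some m) mG2) => // q; exact: sqr_ge0.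
  have m1 : measurable_fun (setT : set (g_sigma_algebraType (blk (U n)))) (fun=> 1 : R) by exact: measurable_cst.
  have := independent_second_moment (sb _) (sb _) ind (mS n)
    (V := fun=> 1) m1 mGm iGm G0' Gr.
  rewrite IH ?(ltnW nM)//.
  rewrite expr1n mean_cst mule1 -EFinD -{2}[r]mul1r -mulrDl natr1 => <-.
  apply: eq_integral => w _; congr (_ ^+ 2)%:E.
  rewrite /S' (bigD1 m)//= ?ltnSn// mul1r addrC; congr (_ + _).
  apply: eq_bigl => i; rewrite ltnS leq_eqVlt -val_eqE /=.
  by case: ltngtP => //=.
rewrite rE -(EFinM M%:R^-1).
have -> : (M%:R^-1 * r = M%:R^-1 ^+ 2 * (M%:R * r))%R.
  by field; rewrite pnatr_eq0 -lt0n.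
rewrite EFinM -(S2 M (leqnn M)) -meanZ ?sqr_ge0//.
- rewrite le_eqVlt; apply/orP; left; apply/eqP; apply: eq_integral => w _.
  rewrite /avg exprMn; congr (_ * _ ^+ 2)%:E.
  by apply: eq_bigl => m; rewrite ltn_ord.
- have mSM := measurable_block H (mS M); apply: measurable_funX; exact: mSM.
- by move=> w; exact: sqr_ge0.
Qed.
End empirical.

Lemma frobenius_mulmx {R : realType} n (A : 'M[R]_n) (x : 'cV[R]_n) :
  dot (A *m x) (A *m x) <= frobenius A ^+ 2 * dot x x.
Proof.
have F0 : 0 <= \sum_(i < n) \sum_(j < n) A i j ^+ 2.
  by apply: sumr_ge0 => i _; apply: sumr_ge0 => j _; exact: sqr_ge0.
rewrite /frobenius sqr_sqrtr// dot_sqr mulr_suml; apply: ler_sum => i _.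
have := dot_CS (row i A)^T x; rewrite [dot (row i A)^T _]dotE.
have -> : ((row i A)^T^T *m x) 0 0 = (A *m x) i 0.
  by rewrite trmxK -row_mul mxE.
rewrite dot_sqr (eq_bigr (fun j => A i j ^+ 2))// => j _.
by rewrite !mxE.
Qed.

(** * The noise of one regression *)
Section noise.
Context {R : realType} {d : measure_display} {Omega : measurableType d}.
Variable P : probability Omega R.
Context {n : nat} (v : Omega -> 'cV[R]_n) (F : Omega -> R) (th : 'cV[R]_n).
Hypothesis sv : forall a, sqint P (fun w => v w a 0).
Hypothesis sF : sqint P F.
Hypothesis thE : coefs_of P v F = th.
Local Notation noise w := ((F w - dot th (v w)) *: v w).

Let mv : mx_measurable v.
Proof. by move=> i j; rewrite (ord1 j); exact: (sv i).1. Qed.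

Lemma frobenius_measurable : measurable_fun setT (fun w => frobenius (v w *m (v w)^T - 1%:M) ^+ 2).
Proof.
have -> : (fun w => frobenius (v w *m (v w)^T - 1%:M) ^+ 2) =
  (fun w => \sum_(i < n) \sum_(j < n) (v w *m (v w)^T - 1%:M) i j ^+ 2).
  apply/funext => w; rewrite sqr_sqrtr//.
  by apply: sumr_ge0 => i _; apply: sumr_ge0 => j _; exact: sqr_ge0.
apply: measurable_sum => i; apply: measurable_sum => j; apply: measurable_funX.
apply: mx_measurableB; last exact: mx_measurable_cst.
by apply: mx_measurableM => //; exact: mx_measurable_tr.
Qed.

(** v F - v (th . v) = (v F - th) - (v v^T - 1) th.  The first term is centered, so
    its second moment is at most that of v F. *)
Lemma noise_mean :
  (\int[P]_w (dot (noise w) (noise w))%:E <=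
   2%:E * \int[P]_w (F w ^+ 2 * dot (v w) (v w))%:E +
   (2 * dot th th)%:E * \int[P]_w (frobenius (v w *m (v w)^T - 1%:M) ^+ 2)%:E)%E.
Proof.
pose D w := F w *: v w - th.
have mD : mx_measurable D.
  apply: mx_measurableB; last exact: mx_measurable_cst.
  by apply: mx_measurableZ => //; exact: sF.1.
have mFv a : measurable_fun setT (fun w => F w * v w a 0).
  by apply: measurable_funM; [exact: sF.1|exact: (sv a).1].
have mn : measurable_fun setT (fun w => dot (noise w) (noise w)).
  have mN : mx_measurable (fun w => noise w).
    apply: mx_measurableZ => //; apply: measurable_funB; first exact: sF.1.
    by apply: measurable_dot => //; exact: mx_measurable_cst.
  exact: measurable_dot.
have mf := frobenius_measurable.
apply: (@le_trans _ _ (\int[P]_w (2 * dot (D w) (D w) + 2 * dot th th * frobenius (v w *m (v w)^T - 1%:M) ^+ 2)%:E)%E).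
  apply: mean_le => //.
  - apply: measurable_funD; apply: measurable_funM => //; exact: measurable_dot.
  - by move=> w; exact: dot_ge0.
  move=> w.
  have -> : noise w = D w - (v w *m (v w)^T - 1%:M) *m th.
    rewrite /D mulmxBl mul1mx opprB addrA subrK scalerBl; congr (_ - _).
    apply/matrixP => i j; rewrite (ord1 j) -mulmxA !mxE big_ord1 mulrC; congr (_ * _).
    by rewrite dotC dotE mxE.
  rewrite (le_trans (dot_add_le _ _))// lerD2l dotNl dotNr opprK -mulrA ler_wpM2l//.
  by rewrite mulrC frobenius_mulmx.
rewrite meanD.
- apply: leeD.
    rewrite meanZ//; [|exact: measurable_dot|by move=> w; exact: dot_ge0].
    apply: lee_wpmul2l; first by rewrite lee_fin.
    have eD w : dot (D w) (D w) = \sum_a (F w * v w a 0 - th a 0) ^+ 2.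
      by rewrite dot_sqr; apply: eq_bigr => a _; rewrite !mxE.
    have eF w : F w ^+ 2 * dot (v w) (v w) = \sum_a (F w * v w a 0) ^+ 2.
      by rewrite dot_sqr mulr_sumr; apply: eq_bigr => a _; rewrite exprMn.
    under eq_integral do rewrite eD.
    under [leRHS]eq_integral do rewrite eF.
    rewrite !mean_sum; first last.
    - by move=> a w; exact: sqr_ge0.
    - by move=> a; apply: measurable_funX; apply: measurable_funB.
    - by move=> a w; exact: sqr_ge0.
    - by move=> a; exact: measurable_funX.
    apply: lee_sum => a _; apply: variance_le => //.
    by rewrite -thE mxE.
  rewrite meanZ//; first by rewrite mulr_ge0 ?dot_ge0.
  by move=> w; exact: sqr_ge0.
- by apply: measurable_funM => //; exact: measurable_dot.
- by apply: measurable_funM.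
- by move=> w; rewrite mulr_ge0 ?dot_ge0.
- by move=> w; rewrite mulr_ge0 ?sqr_ge0// mulr_ge0 ?dot_ge0.
Qed.

End noise.

(** * The error quantity *)
Section decomposition.
Context {R : realType} {d : measure_display} {Omega : measurableType d}.
Variables (P : probability Omega R) (W : R -> Omega -> R).
Variables (cf : coefs R) (bs : cell_basis R) (N : nat).
Hypothesis wf : basis_wf N bs.
Hypotheses (mb : measurable_fun setT (drift cf)) (ms : measurable_fun setT (diffusion cf)).
Hypothesis h0 : 0 < mesh cf N.
Local Notation h := (mesh cf N).
Implicit Type q : path2 (R := R).

Definition free_coord k q (e : pidx (xsize bs k) (bsize bs) N k) : R :=
  if e is inr (existT l e') then
    if l == 0 :> nat then 0 else pcoord P W cf q (inr (existT _ l e')) ^+ 2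
  else pcoord P W cf q e ^+ 2.

Definition free_part k q : R :=
  \sum_(e : pidx (xsize bs k) (bsize bs) N k) free_coord q e.

Lemma free_part_ge0 k q : 0 <= free_part k q.
Proof.
apply: sumr_ge0 => e _; case: e => [i|[l e]] /=; first exact: sqr_ge0.
by case: ifP => // _; exact: sqr_ge0.
Qed.

Let bound_part k q (e : pidx (xsize bs k) (bsize bs) N k) : R :=
  if e is inr (existT l e') then
    if l == 0 :> nat then pcoord P W cf q (inr (existT _ l e')) ^+ 2 else 0
  else 0.

(** Among the components of p_k, those of the first increment of B are the
    components of [pvec_noinc] times dB_k / sqrt h; all others are free of dB_k. *)
Lemma basis_decomposition k q : (k < N)%N ->
  dot (pvec P W cf bs N k q) (pvec P W cf bs N k q) = free_part k q +
  dot (pvec_noinc P W cf bs N k q) (pvec_noinc P W cf bs N k q) * (dB cf N k q ^+ 2 / h).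
Proof.
move=> kN; rewrite dot_sqr (reindex_onto (@enum_rank _) enum_val) /=; last first.
  by move=> i _; rewrite enum_valK.
transitivity (\sum_(e : pidx (xsize bs k) (bsize bs) N k) (free_coord q e + bound_part q e)).
  apply: eq_big => [e|e _]; first by rewrite enum_rankK eqxx.
  rewrite mxE enum_rankK; case: e => [i|[l e]] /=; first by rewrite addr0.
  by case: ifP => _; rewrite ?add0r ?addr0.
rewrite big_split /=; congr (_ + _).
rewrite big_sumType /= big1 ?add0r//.
pose G (l : 'I_(N - k)) (e : widx (xsize bs k) (bsize bs) N (k + l)) : R :=
  if l == 0 :> nat then pcoord P W cf q (inr (existT _ l e)) ^+ 2 else 0.
transitivity (\sum_(e : {l : 'I_(N - k) & widx (xsize bs k) (bsize bs) N (k + l)}) G (tag e) (tagged e)).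
  by apply: eq_bigr => -[l e].
rewrite -(sig_big_dep xpredT (fun=> xpredT) G) /=.
have lN : (0 < N - k)%N by rewrite subn_gt0.
rewrite (bigD1 (Ordinal lN))//= [X in _ + X]big1 ?addr0; last first.
  move=> l l0; apply: big1 => e _; rewrite /G.
  by move: l0; rewrite -val_eqE /= => /negbTE ->.
have key k' : k' = k -> \sum_(e : widx (xsize bs k) (bsize bs) N k')
     (wcomp P W cf q e * (dB cf N k' q / Num.sqrt h)) ^+ 2 =
   dot (pvec_noinc P W cf bs N k q) (pvec_noinc P W cf bs N k q) * (dB cf N k q ^+ 2 / h).
  move=> ->; rewrite dot_sqr mulr_suml [RHS](reindex_onto (@enum_rank _) enum_val) /=; last first.
    by move=> i _; rewrite enum_valK.
  apply: eq_big => [e|e _]; first by rewrite enum_rankK eqxx.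
  have s2 : (Num.sqrt h)^-1 ^+ 2 = h^-1 by rewrite exprVn (sqr_sqrtr (ltW h0)).
  by rewrite mxE enum_rankK exprMn [X in _ * X]exprMn s2.
by rewrite -(key _ (addn0 k)); apply: eq_bigr => e _; rewrite /G /=.
Qed.

Lemma measurable_free_part (S : set (bool * 'I_N)) k : (k < N)%N ->
  (forall j : 'I_N, (j < k)%N -> S (true, j)) ->
  (forall j : 'I_N, (k < j)%N -> S (false, j)) ->
  measurable_fun (setT : set (inc_path cf S)) (free_part k).
Proof.
move=> kN kS kS'; apply: measurable_sum => -[i|[l e]] /=.
  apply: measurable_funX.
  apply: measurableT_comp (measurable_ufun P W cf wf i (ltnW kN)) (measurable_XN mb ms (ltnW kN) _).
  by move=> j jk; exact: kS.
case l0: (l == 0 :> nat); first exact: measurable_cst.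
have lp : (k < k + l)%N by rewrite -addn1 leq_add2l lt0n l0.
apply: measurable_funX; apply: measurable_funM.
  apply: (measurable_wcomp P W wf mb ms e (ltnW kN) kS) => j lj.
  by apply: kS'; exact: ltn_trans lp lj.
apply: measurable_funM => //.
have lN : (k + l < N)%N by rewrite -ltn_subRL.
by apply: (measurable_dB (jN := lN)); apply: kS'.
Qed.

Lemma measurable_pvec_mx (S : set (bool * 'I_N)) k : (k <= N)%N -> before_after k `<=` S ->
  mx_measurable (T := inc_path cf S) (pvec P W cf bs N k).
Proof. by move=> kN kS i j; rewrite (ord1 j); exact: (measurable_pvec P W wf mb ms). Qed.

Lemma measurable_vvec_mx k : (k < N)%N ->
  mx_measurable (T := inc_path cf (setT : set (bool * 'I_N))) (vvec P W cf bs N k).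
Proof.
move=> kN; have mp : mx_measurable (T := inc_path cf (setT : set (bool * 'I_N))) (pvec P W cf bs N k).
  by apply: measurable_pvec_mx (ltnW kN) _.
apply: mx_measurable_col => //; apply: mx_measurableZ => //.
by apply: measurable_funM => //; apply: (measurable_dW (jN := kN)).
Qed.

End decomposition.

Section error_terms.
Context {R : realType} {d : measure_display} {Omega : measurableType d}.
Context {P : probability Omega R} {W B : R -> Omega -> R} {cf : coefs R}.
Context {bs : cell_basis R} {N M : nat} {Ws Bs : 'I_M -> R -> Omega -> R}.
Hypothesis H : regression_setting P W B cf bs N Ws Bs.
Variables (Lf Lg C0 : R).
Local Notation f := (driver cf).
Local Notation g := (bdriver cf).
Hypothesis hf : forall x y z x' y' z',
   `|f x y z - f x' y' z'| ^+ 2 <= Lf * (`|x - x'| ^+ 2 + `|y - y'| ^+ 2 + `|z - z'| ^+ 2).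
Hypothesis hg : forall x y x' y',
   `|g x y - g x' y'| ^+ 2 <= Lg * (`|x - x'| ^+ 2 + `|y - y'| ^+ 2).
Local Notation h := (mesh cf N).
Local Notation p k w := (pvec P W cf bs N k (bpath W B w)).
Local Notation v k w := (vvec P W cf bs N k (bpath W B w)).
Local Notation blk U := (block (W := W) (B := B) (cf := cf) (N := N) (Ws := Ws) (Bs := Bs) U).
Local Notation X k w := (XN cf N k (bpath W B w)).
Local Notation E F := (\int[P]_w (F w)%:E)%E.
Local Notation rhow k := (rhoW P W B cf bs N C0 k).

Let mp k (kN : (k <= N)%N) : mx_measurable (fun w => p k w).
Proof.
by move=> i j; rewrite (ord1 j); exact: (original_basis_sqint H _ kN).1.
Qed.

Let mv k (kN : (k < N)%N) : mx_measurable (fun w => v k w).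
Proof. by move=> i j; rewrite (ord1 j); exact: (regressors_sqint H _ kN).1. Qed.

Lemma sqint_enorm_basis k : (k <= N)%N -> sqint P (fun w => enorm (p k w)).
Proof.
move=> kN; split; first exact: measurable_enorm (mp kN).
have -> : EFin \o (fun w => enorm (p k w) ^+ 2) =
   (fun w => \sum_(a < pdim bs N k) (p k w a 0 ^+ 2)%:E)%E.
  by apply/funext => w /=; rewrite enorm_sqr dot_sqr sumEFin.
by apply: (integrable_sum measurableT) => a _; exact: (original_basis_sqint H a kN).2.
Qed.

Lemma rho_ge1 k w : 1 <= rhow k w.
Proof. by rewrite /rhoW /rho le_max lexx orbT. Qed.

Lemma rho_sqint k : (k <= N)%N -> sqint P (rhow k).
Proof.
move=> kN; have s1 := sqint_enorm_basis kN.
have s2 := sqintD (sqint_cst P 1) (sqintZ (Num.sqrt C0) s1).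
have mr : measurable_fun setT (rhow k).
  by apply: measurable_maxr => //; apply: measurable_funM => //; exact: s1.1.
apply: (sqint_Lipschitz (L := 1) mr s2) => w; rewrite mul1r.
rewrite ler_sqr ?nnegrE ?addr_ge0 ?mulr_ge0 ?sqrtr_ge0 ?(le_trans _ (rho_ge1 _ _))//.
rewrite /rhoW /rho ge_max [_ * enorm _]mulrC lerDr ler01 /= lerDl.
by rewrite mulr_ge0 ?sqrtr_ge0.
Qed.

Definition rho2 k : R := (\int[P]_w (rhow k w ^+ 2))%R.

Lemma rho2E k : (k <= N)%N -> ('E_P[(fun w => `|rhow k w| ^+ 2)%R] = (rho2 k)%:E)%E.
Proof.
move=> kN; rewrite unlock EFin_Rintegral; last exact: (rho_sqint kN).2.
by apply: eq_integral => w _; rewrite real_normK ?num_real.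
Qed.

Lemma rho2_ge1 k : (k <= N)%N -> 1 <= rho2 k.
Proof.
move=> kN; rewrite -lee_fin EFin_Rintegral; last exact: (rho_sqint kN).2.
rewrite -(mean_cst P 1); apply: mean_le => //.
  by apply: measurable_funX; exact: (rho_sqint kN).1.
by move=> w; rewrite expr_ge1 ?rho_ge1// (le_trans _ (rho_ge1 _ _)).
Qed.

Section one_step.
Context {k : nat}.
Hypothesis kN : (k < N)%N.
Let wsq w := enorm (wvec P W cf bs N k (bpath W B w)) ^+ 2.
Definition forward_growth w := 1 + X k.+1 w ^+ 2 + dot (p k.+1 w) (p k.+1 w) * rho2 k.+1.
Definition driver_growth w := 1 + X k w ^+ 2 + dot (p k w) (p k w) * rho2 k
  + h^-1 * dot (p k w) (p k w) * rho2 k.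

Let mX k' (k'N : (k' <= N)%N) : measurable_fun setT (fun w => X k' w).
Proof. exact: (measurable_X H k'N). Qed.

Let rho2_ge0 k' (k'N : (k' <= N)%N) : 0 <= rho2 k'.
Proof. exact: le_trans ler01 (rho2_ge1 k'N). Qed.

Lemma forward_growth_ge1 w : 1 <= forward_growth w.
Proof. by rewrite /forward_growth -addrA lerDl addr_ge0 ?sqr_ge0 ?mulr_ge0 ?dot_ge0 ?rho2_ge0. Qed.

(** All the expectations of rho^2 and zeta^2 are finite, so that eps becomes a
    combination of means of real functions. *)
Lemma epsE : eps P W B cf bs N C0 k =
  (E (fun w => frobenius (v k w *m (v k w)^T - 1%:M) ^+ 2) * (rho2 k + rho2 k)%:E
   + E (fun w => dot (v k w) (v k w) * dot (p k.+1 w) (p k.+1 w)) * (rho2 k.+1)%:E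
   + (h ^+ 2)%:E * E (fun w => dot (v k w) (v k w) * driver_growth w)
   + h%:E * E (fun w => (dot (v k w) (v k w) + wsq w) * forward_growth w))%E.
Proof.
rewrite /eps.
have -> : zetaW P W B cf bs N C0 k = rhow k by [].
rewrite !rho2E ?(ltnW kN)//; congr (_ + _ + _ + _)%E.
- by rewrite unlock -EFinD.
- rewrite unlock; congr (_ * _)%E; apply: eq_integral => w _; by rewrite !enorm_sqr.
- congr (_ * _)%E; apply: eq_integral => w _.
  transitivity ((enorm (v k w) ^+ 2 * (1 + `|X k w| ^+ 2 + enorm (p k w) ^+ 2 * rho2 k
    + h^-1 * enorm (p k w) ^+ 2 * rho2 k))%:E) => //.
  by rewrite !enorm_sqr /driver_growth real_normK ?num_real.
- congr (_ * _)%E; apply: eq_integral => w _.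
  transitivity (((enorm (v k w) ^+ 2 + wsq w) *
     (1 + `|X k.+1 w| ^+ 2 + enorm (p k.+1 w) ^+ 2 * rho2 k.+1))%:E) => //.
  by rewrite !enorm_sqr /forward_growth real_normK ?num_real.
Qed.

Let S := [set e : bool * 'I_N | if e.1 then (e.2 <= k)%N else (k < e.2)%N].
Let eB : option 'I_M * (bool * 'I_N) := (None, (false, Ordinal kN)).
Let U := [set e : option 'I_M * (bool * 'I_N) | S e.2].

(** The increment of B over the step is independent of its cofactors; where the
    basis itself contains it, its fourth moment, of order h^2, is used. *)
Lemma weighted_increment_mean :
  (E (fun w => dot (v k w) (v k w) * (dB cf N k (bpath W B w) ^+ 2 * forward_growth w)) <=
   (64 * h)%:E * E (fun w => (dot (v k w) (v k w) + wsq w) * forward_growth w))%E.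
Proof.
have h0 := mesh_gt0 H.
have sb V : <<s blk V >> `<=` measurable by exact: (block_sub H).
have ind : independent2 P <<s blk U >> <<s blk [set eB] >>.
  apply: (block_independent H) => e + eE; rewrite /U /S /= eE /=.
  by rewrite ltnn.
have mblk d' (T : measurableType d') (F : path2 (R := R) -> T) :
    measurable_fun (setT : set (inc_path cf S)) F ->
    measurable_fun (setT : set (g_sigma_algebraType (blk U))) (fun w => F (bpath W B w)).
  by move=> mF; exact: (block_path (W := W) (B := B) (Ws := Ws) (Bs := Bs) (U := U) (o := None) mF).
have SW (j : 'I_N) : (j < k.+1)%N -> S (true, j) by [].
have SB (j : 'I_N) : (k < j)%N -> S (false, j) by [].
have SW' (j : 'I_N) : (j < k)%N -> S (true, j) by move=> jk; exact: ltnW.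
have [wf mb ms] := And3 (setting_wf H) (setting_drift H) (setting_diffusion H).
pose G := forward_growth.
pose c w := 1 + dW cf N k (bpath W B w) ^+ 2 / h.
have c0 w : 0 <= c w by rewrite addr_ge0// divr_ge0 ?sqr_ge0// ltW.
have G0 w : 0 <= G w by exact: le_trans ler01 (forward_growth_ge1 w).
pose F w := free_part P W cf bs N k (bpath W B w).
pose n w := dot (pvec_noinc P W cf bs N k (bpath W B w)) (pvec_noinc P W cf bs N k (bpath W B w)).
pose b w := dB cf N k (bpath W B w).
have F0 w : 0 <= F w by exact: free_part_ge0.
have n0 w : 0 <= n w by exact: dot_ge0.
have [s0 s2] := mesh_sqrt H.
have sq w : (dW cf N k (bpath W B w) / Num.sqrt h) ^+ 2 = dW cf N k (bpath W B w) ^+ 2 / h.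
  by rewrite exprMn exprVn s2.
have vE w : dot (v k w) (v k w) = c w * (F w + n w * (b w ^+ 2 / h)).
  rewrite -(basis_decomposition P W bs h0 (bpath W B w) kN) /vvec dot_col_mx dotZl dotZr mulrA -expr2 sq.
  by rewrite /c mulrDl mul1r.
have wE w : wsq w = c w * n w.
  by rewrite /wsq enorm_sqr /wvec dot_col_mx dotZl dotZr mulrA -expr2 sq /c mulrDl mul1r.
have mc : measurable_fun (setT : set (inc_path cf S)) (fun q : path2 (R := R) => 1 + dW cf N k q ^+ 2 / h).
  apply: measurable_funD => //; apply: measurable_funM => //; apply: measurable_funX.
  by apply: (measurable_dW (jN := kN)); exact: SW.
have mcU : measurable_fun (setT : set (g_sigma_algebraType (blk U))) c by exact: (mblk _ _ _ mc).
have mG : measurable_fun (setT : set (g_sigma_algebraType (blk U))) G.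
  have mp' : mx_measurable (T := inc_path cf S) (pvec P W cf bs N k.+1).
    by apply: (measurable_pvec_mx P W wf mb ms kN) => -[[] j].
  have mX' : measurable_fun (setT : set (inc_path cf S)) (XN cf N k.+1) by exact: measurable_XN.
  apply: (mblk _ _ (fun q => 1 + XN cf N k.+1 q ^+ 2 +
    dot (pvec P W cf bs N k.+1 q) (pvec P W cf bs N k.+1 q) * rho2 k.+1)).
  apply: measurable_funD; first by apply: measurable_funD => //; exact: measurable_funX.
  by apply: measurable_funM => //; exact: measurable_dot.
have mF : measurable_fun (setT : set (g_sigma_algebraType (blk U))) F.
  by apply: mblk; exact: measurable_free_part.
have mn : measurable_fun (setT : set (g_sigma_algebraType (blk U))) n.
  apply: (mblk _ _ (fun q => dot (pvec_noinc P W cf bs N k q) (pvec_noinc P W cf bs N k q))).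
  have mn : mx_measurable (T := inc_path cf S) (pvec_noinc P W cf bs N k).
    by move=> i j; rewrite (ord1 j); apply: measurable_pvec_noinc => //; exact: ltnW.
  exact: measurable_dot.
have mB : measurable_fun (setT : set (g_sigma_algebraType (blk [set eB]))) b.
  exact: (block_increment (e := eB)).
have toO V (K : Omega -> R) : measurable_fun (setT : set (g_sigma_algebraType (blk V))) K ->
    measurable_fun setT K by move=> mK; have mK' := measurable_block H mK.
have [sB [_ mB2]] := increment_moments H eB.
have E2 : E (fun w => b w ^+ 2) = h%:E by rewrite -mB2 EFin_Rintegral//; exact: sB.2.
have E4 : (E (fun w => b w ^+ 4) <= (64 * h ^+ 2)%:E)%E.
  exact: (increment_fourth_moment h0 (setting_W H) (setting_B H) (setting_WB H) (setting_iid H) eB).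
pose A1 w := c w * F w * G w.
pose A2 w := c w * n w * G w.
have mA1 : measurable_fun (setT : set (g_sigma_algebraType (blk U))) A1.
  by apply: measurable_funM => //; apply: measurable_funM.
have mA2 : measurable_fun (setT : set (g_sigma_algebraType (blk U))) A2.
  by apply: measurable_funM => //; apply: measurable_funM.
have A10 w : 0 <= A1 w by rewrite !mulr_ge0.
have A20 w : 0 <= A2 w by rewrite !mulr_ge0.
have b20 w : 0 <= b w ^+ 2 by exact: sqr_ge0.
have b40 w : 0 <= b w ^+ 4 by rewrite (exprM _ 2 2) sqr_ge0.
have mA1b : measurable_fun setT (fun w => A1 w * b w ^+ 2).
  by apply: measurable_funM; [exact: toO mA1|apply: measurable_funX; exact: toO mB].
have mA2b : measurable_fun setT (fun w => A2 w * b w ^+ 4).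
  by apply: measurable_funM; [exact: toO mA2|apply: measurable_funX; exact: toO mB].
have h1 : 0 <= h^-1 by rewrite invr_ge0 ltW.
have -> : E (fun w => dot (v k w) (v k w) * (dB cf N k (bpath W B w) ^+ 2 * forward_growth w)) =
    E (fun w => A1 w * b w ^+ 2 + h^-1 * (A2 w * b w ^+ 4)).
  apply: eq_integral => w _; rewrite vE -/(b w) -/(G w) /A1 /A2; congr EFin; ring.
rewrite meanD//; first last.
- by move=> w; rewrite mulr_ge0// mulr_ge0.
- by move=> w; rewrite mulr_ge0.
- by apply: measurable_funM.
rewrite meanZ//; last by move=> w; rewrite mulr_ge0.
rewrite (independent_ge0_integralM (sb _) (sb _) ind mA1 (measurable_funX 2 mB))//.
rewrite (independent_ge0_integralM (sb _) (sb _) ind mA2 (measurable_funX 4 mB))// E2.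
have EA1 : (E A1 <= E (fun w => dot (v k w) (v k w) * G w))%E.
  apply: mean_le => //; first exact: toO mA1.
    by apply: measurable_funM; [apply: measurable_dot; exact: mv|exact: toO mG].
  move=> w; rewrite vE /A1 ler_wpM2r// ler_wpM2l// lerDl mulr_ge0// divr_ge0//.
  exact: ltW.
have -> : E (fun w => (dot (v k w) (v k w) + wsq w) * forward_growth w) =
   (E (fun w => dot (v k w) (v k w) * G w) + E A2)%E.
  rewrite -meanD//.
  - by apply: eq_integral => w _; rewrite wE -mulrDl.
  - by apply: measurable_funM; [apply: measurable_dot; exact: mv|exact: toO mG].
  - exact: toO mA2.
  - by move=> w; rewrite mulr_ge0// dot_ge0.
have vG0 w : 0 <= dot (v k w) (v k w) * G w by rewrite mulr_ge0 ?dot_ge0.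
rewrite [in leRHS](ge0_muleDr _ (mean_ge0 P vG0) (mean_ge0 P A20)).
apply: leeD.
  rewrite muleC; apply: lee_pmul => //; rewrite ?lee_fin ?(ltW h0) ?mean_ge0//.
  by rewrite ler_peMl// ?(ltW h0)// ler1n.
apply: (@le_trans _ _ (h^-1%:E * (E A2 * (64 * h ^+ 2)%:E))%E).
  by rewrite lee_wpmul2l ?lee_fin// lee_wpmul2l// mean_ge0.
rewrite [(E A2 * _)%E]muleC muleA -EFinM.
have -> : h^-1 * (64 * h ^+ 2) = 64 * h by field; rewrite gt_eqF.
by [].
Qed.

End one_step.
End error_terms.

(** * The statistical error of the scheme *)
Lemma sqr_add3 {R : realDomainType} (x y z s t u : R) :
  x ^+ 2 <= s -> y ^+ 2 <= t -> z ^+ 2 <= u -> (x + y + z) ^+ 2 <= 3 * (s + t + u).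
Proof.
have := sqr_ge0 (x - y); have := sqr_ge0 (x - z); have := sqr_ge0 (y - z); nra.
Qed.

Lemma error_terms_le {R : realType} (t1 t2 t3 t4 : \bar R) (c kg kf h r r' : R) :
  (0 <= t1)%E -> (0 <= t2)%E -> (0 <= t3)%E -> (0 <= t4)%E ->
  0 <= c -> 0 <= kg -> 0 <= kf -> 0 <= h -> 1 <= r -> 1 <= r' ->
  (2%:E * ((3 * c)%:E * t2 + (3 * kg)%:E * ((64 * h)%:E * t4) + (3 * h ^+ 2 * kf)%:E * t3)
     + (4 * c)%:E * t1 <=
   (10 * c + 384 * kg + 6 * kf)%:E *
   (t1 * (r + r)%:E + t2 * r'%:E + (h ^+ 2)%:E * t3 + h%:E * t4))%E.
Proof.
move=> t10 t20 t30 t40 c0 kg0 kf0 h0 r1 r1'.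
have h20 : 0 <= h ^+ 2 by exact: sqr_ge0.
have r0 : 0 <= r + r by lra.
have r0' : 0 <= r' by lra.
set K := 10 * c + _ + _; have K0 : 0 <= K by rewrite /K; lra.
have K1 : 4 * c <= K * (r + r).
  apply: (@le_trans _ _ (K * 1)); first by rewrite /K; lra.
  by rewrite ler_wpM2l//; lra.
have K2 : 6 * c <= K * r'.
  apply: (@le_trans _ _ (K * 1)); first by rewrite /K; lra.
  by rewrite ler_wpM2l.
have K3 : 6 * kf * h ^+ 2 <= K * h ^+ 2 by rewrite ler_wpM2r// /K; lra.
have K4 : 384 * kg * h <= K * h by rewrite ler_wpM2r// /K; lra.
have p1 : (0 <= t1 * (r + r)%:E)%E by rewrite mule_ge0.
have p2 : (0 <= t2 * r'%:E)%E by rewrite mule_ge0.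
have p3 : (0 <= (h ^+ 2)%:E * t3)%E by rewrite mule_ge0.
have p4 : (0 <= h%:E * t4)%E by rewrite mule_ge0.
rewrite (ge0_muleDr _ (adde_ge0 (adde_ge0 p1 p2) p3) p4).
rewrite (ge0_muleDr _ (adde_ge0 p1 p2) p3) (ge0_muleDr _ p1 p2).
have q2 : (0 <= (3 * c)%:E * t2)%E by rewrite mule_ge0// lee_fin mulr_ge0.
have q3 : (0 <= (3 * h ^+ 2 * kf)%:E * t3)%E by rewrite mule_ge0// lee_fin !mulr_ge0.
have q4 : (0 <= (3 * kg)%:E * ((64 * h)%:E * t4))%E.
  by rewrite !mule_ge0// lee_fin mulr_ge0.
rewrite (ge0_muleDr _ (adde_ge0 q2 q4) q3) (ge0_muleDr _ q2 q4).
rewrite addeC -!addeA; apply: leeD.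
  by rewrite [leRHS]muleCA -EFinM [leRHS]muleC lee_wpmul2r.
apply: leeD.
  rewrite [leLHS]muleA -[in leLHS]EFinM [leRHS]muleCA -[in leRHS]EFinM [leRHS]muleC lee_wpmul2r// lee_fin.
  by apply: le_trans K2; lra.
rewrite addeC; apply: leeD.
  rewrite !muleA -!EFinM lee_wpmul2r// lee_fin.
  by apply: le_trans K3; lra.
rewrite !muleA -!EFinM lee_wpmul2r// lee_fin.
by apply: le_trans K4; lra.
Qed.

Section statistical_error.
Context {R : realType} {d : measure_display} {Omega : measurableType d}.
Context {P : probability Omega R} {W B : R -> Omega -> R} {cf : coefs R}.
Context {bs : cell_basis R} {N M : nat} {Ws Bs : 'I_M -> R -> Omega -> R}.
Hypothesis H : regression_setting P W B cf bs N Ws Bs.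
Variables (Lf Lg C0 : R).
Local Notation f := (driver cf).
Local Notation g := (bdriver cf).
Hypothesis hf : forall x y z x' y' z',
   `|f x y z - f x' y' z'| ^+ 2 <= Lf * (`|x - x'| ^+ 2 + `|y - y'| ^+ 2 + `|z - z'| ^+ 2).
Hypothesis hg : forall x y x' y',
   `|g x y - g x' y'| ^+ 2 <= Lg * (`|x - x'| ^+ 2 + `|y - y'| ^+ 2).
Local Notation h := (mesh cf N).
Local Notation p k w := (pvec P W cf bs N k (bpath W B w)).
Local Notation v k w := (vvec P W cf bs N k (bpath W B w)).
Local Notation X k w := (XN cf N k (bpath W B w)).
Local Notation E F := (\int[P]_w (F w)%:E)%E.

Definition driver_growth_const : R := 2 * f 0 0 0 ^+ 2 + 2 * Lf * (1 + C0).
Definition bdriver_growth_const : R := 2 * g 0 0 ^+ 2 + 2 * Lg * (1 + C0).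
Definition error_const : R := 10 * C0 + 384 * bdriver_growth_const + 6 * driver_growth_const.

Context {k : nat}.
Hypothesis kN : (k < N)%N.
Variables (c : 'cV[R]_(pdim bs N k.+1)) (a b : 'cV[R]_(pdim bs N k)).
Hypotheses (c_le : dot c c <= C0) (a_le : dot a a <= C0) (b_le : h * dot b b <= C0).
Local Notation FT := (full_target (P := P) (W := W) (cf := cf) (bs := bs) (N := N) c a b).
Local Notation DT := (driver_at (P := P) (W := W) (cf := cf) (bs := bs) (N := N) a b).
Local Notation FG := (forward_growth (P := P) (W := W) (B := B) (cf := cf) (bs := bs) (N := N) C0 (k := k)).
Local Notation DG := (driver_growth (P := P) (W := W) (B := B) (cf := cf) (bs := bs) (N := N) C0 (k := k)).
Hypothesis sFT : sqint P (fun w => FT (bpath W B w)).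
Hypothesis thE : coefs_of P (fun w => v k w) (fun w => FT (bpath W B w)) = theta (cf := cf) a b.

Definition residual (q : path2 (R := R)) : R := FT q - dot (theta (cf := cf) a b) (vvec P W cf bs N k q).

Let h0 := mesh_gt0 H.
Let Lf0 : 0 <= Lf := driver_const_ge0 hf.
Let Lg0 : 0 <= Lg := bdriver_const_ge0 hg.
Let C00 : 0 <= C0. Proof. exact: le_trans (dot_ge0 c) c_le. Qed.

Lemma bdriver_growth w :
  g (X k.+1 w) (dot c (p k.+1 w)) ^+ 2 <= bdriver_growth_const * FG w.
Proof.
have r1 := rho2_ge1 H C0 kN; have := Lg0; have := C00.
rewrite /bdriver_growth_const /forward_growth.
set r := rho2 _ _ in r1 *; set pp := dot (p k.+1 w) _.
have pp0 : 0 <= pp by exact: dot_ge0.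
have y2 : dot c (p k.+1 w) ^+ 2 <= C0 * pp.
  by rewrite (le_trans (dot_CS _ _))// ler_wpM2r.
have := hg (X k.+1 w) (dot c (p k.+1 w)) 0 0; rewrite !subr0 !real_normK ?num_real//.
move: y2; set x := X k.+1 w; set y := dot c _; set u := g x y; set u0 := g 0 0.
move=> y2 u2 C0p Lp.
have us : u ^+ 2 <= 2 * u0 ^+ 2 + 2 * (u - u0) ^+ 2 by have := sqr_ge0 (u - 2 * u0); nra.
have e1 : (u - u0) ^+ 2 <= Lg * (x ^+ 2 + C0 * pp).
  by rewrite (le_trans u2)// ler_wpM2l// lerD2l.
have G1 : 1 <= 1 + x ^+ 2 + pp * r by rewrite -addrA lerDl addr_ge0 ?sqr_ge0// mulr_ge0// (le_trans ler01).
have e2 : x ^+ 2 + C0 * pp <= (1 + C0) * (1 + x ^+ 2 + pp * r).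
  have ppr : pp <= pp * r by rewrite ler_peMr.
  have : C0 * pp <= C0 * (pp * r) by rewrite ler_wpM2l.
  have := mulr_ge0 C0p (sqr_ge0 x); lra.
have e3 : 2 * u0 ^+ 2 <= 2 * u0 ^+ 2 * (1 + x ^+ 2 + pp * r) by rewrite ler_peMr// mulr_ge0// sqr_ge0.
have e4 : Lg * (x ^+ 2 + C0 * pp) <= Lg * ((1 + C0) * (1 + x ^+ 2 + pp * r)) by rewrite ler_wpM2l.
by move: e1 e3 e4 us; set G := 1 + x ^+ 2 + pp * r; lra.
Qed.

Lemma driver_growth_le w :
  DT (bpath W B w) ^+ 2 <= driver_growth_const * DG w.
Proof.
have r1 := rho2_ge1 H C0 (ltnW kN); have := Lf0; have := C00.
rewrite /driver_growth_const /driver_growth /driver_at.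
set r := rho2 _ _ in r1 *; set pp := dot (p k w) _.
have pp0 : 0 <= pp by exact: dot_ge0.
have y2 : dot a (p k w) ^+ 2 <= C0 * pp.
  by rewrite (le_trans (dot_CS _ _))// ler_wpM2r.
have z2 : dot b (p k w) ^+ 2 <= C0 * (h^-1 * pp).
  rewrite (le_trans (dot_CS _ _))// mulrA ler_wpM2r//.
  by rewrite ler_pdivlMr// mulrC.
have := hf (X k w) (dot a (p k w)) (dot b (p k w)) 0 0 0; rewrite !subr0 !real_normK ?num_real//.
move: y2 z2; set x := X k w; set y := dot a _; set z := dot b _; set u := f x y z; set u0 := f 0 0 0.
move=> y2 z2 u2 C0p Lp.
have us : u ^+ 2 <= 2 * u0 ^+ 2 + 2 * (u - u0) ^+ 2 by have := sqr_ge0 (u - 2 * u0); nra.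
set G := 1 + _ + _ + _.
have hp : 0 <= h^-1 * pp by rewrite mulr_ge0// invr_ge0 ltW.
have ppr : pp <= pp * r by rewrite ler_peMr.
have hpr : h^-1 * pp <= h^-1 * pp * r by rewrite ler_peMr.
have x0 := sqr_ge0 x.
have G1 : 1 <= G by rewrite /G; lra.
have e1 : x ^+ 2 + y ^+ 2 + z ^+ 2 <= (1 + C0) * G.
  have : C0 * pp <= C0 * (pp * r) by rewrite ler_wpM2l.
  have : C0 * (h^-1 * pp) <= C0 * (h^-1 * pp * r) by rewrite ler_wpM2l.
  have := mulr_ge0 C0p x0; rewrite /G; lra.
have e3 : 2 * u0 ^+ 2 <= 2 * u0 ^+ 2 * G by rewrite ler_peMr// mulr_ge0// sqr_ge0.
have e4 : Lf * (x ^+ 2 + y ^+ 2 + z ^+ 2) <= Lf * ((1 + C0) * G) by rewrite ler_wpM2l.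
by move: u2 e3 e4 us; lra.
Qed.

(** Each of the four terms of eps pays for one part of the target: theta itself,
    Y_{k+1}, the driver, and the term in dB_k. *)
Lemma noise_le_eps :
  (E (fun w => dot (residual (bpath W B w) *: v k w) (residual (bpath W B w) *: v k w)) <=
   error_const%:E * eps P W B cf bs N C0 k)%E.
Proof.
have sv i := regressors_sqint H i kN.
apply: (le_trans (noise_mean sv sFT thE)).
have mv : mx_measurable (fun w => v k w) by move=> i j; rewrite (ord1 j); exact: (sv i).1.
have mp : mx_measurable (fun w => p k.+1 w).
  by move=> i j; rewrite (ord1 j); exact: (original_basis_sqint H i kN).1.
have mp0 : mx_measurable (fun w => p k w).
  by move=> i j; rewrite (ord1 j); exact: (original_basis_sqint H i (ltnW kN)).1.
have mvv : measurable_fun setT (fun w => dot (v k w) (v k w)) by exact: measurable_dot.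
have mB := measurable_dBk H kN.
have mX1 := measurable_X H kN.
have mX0 := measurable_X H (ltnW kN).
rewrite (epsE H C0 kN).
set t1 := E (fun w => frobenius _ ^+ 2).
set t2 := E (fun w => dot _ _ * dot _ _).
set t3 := E (fun w => dot _ _ * driver_growth _ _).
set t4 := E (fun w => (_ + _) * forward_growth _ _).
have C0p : 0 <= C0 := C00.
have Kg0 : 0 <= bdriver_growth_const.
  have Lp : 0 <= Lg := Lg0.
  have := mulr_ge0 Lp C0p; have := sqr_ge0 (g 0 0); rewrite /bdriver_growth_const; lra.
have Kf0 : 0 <= driver_growth_const.
  have Lp : 0 <= Lf := Lf0.
  have := mulr_ge0 Lp C0p; have := sqr_ge0 (f 0 0 0); rewrite /driver_growth_const; lra.
have G0 w : 0 <= FG w.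
  exact: le_trans ler01 (forward_growth_ge1 H C0 kN w).
have r1 := rho2_ge1 H C0 kN; have r0 := rho2_ge1 H C0 (ltnW kN).
have D0 w : 0 <= DG w.
  have r0' := le_trans ler01 r0.
  by rewrite !addr_ge0 ?sqr_ge0// mulr_ge0// ?mulr_ge0 ?dot_ge0// ?invr_ge0 ?(ltW h0).
have mG : measurable_fun setT (FG).
  apply: measurable_funD; first by apply: measurable_funD => //; exact: measurable_funX.
  by apply: measurable_funM => //; exact: measurable_dot.
have mD : measurable_fun setT (DG).
  apply: measurable_funD.
    apply: measurable_funD; first by apply: measurable_funD => //; exact: measurable_funX.
    by apply: measurable_funM => //; exact: measurable_dot.
  by apply: measurable_funM => //; apply: measurable_funM => //; exact: measurable_dot.
have w0 w : 0 <= dot (v k w) (v k w) by exact: dot_ge0.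
pose q1 w := dot (v k w) (v k w) * dot (p k.+1 w) (p k.+1 w).
pose q2 w := dot (v k w) (v k w) * (dB cf N k (bpath W B w) ^+ 2 * FG w).
pose q3 w := dot (v k w) (v k w) * DG w.
have q10 w : 0 <= q1 w by rewrite mulr_ge0 ?dot_ge0.
have q20 w : 0 <= q2 w by rewrite mulr_ge0 ?dot_ge0// mulr_ge0// sqr_ge0.
have q30 w : 0 <= q3 w by rewrite mulr_ge0 ?dot_ge0.
have mq1 : measurable_fun setT q1 by apply: measurable_funM => //; exact: measurable_dot.
have mq2 : measurable_fun setT q2.
  by apply: measurable_funM => //; apply: measurable_funM => //; exact: measurable_funX.
have mq3 : measurable_fun setT q3 by apply: measurable_funM.
have hK3 : 0 <= 3 * h ^+ 2 * driver_growth_const.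
  by apply: mulr_ge0 => //; apply: mulr_ge0 => //; exact: sqr_ge0.
have main : (E (fun w => FT (bpath W B w) ^+ 2 * dot (v k w) (v k w)) <=
  (3 * C0)%:E * t2 + (3 * bdriver_growth_const)%:E * E q2 + (3 * h ^+ 2 * driver_growth_const)%:E * t3)%E.
  apply: (@le_trans _ _ (E (fun w => 3 * C0 * q1 w + 3 * bdriver_growth_const * q2 w
       + 3 * h ^+ 2 * driver_growth_const * q3 w))).
    apply: mean_le.
    - by apply: measurable_funM => //; apply: measurable_funX; exact: sFT.1.
    - apply: measurable_funD; last exact: measurable_funM.
      by apply: measurable_funD; exact: measurable_funM.
    - by move=> w; rewrite mulr_ge0 ?sqr_ge0.
    move=> w; rewrite mulrC /full_target /target.
    set y := dot c _; set u := g _ y; set F := DT _; set B' := dB _ _ _ _.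
    have e1 : y ^+ 2 <= C0 * dot (p k.+1 w) (p k.+1 w).
      by rewrite (le_trans (dot_CS _ _))// ler_wpM2r ?dot_ge0.
    have e2 : (B' * u) ^+ 2 <= bdriver_growth_const * (B' ^+ 2 * FG w).
      by rewrite exprMn [leRHS]mulrCA ler_wpM2l ?sqr_ge0// bdriver_growth.
    have e3 : (h * F) ^+ 2 <= h ^+ 2 * driver_growth_const * DG w.
      by rewrite exprMn -[leRHS]mulrA ler_wpM2l ?sqr_ge0// driver_growth_le.
    have e4 : (y + B' * u + h * F) ^+ 2 <= 3 * (C0 * dot (p k.+1 w) (p k.+1 w) +
       bdriver_growth_const * (B' ^+ 2 * FG w) + h ^+ 2 * driver_growth_const * DG w).
      exact: sqr_add3 e1 e2 e3.
    apply: (le_trans (ler_wpM2l (w0 w) e4)).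
    rewrite /q1 /q2 /q3 -/B'; clear.
    move: (dot (v k w) (v k w)) (dot (p k.+1 w) (p k.+1 w)) (FG w) (DG w) bdriver_growth_const
      driver_growth_const B' => V Q G D kg kf B'.
    by rewrite le_eqVlt; apply/orP; left; apply/eqP; ring.
  rewrite meanD; first last.
  - by move=> w; rewrite mulr_ge0.
  - by move=> w; rewrite addr_ge0// mulr_ge0// mulr_ge0.
  - exact: measurable_funM.
  - by apply: measurable_funD; exact: measurable_funM.
  rewrite meanD; first last.
  - by move=> w; rewrite mulr_ge0// mulr_ge0.
  - by move=> w; rewrite mulr_ge0// mulr_ge0.
  - exact: measurable_funM.
  - exact: measurable_funM.
  by rewrite (meanZ P (mulr_ge0 _ C0p) mq1)// (meanZ P (mulr_ge0 _ Kg0) mq2)// (meanZ P hK3 mq3).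
have wsq0 w : 0 <= enorm (wvec P W cf bs N k (bpath W B w)) ^+ 2 by exact: sqr_ge0.
have t10 : (0 <= t1)%E by apply: mean_ge0 => w; exact: sqr_ge0.
have t20 : (0 <= t2)%E by exact: mean_ge0.
have t30 : (0 <= t3)%E by exact: mean_ge0.
have t40 : (0 <= t4)%E by apply: mean_ge0 => w; rewrite mulr_ge0// addr_ge0.
have th2 : 2 * dot (theta (cf := cf) a b) (theta (cf := cf) a b) <= 4 * C0.
  rewrite /theta dot_col_mx dotZl dotZr mulrA -expr2 (mesh_sqrt H).2.
  by move: a_le b_le; lra.
apply: (@le_trans _ _ (2%:E * ((3 * C0)%:E * t2 + (3 * bdriver_growth_const)%:E * ((64 * h)%:E * t4) + (3 * h ^+ 2 * driver_growth_const)%:E * t3) + (4 * C0)%:E * t1)%E).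
  apply: leeD; last by rewrite lee_wpmul2r// lee_fin.
  rewrite lee_wpmul2l ?lee_fin//; apply: (le_trans main).
  rewrite leeD2r// leeD2l// lee_wpmul2l ?lee_fin ?mulr_ge0//.
  exact: (weighted_increment_mean H C0 kN).
have K0 : 0 <= error_const by rewrite /error_const; lra.
have := error_terms_le t10 t20 t30 t40 C0p Kg0 Kf0 (ltW h0) r0 r1.
rewrite -/error_const.
by apply.
Qed.

Local Notation allpath := (inc_path cf (setT : set (bool * 'I_N))).

Lemma measurable_vvec_all : mx_measurable (T := allpath) (vvec P W cf bs N k).
Proof. exact: (measurable_vvec_mx P W (setting_wf H) (setting_drift H) (setting_diffusion H) kN). Qed.

Lemma measurable_residual : measurable_fun (setT : set allpath) residual.
Proof.
have mX k' : (k' <= N)%N -> measurable_fun (setT : set allpath) (XN cf N k').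
  by move=> k'N; exact: (measurable_XN (setting_drift H) (setting_diffusion H)).
have mp k' : (k' <= N)%N -> mx_measurable (T := allpath) (pvec P W cf bs N k').
  by move=> k'N; exact: (measurable_pvec_mx P W (setting_wf H) (setting_drift H) (setting_diffusion H) k'N).
have md k' (e : 'cV[R]_(pdim bs N k')) : (k' <= N)%N ->
    measurable_fun (setT : set allpath) (fun q => dot e (pvec P W cf bs N k' q)).
  by move=> k'N; apply: measurable_dot; [exact: mx_measurable_cst|exact: mp].
apply: measurable_funB; last first.
  by apply: measurable_dot; [exact: mx_measurable_cst|exact: measurable_vvec_all].
apply: measurable_funD.
  apply: measurable_funD; first exact: md.
  apply: measurable_funM; first by apply: (measurable_dB (jN := kN)).
  by apply: (measurable_bdriver hg); [exact: mX|exact: md].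
apply: measurable_funM => //.
by apply: (measurable_driver hf); [exact: mX (ltnW kN)|exact: md (ltnW kN)|exact: md (ltnW kN)].
Qed.

Definition defect w : 'cV[R]_(pdim bs N k + pdim bs N k) :=
  moment (fun m => vvec P W cf bs N k (spath Ws Bs m w)) (fun m => residual (spath Ws Bs m w)).

(** By [theta_identity] the summands of the defect are centered. *)
Lemma defect_mean : (0 < M)%N ->
  (E (fun w => dot (defect w) (defect w)) <= (error_const / M%:R)%:E * eps P W B cf bs N C0 k)%E.
Proof.
move=> M0.
pose noise i (q : path2 (R := R)) := residual q * vvec P W cf bs N k q i 0.
have mnoise i : measurable_fun (setT : set allpath) (noise i).
  by apply: measurable_funM; [exact: measurable_residual|exact: measurable_vvec_all].
have mres := measurable_residual.
have sv i := regressors_sqint H i kN.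
have ov i j := regressors_ortho H i j kN.
have sres : sqint P (fun w => residual (bpath W B w)).
  exact: (sqintB sFT (sqint_dot sv (theta (cf := cf) a b))).
have inoise i : P.-integrable setT (fun w => (noise i (bpath W B w))%:E).
  exact: sqintM_integrable sres (sv i).
have noise0 i : (\int[P]_w noise i (bpath W B w) = 0)%R.
  transitivity ((coefs_of P (fun w => v k w) (fun w => FT (bpath W B w)) -
     coefs_of P (fun w => v k w) (fun w => dot (theta (cf := cf) a b) (v k w))) i 0).
    rewrite !mxE -RintegralB//; first by apply: eq_Rintegral => w _; rewrite -mulrBl.
      exact: sqintM_integrable sFT (sv i).
    exact: sqintM_integrable (sqint_dot sv _) (sv i).
  by rewrite thE (coefs_of_dot sv ov) subrr mxE.
have dE w : dot (defect w) (defect w) = \sum_i (avg (fun m => noise i (spath Ws Bs m w))) ^+ 2.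
  rewrite dot_sqr; apply: eq_bigr => i _; congr (_ ^+ 2).
  by rewrite /defect /moment mxE summxE; congr (_ * _); apply: eq_bigr => m _; rewrite mxE.
have nE w : dot (residual (bpath W B w) *: v k w) (residual (bpath W B w) *: v k w) =
    \sum_i noise i (bpath W B w) ^+ 2.
  by rewrite dot_sqr; apply: eq_bigr => i _; rewrite mxE.
have mpn o i : measurable_fun setT (fun w => noise i (path_of W B Ws Bs o w)).
  exact: (measurable_path_fun H o (mnoise i)).
under eq_integral do rewrite dE.
rewrite mean_sum; first last.
- by move=> i w; exact: sqr_ge0.
- move=> i; apply: measurable_funX; apply: measurable_funM => //.
  by apply: measurable_sum => m; exact: (mpn (Some m)).
apply: (@le_trans _ _ (\sum_i (M%:R^-1%:E * E (fun w => noise i (bpath W B w) ^+ 2)))%E).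
  by apply: lee_sum => i _; exact: (empirical_second_moment H M0 (mnoise i) (inoise i) (noise0 i)).
have E0 i : (0 <= E (fun w => noise i (bpath W B w) ^+ 2))%E by apply: mean_ge0 => w; exact: sqr_ge0.
have Mi : 0 <= M%:R^-1 :> R by rewrite invr_ge0.
rewrite -ge0_sume_distrr// -mean_sum; first last.
- by move=> i w; exact: sqr_ge0.
- by move=> i; apply: measurable_funX; exact: (mpn None).
under eq_integral do rewrite -nE.
rewrite mulrC EFinM -muleA; apply: lee_wpmul2l; first by rewrite lee_fin.
exact: noise_le_eps.
Qed.
End statistical_error.

(** * Truncation *)
Section truncation_theory.
Context {R : realType} (xi : R -> R).
Hypothesis hxi : truncation_fun xi.

Lemma truncation_lipschitz x y : `|xi x - xi y| <= `|x - y|.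
Proof.
have [[dxi _ _ _] _ _ xi1] := hxi.
have cxi z : {for z, continuous xi} by apply: differentiable_continuous; apply/derivable1_diffP.
wlog xy : x y / x < y => [IH|].
  case: (ltgtP x y) => [/IH//|/IH|->]; last by rewrite !subrr normr0.
  by rewrite distrC [`|y - x|]distrC.
have [c _] := @MVT _ xi (derive1 xi) x y xy
  (fun z _ => DeriveDef (dxi z) (esym (derive1E xi z))) (continuous_subspaceT cxi).
rewrite distrC => ->; rewrite normrM [`|x - y|]distrC.
by rewrite ler_piMl// xi1.
Qed.

Lemma truncate_lipschitz r x y : 0 < r -> `|truncate xi r x - truncate xi r y| <= `|x - y|.
Proof.
move=> r0; rewrite /truncate -mulrBr normrM (gtr0_norm r0).
rewrite mulrC -ler_pdivlMr// (le_trans (truncation_lipschitz _ _))//.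
by rewrite -mulrBl normrM normfV (gtr0_norm r0).
Qed.

Lemma truncate_id r x : 0 < r -> `|x| <= r -> truncate xi r x = x.
Proof.
move=> r0 xr; have [_ xid _ _] := hxi; rewrite /truncate xid.
  by rewrite mulrC divfK// gt_eqF.
rewrite normrM normfV (gtr0_norm r0) ler_pdivrMr//.
by rewrite (le_trans xr)// ler_peMl ?(ltW r0)//; lra.
Qed.

Lemma truncate_le r x : 0 < r -> `|truncate xi r x| <= 2 * r.
Proof.
move=> r0; have [_ _ xi2 _] := hxi.
by rewrite /truncate normrM (gtr0_norm r0) mulrC ler_pM2r.
Qed.

Lemma measurable_truncation : measurable_fun setT xi.
Proof.
have [[dxi _ _ _] _ _ _] := hxi; apply: continuous_measurable_fun => z.
by apply: differentiable_continuous; apply/derivable1_diffP.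
Qed.

End truncation_theory.

(** * One regression of the numerical scheme on its good event *)
Section sample_step.
Context {R : realType} {d : measure_display} {Omega : measurableType d}.
Context {P : probability Omega R} {W B : R -> Omega -> R} {cf : coefs R}.
Context {bs : cell_basis R} {N M : nat} {Ws Bs : 'I_M -> R -> Omega -> R}.
Hypothesis H : regression_setting P W B cf bs N Ws Bs.
Variables (Lf Lg C0 : R) (xi : R -> R) (I : nat).
Variables (alpha beta : forall k, nat -> Omega -> 'cV[R]_(pdim bs N k)).
Local Notation f := (driver cf).
Local Notation g := (bdriver cf).
Hypothesis hf : forall x y z x' y' z',
   `|f x y z - f x' y' z'| ^+ 2 <= Lf * (`|x - x'| ^+ 2 + `|y - y'| ^+ 2 + `|z - z'| ^+ 2).
Local Notation h := (mesh cf N).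
Hypothesis reg : regression_scheme P W B cf C0 xi I Ws Bs alpha beta.
Hypothesis I2 : (1 < I)%N.
Hypothesis hL : (48 * Lf + 2) * h <= 1.
Context {k : nat} {w : Omega}.
Hypothesis kN : (k < N)%N.
Local Notation ps m := (pvec P W cf bs N k (spath Ws Bs m w)).
Local Notation vs m := (vvec P W cf bs N k (spath Ws Bs m w)).
Local Notation Ym := (YMs P W cf C0 xi I Ws Bs alpha k.+1).
Local Notation good := (good_step P W cf bs N Ws Bs k).

Definition sample_data (y : R) (q : path2 (R := R)) : R :=
  y + dB cf N k q * g (XN cf N k.+1 q) y.

(** In the coordinates (alpha, sqrt h beta) on the regressors v, the empirical
    risk is an ordinary least squares functional. *)
Lemma sample_normal_equation i : (i < I)%N ->
  gram (fun m => vs m) *m theta (cf := cf) (alpha k i.+1 w) (beta k i.+1 w) =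
  moment (fun m => vs m) (fun m => sample_data (Ym m w) (spath Ws Bs m w) +
    h * driver_at (P := P) (W := W) (cf := cf) (bs := bs) (N := N) (alpha k i w) (beta k i w) (spath Ws Bs m w)).
Proof.
move=> iI; have [_ _ /(_ k w kN) [_ _ /(_ i.+1)]] := reg.
have [s0 s2] := mesh_sqrt H.
move=> /(_ iI) riskmin; apply: normal_equation => x.
have thetaE a b m : dot (theta (cf := cf) a b) (vs m) = dot a (ps m) + dot b (ps m) * dW cf N k (spath Ws Bs m w).
  by rewrite /theta /vvec dot_col_mx dotZl dotZr; congr (_ + _); field.
have riskE a b : empirical_risk P W cf C0 xi I Ws Bs alpha beta i.+1 w a b =
  avg (fun m => (sample_data (Ym m w) (spath Ws Bs m w) +
    h * driver_at (P := P) (W := W) (cf := cf) (bs := bs) (N := N) (alpha k i w) (beta k i w) (spath Ws Bs m w)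
    - dot (theta (cf := cf) a b) (vs m)) ^+ 2).
  apply: eq_avg => m; rewrite real_normK ?num_real// thetaE /sample_data /driver_at /=.
  by congr (_ ^+ 2); ring.
have xE : x = theta (cf := cf) (usubmx x) ((Num.sqrt h)^-1 *: dsubmx x).
  by rewrite /theta scalerA divff// scale1r vsubmxK.
by rewrite xE -!riskE; exact: riskmin.
Qed.

Let h0 := mesh_gt0 H.

Lemma good_quad x : good w -> (1 - h) * dot x x <= dot x (gram (fun m => vs m) *m x).
Proof.
move=> [gV _]; have : (VM P W cf bs N Ws Bs k w - 1%:M)^T = VM P W cf bs N Ws Bs k w - 1%:M.
  by rewrite linearB /= trmx1 [(VM _ _ _ _ _ _ _ _ _)^T]gram_sym.
move=> /eignorm_quad /(_ gV x); rewrite mulmxBl mul1mx dotBr => /ler_normlP[].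
by rewrite -[VM _ _ _ _ _ _ _ _ _]/(gram (fun m => vs m)); lra.
Qed.

Lemma good_basis_quad x : good w -> dot x (gram (fun m => ps m) *m x) <= (1 + h) * dot x x.
Proof.
move=> [_ gP]; have : (PM P W cf bs N Ws Bs k w - 1%:M)^T = PM P W cf bs N Ws Bs k w - 1%:M.
  by rewrite linearB /= trmx1 [(PM _ _ _ _ _ _ _ _ _)^T]gram_sym.
move=> /eignorm_quad /(_ gP x); rewrite mulmxBl mul1mx dotBr => /ler_normlP[].
by rewrite -[PM _ _ _ _ _ _ _ _ _]/(gram (fun m => ps m)); lra.
Qed.

Variables (c : 'cV[R]_(pdim bs N k.+1)) (a b : 'cV[R]_(pdim bs N k)).

Lemma sample_regression_step : good w ->
  dot (alpha k I w - a) (alpha k I w - a) +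
  2^-1 * (h * dot (beta k I w - b) (beta k I w - b)) <=
  (1 + step_const Lf I * h) *
     avg (fun m => (sample_data (Ym m w) (spath Ws Bs m w) - target (P := P) (W := W) (cf := cf) (bs := bs) (N := N) c (spath Ws Bs m w)) ^+ 2)
  + step_const Lf I / h * dot (defect (P := P) (W := W) (cf := cf) (bs := bs) (N := N) (Ws := Ws) (Bs := Bs) c a b w)
                              (defect (P := P) (W := W) (cf := cf) (bs := bs) (N := N) (Ws := Ws) (Bs := Bs) c a b w)
  + step_const Lf I * h ^+ (I - 1) * (dot a a + h * dot b b).
Proof.
move=> gw; have [_ _ /(_ k w kN) [al0 be0 _]] := reg.
have FL (m : 'I_M) y z y' z' :
   (f (XN cf N k (spath Ws Bs m w)) y z - f (XN cf N k (spath Ws Bs m w)) y' z') ^+ 2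
     <= Lf * ((y - y') ^+ 2 + (z - z') ^+ 2).
  have := hf (XN cf N k (spath Ws Bs m w)) y z (XN cf N k (spath Ws Bs m w)) y' z'.
  by rewrite subrr normr0 expr0n add0r !real_normK ?num_real.
have := regression_step (p := fun m => ps m) (s := fun m => dW cf N k (spath Ws Bs m w) / Num.sqrt h)
  h0 (driver_const_ge0 hf) hL FL (fun x => good_quad x gw)
  (fun x => good_basis_quad x gw) 
  (al := fun i => alpha k i w) (be := fun i => beta k i w)
  (fun m => target (P := P) (W := W) (cf := cf) (bs := bs) (N := N) c (spath Ws Bs m w)) a b I2 al0 be0 sample_normal_equation.
by apply.
Qed.

End sample_step.

Lemma decreasing_ind N (Q : nat -> Prop) : Q N ->
  (forall k, (k < N)%N -> Q k.+1 -> Q k) -> forall k, (k <= N)%N -> Q k.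
Proof.
move=> QN Qs k kN; rewrite -(subKn kN); have := leq_subr k N.
elim: (N - k)%N => [|n IH] nN; first by rewrite subn0.
apply: Qs; first by rewrite ltn_subrL (leq_trans _ nN).
by rewrite subnSK//; apply: IH; exact: ltnW.
Qed.

(** * The regression coefficients as functions of the samples *)
Section sample_measurability.
Context {R : realType} {d : measure_display} {Omega : measurableType d}.
Context {P : probability Omega R} {W B : R -> Omega -> R} {cf : coefs R}.
Context {bs : cell_basis R} {N M : nat} {Ws Bs : 'I_M -> R -> Omega -> R}.
Hypothesis H : regression_setting P W B cf bs N Ws Bs.
Variables (Lf Lg C0 : R) (xi : R -> R) (I : nat).
Variables (alpha beta : forall k, nat -> Omega -> 'cV[R]_(pdim bs N k)).
Local Notation f := (driver cf).
Local Notation g := (bdriver cf).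
Hypothesis hf : forall x y z x' y' z',
   `|f x y z - f x' y' z'| ^+ 2 <= Lf * (`|x - x'| ^+ 2 + `|y - y'| ^+ 2 + `|z - z'| ^+ 2).
Hypothesis hg : forall x y x' y',
   `|g x y - g x' y'| ^+ 2 <= Lg * (`|x - x'| ^+ 2 + `|y - y'| ^+ 2).
Local Notation h := (mesh cf N).
Hypothesis hxi : truncation_fun xi.
Hypothesis reg : regression_scheme P W B cf C0 xi I Ws Bs alpha beta.
Hypothesis I0 : (0 < I)%N.
Hypothesis h1 : h < 1.
Local Notation blk U := (block (W := W) (B := B) (cf := cf) (N := N) (Ws := Ws) (Bs := Bs) U).
Local Notation good_event k := (good_event P W cf bs N Ws Bs k).
Local Notation good_step k := (good_step P W cf bs N Ws Bs k).

(** Only the increments of B from step k on: leaving out the earlier ones is what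
    makes an increment of B independent of all later regressions. *)
Definition sample_block k : set (option 'I_M * (bool * 'I_N)) :=
  [set e : option 'I_M * (bool * 'I_N) | e.1 /\ (e.2.1 \/ (k <= e.2.2)%N)].

Local Notation tail k := (g_sigma_algebraType (blk (sample_block k))).

Lemma block_mono d' (T : measurableType d') U U' (F : Omega -> T) : U `<=` U' ->
  measurable_fun (setT : set (g_sigma_algebraType (blk U))) F ->
  measurable_fun (setT : set (g_sigma_algebraType (blk U'))) F.
Proof.
move=> UU' mF _ C mC; have := mF measurableT C mC; apply: sub_sigma_algebra2.
by move=> A [e Ue eA]; exists e => //; exact: UU'.
Qed.

Lemma sample_block_mono k k' : (k <= k')%N -> sample_block k' `<=` sample_block k.
Proof. by move=> kk' e [e1 [eW|ke]]; split => //; [left|right; exact: leq_trans ke]. Qed.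

Lemma sample_path_measurable d' (T : measurableType d') k m (F : path2 (R := R) -> T) :
  measurable_fun (setT : set (inc_path cf [set e : bool * 'I_N | e.1 \/ (k <= e.2)%N])) F ->
  measurable_fun (setT : set (tail k)) (fun w => F (spath Ws Bs m w)).
Proof.
move=> mF.
exact: (block_path (W := W) (B := B) (Ws := Ws) (Bs := Bs) (U := sample_block k) (o := Some m) mF).
Qed.


Let mp k j m : (k <= j)%N -> (j <= N)%N ->
  mx_measurable (T := tail k) (fun w => pvec P W cf bs N j (spath Ws Bs m w)).
Proof.
move=> kj jN i i'; rewrite (ord1 i').
apply: (sample_path_measurable m (F := fun q => pvec P W cf bs N j q i 0)).
apply: (measurable_pvec P W (setting_wf H) (setting_drift H) (setting_diffusion H) i jN).
by move=> [[] e] /= je; [left|right; exact: leq_trans je].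
Qed.

Let mX k j m : (j <= N)%N ->
  measurable_fun (setT : set (tail k)) (fun w => XN cf N j (spath Ws Bs m w)).
Proof.
move=> jN; apply: (sample_path_measurable m (F := XN cf N j)).
by apply: (measurable_XN (setting_drift H) (setting_diffusion H) jN) => e _; left.
Qed.

Let mdW k j m : (j < N)%N ->
  measurable_fun (setT : set (tail k)) (fun w => dW cf N j (spath Ws Bs m w)).
Proof.
move=> jN; apply: (sample_path_measurable m (F := dW cf N j)).
by apply: (measurable_dW (jN := jN)); left.
Qed.

Let mdB k j m : (k <= j)%N -> (j < N)%N ->
  measurable_fun (setT : set (tail k)) (fun w => dB cf N j (spath Ws Bs m w)).
Proof.
move=> kj jN; apply: (sample_path_measurable m (F := dB cf N j)).
by apply: (measurable_dB (jN := jN)); right.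
Qed.

Let mv k j m : (k <= j)%N -> (j < N)%N ->
  mx_measurable (T := tail k) (fun w => vvec P W cf bs N j (spath Ws Bs m w)).
Proof.
move=> kj jN; apply: mx_measurable_col; first exact: mp (ltnW jN).
apply: mx_measurableZ; last exact: mp (ltnW jN).
by apply: measurable_funM => //; exact: mdW.
Qed.

Let mgram k n (u : 'I_M -> Omega -> 'cV[R]_n) : (forall m, mx_measurable (T := tail k) (u m)) ->
  mx_measurable (T := tail k) (fun w => gram (fun m => u m w)).
Proof.
move=> mu; apply: mx_measurableZ => //; apply: mx_measurable_sum => m.
by apply: mx_measurableM => //; exact: mx_measurable_tr.
Qed.

Lemma measurable_good_step k j : (k <= j)%N -> (j < N)%N ->
  measurable (good_step j : set (tail k)).
Proof.
move=> kj jN; have h0 := ltW (mesh_gt0 H).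
have -> : good_step j = [set w | eignorm (VM P W cf bs N Ws Bs j w - 1%:M) <= h] `&`
   [set w | eignorm (PM P W cf bs N Ws Bs j w - 1%:M) <= h] by [].
apply: measurableI.
  apply: (measurable_eignorm_le (T := tail k)) => //.
    by move=> w; rewrite linearB /= trmx1 [(VM _ _ _ _ _ _ _ _ _)^T]gram_sym.
  apply: mx_measurableB; last exact: mx_measurable_cst.
  by apply: mgram => m; exact: mv.
apply: (measurable_eignorm_le (T := tail k)) => //.
  by move=> w; rewrite linearB /= trmx1 [(PM _ _ _ _ _ _ _ _ _)^T]gram_sym.
apply: mx_measurableB; last exact: mx_measurable_cst.
by apply: mgram => m; exact: mp (ltnW jN).
Qed.

Lemma good_event_last : good_event N = setT.
Proof.
apply/seteqP; split => // w _ j /= /andP[Nj jN].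
by have := leq_ltn_trans Nj jN; rewrite ltnn.
Qed.

Lemma good_event_step k : (k < N)%N -> good_event k = good_step k `&` good_event k.+1.
Proof.
move=> kN; apply/seteqP; split => w.
  move=> gw; split; first by apply: gw => /=; rewrite leqnn.
  by move=> j /= /andP[kj jN]; apply: gw => /=; rewrite jN (ltnW kj).
move=> [gk gw] j /= /andP[]; rewrite leq_eqVlt => /orP[/eqP <-//|kj jN].
by apply: gw => /=; rewrite kj.
Qed.

Lemma measurable_good_event k j : (j <= N)%N -> (k <= j)%N -> measurable (good_event j : set (tail k)).
Proof.
move: j; apply: (decreasing_ind (Q := fun j => (k <= j)%N -> measurable (good_event j : set (tail k)))) => [_|j jN IH kj].
  by rewrite good_event_last; exact: measurableT.
rewrite good_event_step//; apply: measurableI; first exact: measurable_good_step.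
by apply: IH; exact: leq_trans kj _.
Qed.

(** [YMs] for arbitrary coefficients: the actual ones are functions of the right
    increments only on the good event, where they are replaced by measurable
    versions. *)
Definition sample_value k (a : Omega -> 'cV[R]_(pdim bs N k)) m w :=
  truncate xi (rho P W cf bs N C0 k (spath Ws Bs m w)) (dot (a w) (pvec P W cf bs N k (spath Ws Bs m w))).

Lemma measurable_sample_value k (a : Omega -> 'cV[R]_(pdim bs N k)) m : (k <= N)%N -> mx_measurable (T := tail k) a ->
  measurable_fun (setT : set (tail k)) (sample_value a m).
Proof.
move=> kN ma.
have mr : measurable_fun (setT : set (tail k)) (fun w => rho P W cf bs N C0 k (spath Ws Bs m w)).
  apply: measurable_maxr => //; apply: measurable_funM => //.
  by apply: measurable_enorm; exact: mp.
apply: measurable_funM => //; apply: (measurableT_comp (measurable_truncation hxi)).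
apply: measurable_funM; last exact: measurable_invr.
by apply: measurable_dot => //; exact: mp.
Qed.

(** On the good event the normal equations have a unique solution, given by
    Cramer's rule, so the coefficients coincide there with functions of the
    increments that enter the regressions from step k on. *)
Lemma coefficients_measurable k : (k <= N)%N ->
  exists a b : Omega -> 'cV[R]_(pdim bs N k),
    [/\ mx_measurable (T := tail k) a, mx_measurable (T := tail k) b &
        forall w, good_event k w -> alpha k I w = a w /\ beta k I w = b w].
Proof.
move: k; apply: (decreasing_ind (Q := fun k => exists a b : Omega -> 'cV[R]_(pdim bs N k),
    [/\ mx_measurable (T := tail k) a, mx_measurable (T := tail k) b &
        forall w, good_event k w -> alpha k I w = a w /\ beta k I w = b w])).
  have [_ [c _ cE] _] := reg; exists (fun=> c), (fun=> 0).
  split=> [||w _]; [exact: mx_measurable_cst|exact: mx_measurable_cst|].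
  by apply: cE; rewrite I0 leqnn.
move=> k kN [a' [b' [ma' _ E']]].
have SM d' (T : measurableType d') (F : Omega -> T) : measurable_fun (setT : set (tail k.+1)) F ->
    measurable_fun (setT : set (tail k)) F.
  by apply: block_mono; exact: sample_block_mono.
have mY m : measurable_fun (setT : set (tail k)) (sample_value a' m).
  by apply: SM; exact: measurable_sample_value.
pose D m w := sample_data (cf := cf) (N := N) (k := k) (sample_value a' m w) (spath Ws Bs m w).
have mD m : measurable_fun (setT : set (tail k)) (D m).
  apply: measurable_funD => //; apply: measurable_funM; first exact: mdB.
  by apply: (measurable_bdriver hg) => //; exact: mX.
suff key i : (i <= I)%N -> exists a b : Omega -> 'cV[R]_(pdim bs N k),
    [/\ mx_measurable (T := tail k) a, mx_measurable (T := tail k) b &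
        forall w, good_event k w -> alpha k i w = a w /\ beta k i w = b w] by exact: key.
have [_ _ step0] := reg.
elim: i => [_|i IH iI].
  exists (fun=> 0), (fun=> 0); split=> [||w _]; [exact: mx_measurable_cst|exact: mx_measurable_cst|].
  by have [-> ->] := step0 k w kN.
have [a [b [ma mb E]]] := IH (ltnW iI).
pose vs m w := vvec P W cf bs N k (spath Ws Bs m w).
pose z w := moment (fun m => vs m w) (fun m => D m w +
  h * driver_at (P := P) (W := W) (cf := cf) (bs := bs) (N := N) (a w) (b w) (spath Ws Bs m w)).
pose sol w := cramer (gram (fun m => vs m w)) (z w).
have mvs m : mx_measurable (T := tail k) (vs m) by exact: mv.
have mz : mx_measurable (T := tail k) z.
  apply: mx_measurableZ => //; apply: mx_measurable_sum => m; apply: mx_measurableZ => //.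
  apply: measurable_funD => //; apply: measurable_funM => //.
  apply: (measurable_driver hf); first exact: mX (ltnW kN).
    by apply: measurable_dot => //; exact: mp (ltnW kN).
  by apply: measurable_dot => //; exact: mp (ltnW kN).
have ms : mx_measurable (T := tail k) sol by apply: mx_measurable_cramer => //; exact: mgram.
exists (fun w => usubmx (sol w)), (fun w => (Num.sqrt h)^-1 *: dsubmx (sol w)); split.
- by move=> i1 i2; under eq_fun do rewrite mxE; exact: ms.
- by apply: mx_measurableZ => // i1 i2; under eq_fun do rewrite mxE; exact: ms.
move=> w gw; have [gk gk1] : good_step k w /\ good_event k.+1 w by rewrite good_event_step in gw.
have [e1 e2] := E w gw; have [e1' _] := E' w gk1.
have uV : gram (fun m => vs m w) \in unitmx.
  by apply: (gram_unit h1) => x; exact: (good_quad x gk).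
have eq := sample_normal_equation H reg kN (w := w) iI.
have zE : gram (fun m => vs m w) *m theta (cf := cf) (alpha k i.+1 w) (beta k i.+1 w) = z w.
  rewrite eq /z e1 e2; congr (moment _ _); apply/funext => m; congr (_ + _).
  by rewrite /D /sample_value -e1'.
have solE := cramerE uV zE.
have [s0 _] := mesh_sqrt H.
by rewrite -[sol w]solE /theta col_mxKu col_mxKd scalerA mulVf// scale1r.
Qed.

End sample_measurability.

(** What the projected Picard scheme provides for the comparison: the
    coefficients al, ai and be of its iterate, its limit and its slope. *)
Record picard_coordinates {R : realType} {d : measure_display} {Omega : measurableType d}
    (P : probability Omega R) (W B : R -> Omega -> R) (cf : coefs R) (bs : cell_basis R)
    (N : nat) (Lf C0 : R) (I : nat) (Y Z : nat -> Omega -> R)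
    (al ai be : forall k, 'cV[R]_(pdim bs N k)) : Prop := PicardCoordinates {
  coord_Y : forall k, (k <= N)%N -> measurable_fun setT (Y k) /\
    Y k = (fun w => dot (al k) (pvec P W cf bs N k (bpath W B w))) %[ae P];
  coord_Z : forall k, (k < N)%N -> measurable_fun setT (Z k) /\
    Z k = (fun w => dot (be k) (pvec P W cf bs N k (bpath W B w))) %[ae P];
  coord_al : forall k, (k <= N)%N -> dot (al k) (al k) <= C0;
  coord_ai : forall k, (k < N)%N -> dot (ai k) (ai k) <= C0;
  coord_be : forall k, (k < N)%N -> mesh cf N * dot (be k) (be k) <= C0;
  coord_contraction : forall k, (k < N)%N ->
    dot (al k - ai k) (al k - ai k) <= (mesh cf N ^+ 2 * Lf) ^+ I * dot (ai k) (ai k);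
  coord_target : forall k, (k < N)%N -> sqint P (fun w =>
    full_target (P := P) (W := W) (cf := cf) (bs := bs) (N := N) (al k.+1) (ai k) (be k) (bpath W B w));
  coord_theta : forall k, (k < N)%N ->
    coefs_of P (fun w => vvec P W cf bs N k (bpath W B w)) (fun w =>
      full_target (P := P) (W := W) (cf := cf) (bs := bs) (N := N) (al k.+1) (ai k) (be k) (bpath W B w)) =
    theta (cf := cf) (ai k) (be k);
  coord_last : forall c, orth_proj P (fun w => pvec P W cf bs N N (bpath W B w))
    (fun w => terminal cf (XN cf N N (bpath W B w)))
    (fun w => dot c (pvec P W cf bs N N (bpath W B w))) -> c = al N }.

Lemma step_const_ge0 {R : realType} (L : R) I : 0 <= L -> 0 <= step_const L I.
Proof.
move=> L0; have L3 : 0 <= 3 * L by rewrite mulr_ge0.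
by have := exprn_ge0 (I - 1) L3; rewrite /step_const; lra.
Qed.

Lemma recursion_arith {R : realFieldType} (x y u z t T s h q C a L : R) :
  0 <= h -> h <= 1 -> 0 <= s -> 0 <= q -> 0 <= y -> 0 <= z -> 0 <= a -> 0 <= C ->
  u + 2^-1 * y <= (1 + s * h) * a + s / h * z + s * q * T ->
  x <= (1 + h) * u + (1 + h^-1) * t -> (1 + h^-1) * t <= L * q -> T <= 2 * C ->
  x + 2^-1 * y <= (1 + (1 + 2 * s) * h) * a + 2 * s / h * z + (4 * s * C + L) * q.
Proof.
move=> h0 h1 s0 q0 y0 z0 a0 C0 S1 S2 S3 S4.
have sT : s * q * T <= s * q * (2 * C) by rewrite ler_wpM2l// mulr_ge0.
have S5 : (1 + h) * (u + 2^-1 * y) <= (1 + h) * ((1 + s * h) * a + s / h * z + s * q * T).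
  by rewrite ler_wpM2l// addr_ge0.
have e1 : (1 + h) * ((1 + s * h) * a) <= (1 + (1 + 2 * s) * h) * a.
  rewrite mulrA ler_wpM2r//.
  have shh : s * h * h <= s * h by rewrite ler_piMr// mulr_ge0.
  lra.
have e2 : (1 + h) * (s / h * z) <= 2 * s / h * z.
  have szh : 0 <= s / h * z by rewrite mulr_ge0// divr_ge0.
  rewrite -[2 * s / h]mulrA -[2 * (s / h) * z]mulrA ler_wpM2r//.
  by lra.
have e3 : (1 + h) * (s * q * T) <= 2 * (s * q * (2 * C)).
  apply: (@le_trans _ _ ((1 + h) * (s * q * (2 * C)))).
    by rewrite ler_wpM2l// addr_ge0.
  by rewrite ler_wpM2r ?mulr_ge0//; lra.
have e4 : 2^-1 * y <= (1 + h) * (2^-1 * y).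
  by rewrite ler_peMl ?mulr_ge0 ?invr_ge0//; lra.
lra.
Qed.

Lemma growth_arith {R : realFieldType} (a b h : R) : 0 <= h -> h <= 1 -> 0 <= a -> 0 <= b ->
  (1 + a * h) * ((1 + b * h) * (1 + h)) <= 1 + (2 * (a + b + a * b) + 1) * h.
Proof.
move=> h0 h1 a0 b0; have ab0 : 0 <= a * b by rewrite mulr_ge0.
have t1 : (1 + a * h) * (1 + b * h) <= 1 + (a + b + a * b) * h.
  have : a * b * (h * h) <= a * b * h by rewrite ler_wpM2l// ler_piMr.
  by lra.
rewrite mulrA; apply: (@le_trans _ _ ((1 + (a + b + a * b) * h) * (1 + h))).
  by rewrite ler_wpM2r// addr_ge0.
have c0 : 0 <= a + b + a * b by rewrite !addr_ge0.
have : (a + b + a * b) * (h * h) <= (a + b + a * b) * h by rewrite ler_wpM2l// ler_piMr.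
lra.
Qed.

(** * Propagation of the error of the coefficients *)
Section recursion.
Context {R : realType} {d : measure_display} {Omega : measurableType d}.
Context {P : probability Omega R} {W B : R -> Omega -> R} {cf : coefs R}.
Context {bs : cell_basis R} {N M : nat} {Ws Bs : 'I_M -> R -> Omega -> R}.
Hypothesis H : regression_setting P W B cf bs N Ws Bs.
Variables (Lf Lg C0 : R) (xi : R -> R) (I : nat).
Variables (alpha beta : forall k, nat -> Omega -> 'cV[R]_(pdim bs N k)).
Local Notation f := (driver cf).
Local Notation g := (bdriver cf).
Hypothesis hf : forall x y z x' y' z',
   `|f x y z - f x' y' z'| ^+ 2 <= Lf * (`|x - x'| ^+ 2 + `|y - y'| ^+ 2 + `|z - z'| ^+ 2).
Hypothesis hg : forall x y x' y',
   `|g x y - g x' y'| ^+ 2 <= Lg * (`|x - x'| ^+ 2 + `|y - y'| ^+ 2).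
Local Notation h := (mesh cf N).
Hypothesis hxi : truncation_fun xi.
Hypothesis reg : regression_scheme P W B cf C0 xi I Ws Bs alpha beta.
Variables (Y Z : nat -> Omega -> R) (al ai be : forall k, 'cV[R]_(pdim bs N k)).
Hypothesis HC : picard_coordinates P W B cf Lf C0 I Y Z al ai be.
Hypothesis I2 : (1 < I)%N.
Hypothesis hL : (48 * Lf + 2) * h <= 1.
Hypothesis M0 : (0 < M)%N.
Local Notation E F := (\int[P]_w (F w)%:E)%E.
Local Notation blk U := (block (W := W) (B := B) (cf := cf) (N := N) (Ws := Ws) (Bs := Bs) U).
Local Notation tail k := (g_sigma_algebraType (blk (sample_block k))).
Local Notation good_event k := (good_event P W cf bs N Ws Bs k).
Local Notation good_step k := (good_step P W cf bs N Ws Bs k).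
Local Notation ps k m w := (pvec P W cf bs N k (spath Ws Bs m w)).
Local Notation J k w := (\1_(good_event k) w : R).
Local Notation dal k w := (alpha k I w - al k).
Local Notation dbe k w := (beta k I w - be k).

Let h0 := mesh_gt0 H.
Let Lf0 : 0 <= Lf := driver_const_ge0 hf.
Let Lg0 : 0 <= Lg := bdriver_const_ge0 hg.
Let C00 : 0 <= C0. Proof. exact: le_trans (dot_ge0 _) (coord_al HC (leqnn N)). Qed.
Let h12 : h <= 1 / 2.
Proof. have := mulr_ge0 Lf0 (ltW h0); have := hL; lra. Qed.
Let h1 : h < 1. Proof. have := h12; lra. Qed.
Let I0 : (0 < I)%N. Proof. exact: ltnW. Qed.

Definition position_error k : \bar R := E (fun w => J k w * dot (dal k w) (dal k w)).
Definition slope_error k : \bar R := E (fun w => J k w * (h * dot (dbe k w) (dbe k w))).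

Lemma good01 k w : (good_event k w -> J k w = 1) /\ (~ good_event k w -> J k w = 0).
Proof.
split=> gw; rewrite indicE; first by rewrite mem_set.
by rewrite memNset.
Qed.

Lemma good_sqr k w : J k w ^+ 2 = J k w.
Proof.
have [g1 g0] := good01 k w.
by have [/g1 ->|/g0 ->] := pselect (good_event k w); rewrite ?expr1n ?expr0n.
Qed.

Lemma good_ge0 k w : 0 <= J k w.
Proof. by rewrite -good_sqr sqr_ge0. Qed.

Lemma position_error_ge0 k : (0 <= position_error k)%E.
Proof. by apply: mean_ge0 => w; rewrite mulr_ge0 ?dot_ge0// good_ge0. Qed.

Lemma slope_error_ge0 k : (0 <= slope_error k)%E.
Proof.
apply: mean_ge0 => w; apply: mulr_ge0; first exact: good_ge0.
by apply: mulr_ge0; [exact: ltW h0|exact: dot_ge0].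
Qed.

Lemma last_coefficients w : alpha N I w = al N.
Proof.
have [_ [c cproj cE] _] := reg.
have [-> _] : alpha N I w = c /\ beta N I w = 0 by apply: cE; rewrite I0 leqnn.
exact: coord_last HC _ cproj.
Qed.

Let mdal k : (k <= N)%N -> mx_measurable (fun w => dal k w).
Proof.
move=> kN i j; rewrite (ord1 j); under eq_fun do rewrite !mxE.
apply: measurable_funB => //; have [mab _ _] := reg.
by have [] := mab k I i kN (leqnn I).
Qed.

Let mdbe k : (k <= N)%N -> mx_measurable (fun w => dbe k w).
Proof.
move=> kN i j; rewrite (ord1 j); under eq_fun do rewrite !mxE.
apply: measurable_funB => //; have [mab _ _] := reg.
by have [] := mab k I i kN (leqnn I).
Qed.

Let mJt k j : (k <= j)%N -> (j <= N)%N -> measurable_fun (setT : set (tail k)) (fun w => J j w).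
Proof.
by move=> kj jN; exact: (measurable_indic (measurable_good_event H jN kj)).
Qed.

Let mJ k : (k <= N)%N -> measurable_fun setT (fun w => J k w).
Proof. by move=> kN; have mJ := measurable_block H (mJt (leqnn k) kN). Qed.

Let mps k m : (k <= N)%N -> mx_measurable (fun w => ps k m w).
Proof.
move=> kN i j; rewrite (ord1 j).
apply: (measurable_path_fun H (Some m) (S := setT) (F := fun q => pvec P W cf bs N k q i 0)).
exact: (measurable_pvec P W (setting_wf H) (setting_drift H) (setting_diffusion H)).
Qed.

(** One step back, the errors of the sample values enter through the martingale
    increment of B, which is independent of everything that the later
    regressions use: the cross term disappears. *)
Lemma propagated_error k : (k < N)%N ->
  (E (fun w => J k.+1 w * avg (fun m =>
     (sample_data (cf := cf) (N := N) (k := k) (YMs P W cf C0 xi I Ws Bs alpha k.+1 m w) (spath Ws Bs m w)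
      - target (P := P) (W := W) (cf := cf) (bs := bs) (N := N) (al k.+1) (spath Ws Bs m w)) ^+ 2)) <=
   ((1 + Lg * h) * (1 + h))%:E * position_error k.+1)%E.
Proof.
move=> kN.
have [a [b [ma _ abE]]] := coefficients_measurable H hf hg hxi reg I0 h1 kN.
pose y m w := sample_value (P := P) (W := W) (cf := cf) (bs := bs) (N := N) (Ws := Ws) (Bs := Bs) C0 xi (k := k.+1) a m w.
pose y0 m w := dot (al k.+1) (ps k.+1 m w).
pose Xm m w := XN cf N k.+1 (spath Ws Bs m w).
pose U m w := J k.+1 w * (y m w - y0 m w).
pose V m w := J k.+1 w * (g (Xm m w) (y m w) - g (Xm m w) (y0 m w)).
pose b' m w := dB cf N k (spath Ws Bs m w).
have my m : measurable_fun (setT : set (tail k.+1)) (y m) by exact: (measurable_sample_value H).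
have my0 m : measurable_fun (setT : set (tail k.+1)) (y0 m).
  apply: measurable_dot; first exact: mx_measurable_cst.
  move=> i j; rewrite (ord1 j).
  apply: (sample_path_measurable m (F := fun q => pvec P W cf bs N k.+1 q i 0)).
  apply: (measurable_pvec P W (setting_wf H) (setting_drift H) (setting_diffusion H) i kN).
  by move=> [[] e] /= je; [left|right].
have mX m : measurable_fun (setT : set (tail k.+1)) (Xm m).
  apply: (sample_path_measurable m (F := XN cf N k.+1)).
  by apply: (measurable_XN (setting_drift H) (setting_diffusion H) kN) => e _; left.
have mU m : measurable_fun (setT : set (tail k.+1)) (U m).
  by apply: measurable_funM; [exact: mJt|exact: measurable_funB].
have mV m : measurable_fun (setT : set (tail k.+1)) (V m).
  by apply: measurable_funM; [exact: mJt|apply: measurable_funB; exact: (measurable_bdriver hg)].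
pose e m : option 'I_M * (bool * 'I_N) := (Some m, (false, Ordinal kN)).
have mb m : measurable_fun (setT : set (g_sigma_algebraType (blk [set e m]))) (b' m).
  exact: (block_increment (e := e m)).
have sb X : <<s blk X >> `<=` measurable by exact: (block_sub H).
have ind m : independent2 P <<s blk (sample_block k.+1) >> <<s blk [set e m] >>.
  apply: (block_independent H) => e' + ee; rewrite ee /sample_block /= => -[_ [//|]].
  by rewrite ltnn.
have toO X (K : Omega -> R) : measurable_fun (setT : set (g_sigma_algebraType (blk X))) K ->
    measurable_fun setT K by move=> mK; have mK' := measurable_block H mK.
have mD m : measurable_fun setT (fun w => (U m w + V m w * b' m w) ^+ 2).
  apply: measurable_funX; apply: measurable_funD; first exact: toO (mU m).
  by apply: measurable_funM; [exact: toO (mV m)|exact: toO (mb m)].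
have Mi : 0 <= M%:R^-1 :> R by rewrite invr_ge0.
have -> : E (fun w => J k.+1 w * avg (fun m =>
     (sample_data (cf := cf) (N := N) (k := k) (YMs P W cf C0 xi I Ws Bs alpha k.+1 m w) (spath Ws Bs m w)
      - target (P := P) (W := W) (cf := cf) (bs := bs) (N := N) (al k.+1) (spath Ws Bs m w)) ^+ 2)) =
  (M%:R^-1%:E * \sum_(m < M) E (fun w => (U m w + V m w * b' m w) ^+ 2))%E.
  rewrite -mean_sum//; last by move=> m w; exact: sqr_ge0.
  rewrite -meanZ//; [|exact: measurable_sum|by move=> w; apply: sumr_ge0 => m _; exact: sqr_ge0].
  apply: eq_integral => w _; congr EFin; rewrite /avg mulrCA mulr_sumr; congr (_ * _).
  apply: eq_bigr => m _; rewrite /U /V.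
  have [g1 g0] := good01 k.+1 w.
  have [gw|/g0 ->] := pselect (good_event k.+1 w); last by rewrite !mul0r addr0 expr0n.
  rewrite (g1 gw) !mul1r; congr (_ ^+ 2).
  have [aE _] := abE w gw.
  have yE : YMs P W cf C0 xi I Ws Bs alpha k.+1 m w = y m w by rewrite /YMs aE.
  rewrite yE -[LHS]/(y m w + b' m w * g (Xm m w) (y m w) - (y0 m w + b' m w * g (Xm m w) (y0 m w))).
  ring.
have EUV m : (E (fun w => (U m w + V m w * b' m w) ^+ 2) <= (1 + Lg * h)%:E * E (fun w => U m w ^+ 2))%E.
  have [sB [m1 m2]] := increment_moments H (e m).
  rewrite (independent_second_moment (sb _) (sb _) (ind m) (mU m) (mV m) (mb m) (s := h)).
  - have Lgh : 0 <= Lg * h by rewrite mulr_ge0// ltW.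
    rewrite EFinD ge0_muleDl ?mul1e ?lee_fin ?Lgh//.
    apply: leeD => //; rewrite (_ : (Lg * h)%:E = (h%:E * Lg%:E)%E); last by rewrite -EFinM mulrC.
    rewrite -muleA.
    apply: lee_wpmul2l; first by rewrite lee_fin ltW.
    rewrite -meanZ//.
    + apply: mean_le.
      * by apply: measurable_funX; exact: toO (mV m).
      * by apply: measurable_funM => //; apply: measurable_funX; exact: toO (mU m).
      * by move=> w; exact: sqr_ge0.
      * move=> w; rewrite /U /V !exprMn [leRHS]mulrCA ler_wpM2l ?sqr_ge0//.
        have := hg (Xm m w) (y m w) (Xm m w) (y0 m w).
        by rewrite subrr normr0 expr0n add0r !real_normK ?num_real.
    + by apply: measurable_funX; exact: toO (mU m).
    + by move=> w; exact: sqr_ge0.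
  - exact: sqint_integrable sB.
  - by rewrite -(EFin_Rintegral (sqint_integrable sB)) m1.
  - by rewrite -(EFin_Rintegral sB.2) m2.
have dal0 w : 0 <= dot (dal k.+1 w) (dal k.+1 w) by exact: dot_ge0.
have mdd : measurable_fun setT (fun w => dot (dal k.+1 w) (dal k.+1 w)) by apply: measurable_dot; exact: mdal.
have EU : (M%:R^-1%:E * \sum_(m < M) E (fun w => U m w ^+ 2) <= (1 + h)%:E * position_error k.+1)%E.
  rewrite /position_error -meanZ; first last.
  - by move=> w; rewrite mulr_ge0// good_ge0.
  - by apply: measurable_funM => //; exact: mJ.
  - by rewrite addr_ge0// ltW.
  rewrite -mean_sum; first last.
  - by move=> m w; exact: sqr_ge0.
  - by move=> m; apply: measurable_funX; exact: toO (mU m).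
  have ms : measurable_fun setT (fun w => \sum_(m < M) U m w ^+ 2).
    by apply: measurable_sum => m; apply: measurable_funX; exact: toO (mU m).
  rewrite -meanZ//; last by move=> w; apply: sumr_ge0 => m _; exact: sqr_ge0.
  apply: mean_le.
  - exact: measurable_funM.
  - by apply: measurable_funM => //; apply: measurable_funM => //; exact: mJ.
  - by move=> w; rewrite mulr_ge0//; apply: sumr_ge0 => m _; exact: sqr_ge0.
  move=> w; have [g1 g0] := good01 k.+1 w.
  have [gw|gw] := pselect (good_event k.+1 w); last first.
    rewrite (g0 gw) mul0r mulr0 big1 ?mulr0// => m _.
    by rewrite /U (g0 gw) mul0r expr0n.
  rewrite (g1 gw) mul1r; have [aE _] := abE w gw.
  apply: (@le_trans _ _ (dot (dal k.+1 w) (gram (fun m => ps k.+1 m w) *m dal k.+1 w))).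
    rewrite gram_quad; apply: avg_le => m; rewrite /U (g1 gw) mul1r.
    rewrite -(real_normK (num_real (y m w - y0 m w))) -[leRHS]real_normK ?num_real//.
    rewrite ler_sqr ?nnegrE// dotBl aE.
    have rho0 : 0 < rho P W cf bs N C0 k.+1 (spath Ws Bs m w).
      by rewrite /rho lt_max ltr01 orbT.
    have y0E : truncate xi (rho P W cf bs N C0 k.+1 (spath Ws Bs m w)) (y0 m w) = y0 m w.
      apply: (truncate_id hxi) => //; rewrite /rho le_max; apply/orP; left.
      rewrite (le_trans (dot_CS_abs _ _))// mulrC ler_wpM2l ?enorm_ge0//.
      by apply: ler_wsqrtr; exact: (coord_al HC kN).
    by rewrite -{1}y0E; exact: truncate_lipschitz.
  have [kN1|] := ltnP k.+1 N.
    by rewrite (good_event_step kN1) in gw; exact: (good_basis_quad _ gw.1).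
  move=> Nk; have kE : k.+1 = N by apply/eqP; rewrite eqn_leq kN.
  have d0' j : j = N -> dal j w = 0 by move=> ->; rewrite last_coefficients subrr.
  have d0 := d0' _ kE.
  by rewrite d0 dot0l dot0l mulr0.
apply: (@le_trans _ _ (M%:R^-1%:E * \sum_(m < M) ((1 + Lg * h)%:E * E (fun w => U m w ^+ 2)))%E).
  by apply: lee_wpmul2l; rewrite ?lee_fin//; apply: lee_sum => m _.
have EU0 m : (0 <= E (fun w => U m w ^+ 2))%E by apply: mean_ge0 => w; exact: sqr_ge0.
rewrite -ge0_sume_distrr// muleCA EFinM -muleA; apply: lee_wpmul2l => //.
by rewrite lee_fin addr_ge0// mulr_ge0// ltW.
Qed.

Definition recursion_growth : R :=
  2 * ((1 + 2 * step_const Lf I) + Lg + (1 + 2 * step_const Lf I) * Lg) + 1.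
Definition recursion_noise : R := 2 * step_const Lf I * error_const (cf := cf) Lf Lg C0.
Definition recursion_bias : R := 4 * step_const Lf I * C0 + 2 * Lf ^+ I * C0.

Let s0 : 0 <= step_const Lf I := step_const_ge0 I Lf0.

(** Splitting |alpha - al|^2 with weights h and h^-1 loses a factor 1/h, but
    stopping the Picard iterations of the exact scheme only costs h^(2 I). *)
Lemma picard_bias k : (k < N)%N ->
  (1 + h^-1) * dot (ai k - al k) (ai k - al k) <= 2 * Lf ^+ I * C0 * h ^+ (I - 1).
Proof.
move=> kN; have hp := h0; have hi : 0 < h^-1 by rewrite invr_gt0.
have h1' : h <= 1 by have := h1; lra.
rewrite -opprB dotNl dotNr opprK.
have D := coord_contraction HC kN; have A := coord_ai HC kN.
have Lp : 0 <= Lf ^+ I by rewrite exprn_ge0// Lf0.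
have hpow n : 0 <= h ^+ n by rewrite exprn_ge0// ltW.
have D' : dot (al k - ai k) (al k - ai k) <= (h ^+ I * h ^+ I) * (Lf ^+ I * C0).
  apply: (le_trans D); rewrite exprMn -exprM mulnC exprM expr2 -[leLHS]mulrA.
  by rewrite ler_wpM2l ?mulr_ge0// ler_wpM2l.
have e1 : 1 + h^-1 <= 2 * h^-1.
  by rewrite mulrDl mul1r lerD2r -[leLHS]invr1 lef_pV2 ?posrE.
apply: (@le_trans _ _ (2 * h^-1 * ((h ^+ I * h ^+ I) * (Lf ^+ I * C0)))).
  by apply: ler_pM => //; rewrite ?dot_ge0// addr_ge0// ltW.
have hI : h ^+ I = h * h ^+ (I - 1) by rewrite -exprS subn1 prednK.
rewrite {1}hI.
have -> : 2 * h^-1 * (h * h ^+ (I - 1) * h ^+ I * (Lf ^+ I * C0)) =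
   (2 * Lf ^+ I * C0 * h ^+ (I - 1)) * h ^+ I by field; rewrite gt_eqF.
have hI1 : h ^+ I <= 1 by rewrite exprn_ile1// ltW.
by rewrite ler_piMr// !mulr_ge0// C00.
Qed.

(** [regression_step] on the good event, where the data error is taken from the
    larger good event of step k+1 and the defect from the whole space. *)
Lemma regression_recursion k : (k < N)%N ->
  (position_error k + (2^-1)%:E * slope_error k <=
   (1 + recursion_growth * h)%:E * position_error k.+1
   + (recursion_noise / (h * M%:R))%:E * eps P W B cf bs N C0 k
   + (recursion_bias * h ^+ (I - 1))%:E)%E.
Proof.
move=> kN.
pose s := step_const Lf I; have sp : 0 <= s := s0; have hp := h0; have hle := h12; have hw := ltW hp.
have hl1 : h <= 1 := ltW h1.
have C0p := C00; have Lgp := Lg0.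
pose A w := avg (fun m =>
   (sample_data (cf := cf) (N := N) (k := k) (YMs P W cf C0 xi I Ws Bs alpha k.+1 m w) (spath Ws Bs m w)
    - target (P := P) (W := W) (cf := cf) (bs := bs) (N := N) (al k.+1) (spath Ws Bs m w)) ^+ 2).
pose df w := defect (P := P) (W := W) (cf := cf) (bs := bs) (N := N) (Ws := Ws) (Bs := Bs) (al k.+1) (ai k) (be k) w.
pose G1 := 1 + (1 + 2 * s) * h.
have A0 w : 0 <= A w by apply: avg_ge0 => m; exact: sqr_ge0.
have hI0 : 0 <= h ^+ (I - 1) by rewrite exprn_ge0//.
have bias0 : 0 <= recursion_bias * h ^+ (I - 1).
  rewrite mulr_ge0// /recursion_bias addr_ge0// !mulr_ge0// ?s0//.
  by rewrite exprn_ge0// Lf0.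
have G10 : 0 <= G1 by rewrite addr_ge0// mulr_ge0 //; lra.
have sh0 : 0 <= 2 * s / h by rewrite divr_ge0// mulr_ge0.
have pointwise w : J k w * dot (dal k w) (dal k w) + 2^-1 * (J k w * (h * dot (dbe k w) (dbe k w))) <=
    G1 * (J k.+1 w * A w) + 2 * s / h * dot (df w) (df w) + recursion_bias * h ^+ (I - 1).
  have [gw|gw] := pselect (good_event k w); last first.
    rewrite (good01 k w).2// !mul0r mulr0 addr0.
    have t1 : 0 <= G1 * (J k.+1 w * A w).
      by apply: mulr_ge0 => //; apply: mulr_ge0 => //; exact: good_ge0.
    have t2 : 0 <= 2 * s / h * dot (df w) (df w) by apply: mulr_ge0 => //; exact: dot_ge0.
    by apply: addr_ge0 => //; exact: addr_ge0.
  rewrite (good01 k w).1// !mul1r.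
  rewrite (good_event_step kN) in gw; have [gk gk1] := gw.
  rewrite (good01 k.+1 w).1// mul1r.
  have S1 := sample_regression_step H hf reg I2 hL kN (al k.+1) (ai k) (be k) gk.
  rewrite -/(A w) -/(df w) -/s in S1.
  have S2 := dot_eps (alpha k I w - ai k) (ai k - al k) hp.
  rewrite addrA subrK in S2.
  have S3 := picard_bias kN.
  have S4 : dot (ai k) (ai k) + h * dot (be k) (be k) <= 2 * C0.
    by have := coord_ai HC kN; have := coord_be HC kN; lra.
  have B0 : 0 <= h * dot (dbe k w) (dbe k w) by rewrite mulr_ge0 ?dot_ge0.
  exact: (recursion_arith hw hl1 sp hI0 B0 (dot_ge0 (df w)) (A0 w) C0p S1 S2 S3 S4).
have mdd : measurable_fun setT (fun w => J k w * dot (dal k w) (dal k w)).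
  by apply: measurable_funM; [exact: mJ (ltnW kN)|apply: measurable_dot; exact: mdal (ltnW kN)].
have mbb : measurable_fun setT (fun w => J k w * (h * dot (dbe k w) (dbe k w))).
  apply: measurable_funM; first exact: mJ (ltnW kN).
  by apply: measurable_funM => //; apply: measurable_dot; exact: mdbe (ltnW kN).
have malpha : mx_measurable (fun w => alpha k.+1 I w).
  move=> i j; rewrite (ord1 j); have [mab _ _] := reg.
  by have [] := mab k.+1 I i kN (leqnn I).
have mpath (F : path2 (R := R) -> R) m :
    measurable_fun (setT : set (inc_path cf (setT : set (bool * 'I_N)))) F ->
    measurable_fun setT (fun w => F (spath Ws Bs m w)).
  by move=> mF; exact: (measurable_path_fun H (Some m) mF).
have mXm m : measurable_fun setT (fun w => XN cf N k.+1 (spath Ws Bs m w)).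
  by apply: mpath; exact: (measurable_XN (setting_drift H) (setting_diffusion H) kN).
have mBm m : measurable_fun setT (fun w => dB cf N k (spath Ws Bs m w)).
  by apply: mpath; apply: (measurable_dB (jN := kN)).
have mYm m : measurable_fun setT (YMs P W cf C0 xi I Ws Bs alpha k.+1 m).
  have mr : measurable_fun setT (fun w => rho P W cf bs N C0 k.+1 (spath Ws Bs m w)).
    apply: measurable_maxr => //; apply: measurable_funM => //.
    by apply: measurable_enorm; exact: mps.
  apply: measurable_funM => //; apply: (measurableT_comp (measurable_truncation hxi)).
  apply: measurable_funM; last exact: measurable_invr.
  by apply: measurable_dot => //; exact: mps.
have mA : measurable_fun setT A.
  apply: measurable_funM => //; apply: measurable_sum => m; apply: measurable_funX.
  have mym : measurable_fun setT (fun w => dot (al k.+1) (ps k.+1 m w)).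
    by apply: measurable_dot; [exact: mx_measurable_cst|exact: mps].
  apply: measurable_funB.
    apply: measurable_funD => //; apply: measurable_funM => //.
    exact: (measurable_bdriver hg).
  apply: measurable_funD => //; apply: measurable_funM => //.
  exact: (measurable_bdriver hg).
have mJA : measurable_fun setT (fun w => J k.+1 w * A w) by apply: measurable_funM => //; exact: mJ.
have mdf : measurable_fun setT (fun w => dot (df w) (df w)).
  have mdfx : mx_measurable df.
    apply: mx_measurableZ => //; apply: mx_measurable_sum => m; apply: mx_measurableZ.
      by apply: mpath; exact: (measurable_residual H hf hg kN).
    move=> i j; rewrite (ord1 j); apply: (mpath (fun q => vvec P W cf bs N k q i 0)).
    exact: (measurable_vvec_all H kN).
  exact: measurable_dot.
have J0 j w : 0 <= J j w := good_ge0 j w.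
have x0 w : 0 <= J k w * dot (dal k w) (dal k w) by rewrite mulr_ge0 ?dot_ge0.
have y0 w : 0 <= J k w * (h * dot (dbe k w) (dbe k w)).
  by rewrite mulr_ge0// mulr_ge0 ?dot_ge0//.
have z0 w : 0 <= dot (df w) (df w) by exact: dot_ge0.
have JA0 w : 0 <= J k.+1 w * A w by rewrite mulr_ge0.
have half0 : 0 <= 2^-1 :> R by rewrite invr_ge0.
have -> : (position_error k + (2^-1)%:E * slope_error k =
  E (fun w => J k w * dot (dal k w) (dal k w) + 2^-1 * (J k w * (h * dot (dbe k w) (dbe k w)))))%E.
  rewrite meanD//; first by rewrite meanZ.
    exact: measurable_funM.
  by move=> w; rewrite mulr_ge0.
apply: (@le_trans _ _ (E (fun w => G1 * (J k.+1 w * A w) + 2 * s / h * dot (df w) (df w) + recursion_bias * h ^+ (I - 1)))).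
  apply: mean_le => //.
  - by apply: measurable_funD => //; exact: measurable_funM.
  - by apply: measurable_funD => //; apply: measurable_funD; exact: measurable_funM.
  - by move=> w; rewrite addr_ge0// mulr_ge0.
rewrite meanD//; first last.
- by move=> w; rewrite addr_ge0// mulr_ge0.
- by apply: measurable_funD; exact: measurable_funM.
rewrite mean_cst meanD; first last.
- by move=> w; rewrite mulr_ge0.
- by move=> w; rewrite mulr_ge0.
- exact: measurable_funM.
- exact: measurable_funM.
rewrite meanZ// meanZ//; apply: leeD => //; apply: leeD.
  apply: (@le_trans _ _ (G1%:E * (((1 + Lg * h) * (1 + h))%:E * position_error k.+1))%E).
    by apply: lee_wpmul2l => //; exact: propagated_error.
  rewrite muleA -EFinM; apply: lee_wpmul2r; first exact: position_error_ge0.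
  rewrite lee_fin /G1 /recursion_growth -/s; apply: growth_arith => //.
  by rewrite addr_ge0// mulr_ge0.
have DM := defect_mean H hf hg kN (coord_al HC kN) (coord_ai HC kN) (coord_be HC kN)
   (coord_target HC kN) (coord_theta HC kN) M0.
apply: (@le_trans _ _ ((2 * s / h)%:E * ((error_const (cf := cf) Lf Lg C0 / M%:R)%:E * eps P W B cf bs N C0 k))%E).
  by apply: lee_wpmul2l.
rewrite muleA -EFinM.
have -> : 2 * s / h * (error_const (cf := cf) Lf Lg C0 / M%:R) = recursion_noise / (h * M%:R).
  by rewrite /recursion_noise -/s; field; rewrite pnatr_eq0 -lt0n M0 gt_eqF.
by [].
Qed.

End recursion.

(** The sum of the y j is kept on the left because it will become the error on Z. *)
Lemma backward_gronwall {R : realType} N (x y e : nat -> \bar R) (K : R) : 0 <= K ->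
  (forall k, 0 <= x k)%E -> (forall k, 0 <= y k)%E -> (forall k, (k < N)%N -> 0 <= e k)%E -> (x N = 0)%E ->
  (forall k, (k < N)%N -> x k + (2^-1)%:E * y k <= (1 + K)%:E * x k.+1 + e k)%E ->
  forall k, (k <= N)%N ->
  (x k + (2^-1)%:E * \sum_(k <= j < N) y j <= ((1 + K) ^+ (N - k))%:E * \sum_(k <= j < N) e j)%E.
Proof.
move=> K0 x0 y0 e0 xN rec; apply: decreasing_ind => [|k kN IH].
  by rewrite xN !big_geq// !mule0 adde0.
have K1 : 1 <= 1 + K by rewrite lerDl.
have Kp : 0 <= 1 + K by exact: le_trans K1.
have half : 0 <= 2^-1 :> R by rewrite invr_ge0.
have sy0 : (0 <= \sum_(k.+1 <= j < N) y j)%E by exact: sume_ge0.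
have se0 : (0 <= \sum_(k.+1 <= j < N) e j)%E.
  by rewrite big_nat_cond; apply: sume_ge0 => j /andP[/andP[_ jN] _]; exact: e0.
rewrite !(big_ltn kN) (ge0_muleDr _ (y0 k) sy0) (ge0_muleDr _ (e0 k kN) se0) addeA.
have h2 : (0 <= (2^-1)%:E * \sum_(k.+1 <= j < N) y j)%E by rewrite mule_ge0.
apply: (@le_trans _ _ ((1 + K)%:E * x k.+1 + e k + (1 + K)%:E * ((2^-1)%:E * \sum_(k.+1 <= j < N) y j))%E).
  apply: leeD; first exact: rec.
  by rewrite -[leLHS]mul1e; apply: lee_wpmul2r => //; rewrite lee_fin.
rewrite [leLHS]addeAC -[in leLHS]ge0_muleDr// [leLHS]addeC; apply: leeD.
  rewrite -[leLHS]mul1e; apply: lee_wpmul2r; first exact: e0.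
  by rewrite lee_fin exprn_ege1.
apply: (@le_trans _ _ ((1 + K)%:E * (((1 + K) ^+ (N - k.+1))%:E * \sum_(k.+1 <= j < N) e j))%E).
  by apply: lee_wpmul2l => //; rewrite lee_fin.
by rewrite muleA -EFinM -exprS subnSK.
Qed.

Section truncation_error.
Context {R : realType} (xi : R -> R).
Hypothesis hxi : truncation_fun xi.

Lemma truncation_error r x y : 0 < r -> `|x| <= r ->
  `|x - truncate xi r y| ^+ 2 <= (x - y) ^+ 2.
Proof.
move=> r0 xr; rewrite -{1}(truncate_id hxi r0 xr) -(real_normK (num_real (x - y))).
by rewrite ler_sqr ?nnegrE//; exact: truncate_lipschitz.
Qed.

Lemma truncation_error_max r x y : 0 < r -> `|x| <= r ->
  `|x - truncate xi r y| ^+ 2 <= 9 * r ^+ 2.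
Proof.
move=> r0 xr; have -> : 9 * r ^+ 2 = (3 * r) ^+ 2 by ring.
rewrite ler_sqr ?nnegrE ?mulr_ge0 ?(ltW r0)//.
rewrite (le_trans (ler_normB _ _))//; have := truncate_le hxi y r0; lra.
Qed.

End truncation_error.

(** * From the coefficients to the solution *)
Section comparison.
Context {R : realType} {d : measure_display} {Omega : measurableType d}.
Context {P : probability Omega R} {W B : R -> Omega -> R} {cf : coefs R}.
Context {bs : cell_basis R} {N M : nat} {Ws Bs : 'I_M -> R -> Omega -> R}.
Hypothesis H : regression_setting P W B cf bs N Ws Bs.
Variables (Lf Lg C0 : R) (xi : R -> R) (I : nat).
Variables (alpha beta : forall k, nat -> Omega -> 'cV[R]_(pdim bs N k)).
Local Notation f := (driver cf).
Local Notation g := (bdriver cf).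
Hypothesis hf : forall x y z x' y' z',
   `|f x y z - f x' y' z'| ^+ 2 <= Lf * (`|x - x'| ^+ 2 + `|y - y'| ^+ 2 + `|z - z'| ^+ 2).
Hypothesis hg : forall x y x' y',
   `|g x y - g x' y'| ^+ 2 <= Lg * (`|x - x'| ^+ 2 + `|y - y'| ^+ 2).
Local Notation h := (mesh cf N).
Hypothesis hxi : truncation_fun xi.
Hypothesis reg : regression_scheme P W B cf C0 xi I Ws Bs alpha beta.
Variables (Y Z : nat -> Omega -> R) (al ai be : forall k, 'cV[R]_(pdim bs N k)).
Hypothesis HC : picard_coordinates P W B cf Lf C0 I Y Z al ai be.
Hypothesis I0 : (0 < I)%N.
Hypothesis h1 : h < 1.
Local Notation E F := (\int[P]_w (F w)%:E)%E.
Local Notation blk U := (block (W := W) (B := B) (cf := cf) (N := N) (Ws := Ws) (Bs := Bs) U).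
Local Notation tail k := (g_sigma_algebraType (blk (sample_block k))).
Local Notation good_event k := (good_event P W cf bs N Ws Bs k).
Local Notation p k w := (pvec P W cf bs N k (bpath W B w)).
Local Notation J k w := (\1_(good_event k) w : R).
Local Notation dal k w := (alpha k I w - al k).
Local Notation dbe k w := (beta k I w - be k).
Local Notation rhow k := (rhoW P W B cf bs N C0 k).
Local Notation pos_err := (position_error (P := P) (W := W) (cf := cf) (bs := bs) (N := N) (Ws := Ws) (Bs := Bs) I alpha al).
Local Notation slo_err := (slope_error (P := P) (W := W) (cf := cf) (bs := bs) (N := N) (Ws := Ws) (Bs := Bs) I beta be).
Local Notation YMk := (YM P W B cf C0 xi I alpha).
Local Notation ZMk := (ZM P W B cf C0 xi I beta).

(** The new path is independent of the samples, so it can be integrated out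
    with the regression coefficients frozen. *)
Lemma frozen_second_moment k (U : Omega -> 'cV[R]_(pdim bs N k)) : (k <= N)%N ->
  mx_measurable (T := tail k) U ->
  E (fun w => dot (U w) (p k w) ^+ 2) = E (fun w => dot (U w) (U w)).
Proof.
move=> kN mU.
pose V : set (option 'I_M * (bool * 'I_N)) := [set e : option 'I_M * (bool * 'I_N) | ~~ e.1].
have sb X : <<s blk X >> `<=` measurable by exact: (block_sub H).
have ind : independent2 P <<s blk (sample_block k) >> <<s blk V >>.
  by apply: (block_independent H) => e [e1 _]; rewrite /V /= e1.
have mp : mx_measurable (T := g_sigma_algebraType (blk V)) (fun w => p k w).
  move=> i j; rewrite (ord1 j).
  apply: (block_path (S := before_after k) (o := None) (F := fun q => pvec P W cf bs N k q i 0)) => //.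
  exact: (measurable_pvec P W (setting_wf H) (setting_drift H) (setting_diffusion H)).
rewrite (freezing (sb _) (sb _) ind (F := fun w w' => (dot (U w) (p k w') ^+ 2)%:E)); first last.
- by move=> w w'; rewrite lee_fin sqr_ge0.
- apply/measurable_EFinP; apply: measurable_funX; apply: measurable_dot => i j.
    exact: (measurableT_comp (mU i j) (@measurable_fst _ _ _ _)).
  exact: (measurableT_comp (mp i j) (@measurable_snd _ _ _ _)).
apply: eq_integral => w _.
by rewrite (integral_dot_sqr (fun a => original_basis_sqint H a kN) (fun a b => original_basis_ortho H a b kN)).
Qed.

Let h0 := mesh_gt0 H.
Let mJ k : (k <= N)%N -> measurable_fun setT (fun w => J k w).
Proof.
move=> kN; have mJt : measurable_fun (setT : set (tail k)) (fun w => J k w).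
  exact: (measurable_indic (measurable_good_event H kN (leqnn k))).
by have mJ := measurable_block H mJt.
Qed.

Let mp k : (k <= N)%N -> mx_measurable (fun w => p k w).
Proof. by move=> kN i j; rewrite (ord1 j); exact: (original_basis_sqint H i kN).1. Qed.

Let mab k : (k <= N)%N -> mx_measurable (fun w => alpha k I w) /\ mx_measurable (fun w => beta k I w).
Proof.
move=> kN; have [mr _ _] := reg.
by split=> i j; rewrite (ord1 j); have [] := mr k I i kN (leqnn I).
Qed.

Let mtrunc k (u : Omega -> R) : (k <= N)%N -> measurable_fun setT u ->
  measurable_fun setT (fun w => truncate xi (rhow k w) (u w)).
Proof.
move=> kN mu; have mr := (rho_sqint H C0 kN).1.
apply: measurable_funM => //; apply: (measurableT_comp (measurable_truncation hxi)).
by apply: measurable_funM => //; exact: measurable_invr.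
Qed.

Lemma frozen_position_error k : (k <= N)%N ->
  E (fun w => J k w * dot (dal k w) (p k w) ^+ 2) = pos_err k.
Proof.
move=> kN; have [a [b [ma _ abE]]] := coefficients_measurable H hf hg hxi reg I0 h1 kN.
have mJt : measurable_fun (setT : set (tail k)) (fun w => J k w).
  exact: (measurable_indic (measurable_good_event H kN (leqnn k))).
have mU : mx_measurable (T := tail k) (fun w => J k w *: (a w - al k)).
  by apply: mx_measurableZ => //; apply: mx_measurableB => //; exact: mx_measurable_cst.
have JE w : J k w *: (a w - al k) = J k w *: dal k w.
  have [gw|gw] := pselect (good_event k w); first by rewrite (abE w gw).1.
  by rewrite (good01 _ _).2// !scale0r.
transitivity (E (fun w => dot (J k w *: (a w - al k)) (p k w) ^+ 2)).
  by apply: eq_integral => w _; rewrite JE dotZl exprMn good_sqr.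
rewrite frozen_second_moment//; apply: eq_integral => w _.
by rewrite JE dotZl dotZr mulrA -expr2 good_sqr.
Qed.

Lemma frozen_slope_error k : (k <= N)%N ->
  E (fun w => J k w * (h * dot (dbe k w) (p k w) ^+ 2)) = slo_err k.
Proof.
move=> kN; have [a [b [_ mb abE]]] := coefficients_measurable H hf hg hxi reg I0 h1 kN.
have mJt : measurable_fun (setT : set (tail k)) (fun w => J k w).
  exact: (measurable_indic (measurable_good_event H kN (leqnn k))).
have [_ s2] := mesh_sqrt H.
have mU : mx_measurable (T := tail k) (fun w => J k w *: (Num.sqrt h *: (b w - be k))).
  apply: mx_measurableZ => //; apply: mx_measurableZ => //.
  by apply: mx_measurableB => //; exact: mx_measurable_cst.
have JE w : J k w *: (Num.sqrt h *: (b w - be k)) = J k w *: (Num.sqrt h *: dbe k w).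
  have [gw|gw] := pselect (good_event k w); first by rewrite (abE w gw).2.
  by rewrite (good01 _ _).2// !scale0r.
transitivity (E (fun w => dot (J k w *: (Num.sqrt h *: (b w - be k))) (p k w) ^+ 2)).
  by apply: eq_integral => w _; rewrite JE !dotZl !exprMn good_sqr s2.
rewrite frozen_second_moment//; apply: eq_integral => w _.
rewrite JE !dotZl !dotZr; set D := dot _ _.
transitivity ((J k w ^+ 2 * (Num.sqrt h ^+ 2 * D))%:E); first by congr EFin; ring.
by rewrite good_sqr s2.
Qed.

Let rho_gt0 k w : 0 < rhow k w. Proof. exact: lt_le_trans ltr01 (rho_ge1 _ _ _). Qed.

Let in_ball k (c : 'cV[R]_(pdim bs N k)) w : dot c c <= C0 -> `|dot c (p k w)| <= rhow k w.
Proof.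
move=> cC; rewrite /rhoW /rho le_max; apply/orP; left.
rewrite (le_trans (dot_CS_abs _ _))// mulrC ler_wpM2l ?enorm_ge0//.
exact: ler_wsqrtr.
Qed.

Let Yball k w : (k <= N)%N -> `|dot (al k) (p k w)| <= rhow k w.
Proof. by move=> kN; apply: in_ball; exact: (coord_al HC kN). Qed.

Let Zball k w : (k < N)%N -> `|Num.sqrt h * dot (be k) (p k w)| <= rhow k w.
Proof.
move=> kN; rewrite -dotZl; apply: in_ball.
by rewrite dotZl dotZr mulrA -expr2 (mesh_sqrt H).2; exact: (coord_be HC kN).
Qed.

Let bad k w : \1_(~` good_event k) w = 1 - J k w.
Proof. by rewrite !indicE in_setC; case: (_ \in _); rewrite ?subrr ?subr0. Qed.

Let mbadk k : (k <= N)%N -> measurable_fun setT (\1_(~` good_event k) : Omega -> R).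
Proof.
move=> kN; rewrite (_ : (\1_(~` good_event k) : Omega -> R) = (fun w => 1 - J k w)).
  by apply: measurable_funB => //; exact: mJ.
by apply/funext => w; exact: bad.
Qed.

Let bad_ge0 k w : 0 <= \1_(~` good_event k) w :> R.
Proof. by rewrite indicE ler0n. Qed.

(** On the good event the truncation can only bring the approximation closer to
    Y_k, which lies in the ball of radius rho; elsewhere both are bounded. *)
Lemma position_comparison k : (k <= N)%N ->
  ('E_P[(fun w => `|Y k w - YMk k w| ^+ 2)%R] <=
   pos_err k + 9%:E * 'E_P[(fun w => `|rhow k w| ^+ 2 * \1_(~` good_event k) w)%R])%E.
Proof.
move=> kN; rewrite !unlock; have [mY YE] := coord_Y HC kN; have [ma _] := mab kN.
have mYM : measurable_fun setT (YMk k) by apply: mtrunc => //; exact: measurable_dot _ (mp kN).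
have mr := (rho_sqint H C0 kN).1.
have mbad : measurable_fun setT (fun w => `|rhow k w| ^+ 2 * \1_(~` good_event k) w).
  apply: measurable_funM; first by apply: measurable_funX; exact: measurableT_comp.
  exact: mbadk.
have mgood : measurable_fun setT (fun w => J k w * dot (dal k w) (p k w) ^+ 2).
  apply: measurable_funM; first exact: mJ.
  apply: measurable_funX; apply: measurable_dot; last exact: mp.
  by apply: mx_measurableB => //; exact: mx_measurable_cst.
have g0 w : 0 <= J k w * dot (dal k w) (p k w) ^+ 2 by rewrite mulr_ge0 ?sqr_ge0// good_ge0.
have b0 w : 0 <= `|rhow k w| ^+ 2 * \1_(~` good_event k) w by rewrite mulr_ge0// sqr_ge0.
have m9 : measurable_fun setT (fun w => 9 * (`|rhow k w| ^+ 2 * \1_(~` good_event k) w)).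
  exact: measurable_funM.
have b90 w : 0 <= 9 * (`|rhow k w| ^+ 2 * \1_(~` good_event k) w) by rewrite mulr_ge0.
rewrite -frozen_position_error// -meanZ// -meanD//.
apply: ae_ge0_le_integral => //.
- apply/measurable_EFinP; apply: measurable_funX; apply: measurableT_comp => //.
  exact: measurable_funB.
- by move=> w _; rewrite lee_fin addr_ge0// mulr_ge0.
- by apply/measurable_EFinP; apply: measurable_funD => //; exact: measurable_funM.
apply: filterS YE => w /= e _; rewrite e// lee_fin bad.
rewrite [`|rhow k w| ^+ 2]real_normK ?num_real//.
have [gw|gw] := pselect (good_event k w).
  rewrite (good01 _ _).1// subrr !mulr0 addr0 mul1r.
  rewrite (le_trans (truncation_error hxi _ (rho_gt0 k w) (Yball w kN)))//.
  by rewrite dotBl -sqrrN opprB.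
rewrite (good01 _ _).2// subr0 mul0r add0r mulr1.
exact: (truncation_error_max hxi _ (rho_gt0 k w) (Yball w kN)).
Qed.

Lemma slope_comparison k j : (k <= j)%N -> (j < N)%N ->
  (h%:E * 'E_P[(fun w => `|Z j w - ZMk j w| ^+ 2)%R] <=
   slo_err j + 9%:E * 'E_P[(fun w => `|rhow j w| ^+ 2 * \1_(~` good_event k) w)%R])%E.
Proof.
move=> kj jN; rewrite !unlock; have [mZ ZE] := coord_Z HC jN; have [_ mb] := mab (ltnW jN).
have [sn0 s2] := mesh_sqrt H.
have mZM : measurable_fun setT (ZMk j).
  apply: measurable_funM => //; apply: mtrunc; first exact: ltnW.
  by apply: measurable_funM => //; exact: measurable_dot _ (mp (ltnW jN)).
have mr := (rho_sqint H C0 (ltnW jN)).1.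
have mbad i : (i <= N)%N -> measurable_fun setT (fun w => `|rhow j w| ^+ 2 * \1_(~` good_event i) w).
  move=> iN; apply: measurable_funM; first by apply: measurable_funX; exact: measurableT_comp.
  exact: mbadk.
have mgood : measurable_fun setT (fun w => J j w * (h * dot (dbe j w) (p j w) ^+ 2)).
  apply: measurable_funM; first exact: mJ (ltnW jN).
  apply: measurable_funM => //; apply: measurable_funX; apply: measurable_dot; last exact: mp (ltnW jN).
  by apply: mx_measurableB => //; exact: mx_measurable_cst.
have hw := ltW h0.
have g0 w : 0 <= J j w * (h * dot (dbe j w) (p j w) ^+ 2).
  by apply: mulr_ge0; [exact: good_ge0|apply: mulr_ge0 => //; exact: sqr_ge0].
have b0 i w : 0 <= `|rhow j w| ^+ 2 * \1_(~` good_event i) w by rewrite mulr_ge0// sqr_ge0.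
have mD : measurable_fun setT (fun w => `|Z j w - ZMk j w| ^+ 2).
  by apply: measurable_funX; apply: measurableT_comp => //; exact: measurable_funB.
have kN : (k <= N)%N := leq_trans kj (ltnW jN).
rewrite -(frozen_slope_error (ltnW jN)) -meanZ//.
rewrite -meanZ//; last exact: mbad.
have m9 : measurable_fun setT (fun w => 9 * (`|rhow j w| ^+ 2 * \1_(~` good_event k) w)).
  by apply: measurable_funM => //; exact: mbad.
have b90 w : 0 <= 9 * (`|rhow j w| ^+ 2 * \1_(~` good_event k) w) by rewrite mulr_ge0.
rewrite -meanD//.
apply: ae_ge0_le_integral => //.
- by move=> w _; rewrite lee_fin mulr_ge0// sqr_ge0.
- by apply/measurable_EFinP; exact: measurable_funM.
- by move=> w _; rewrite lee_fin addr_ge0// mulr_ge0.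
- by apply/measurable_EFinP; exact: measurable_funD.
apply: filterS ZE => w /= e _; rewrite e// lee_fin bad.
pose x := Num.sqrt h * dot (be j) (p j w).
pose y := Num.sqrt h * dot (beta j I w) (p j w).
have -> : h * `|dot (be j) (p j w) - ZMk j w| ^+ 2 = `|x - truncate xi (rhow j w) y| ^+ 2.
  rewrite /ZM -/y -[zeta _ _ _ _ _ _ _ _]/(rhow j w) !real_normK ?num_real// /x -{1}s2.
  by rewrite -exprMn mulrBr [Num.sqrt h * (_ / _)]mulrCA divff// mulr1.
have xy : (x - y) ^+ 2 = h * dot (dbe j w) (p j w) ^+ 2.
  by rewrite /x /y -mulrBr -dotBl exprMn s2 -(opprB (be j)) dotNl sqrrN.
rewrite [`|rhow j w| ^+ 2]real_normK ?num_real//.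
have r20 : 0 <= 9 * (rhow j w ^+ 2 * (1 - J k w)).
  by apply: mulr_ge0 => //; apply: mulr_ge0; [exact: sqr_ge0|rewrite -bad; exact: bad_ge0].
have [gw|gw] := pselect (good_event j w).
  rewrite (good01 j w).1// mul1r -xy.
  rewrite (le_trans (truncation_error hxi _ (rho_gt0 j w) (Zball w jN)))//.
  by rewrite lerDl.
have gk : ~ good_event k w.
  by move=> gk; apply: gw => i /= /andP[ji iN]; apply: gk => /=; rewrite iN (leq_trans kj).
rewrite (good01 j w).2// (good01 k w).2// subr0 mul0r add0r mulr1.
exact: (truncation_error_max hxi _ (rho_gt0 j w) (Zball w jN)).
Qed.

Lemma bad_event_mean k j : (k <= N)%N -> (j <= N)%N ->
  ('E_P[(fun w => (`|zetaW P W B cf bs N C0 j w| ^+ 2 + `|rhow j w| ^+ 2) * \1_(~` good_event k) w)%R] =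
   'E_P[(fun w => `|rhow j w| ^+ 2 * \1_(~` good_event k) w)%R]
   + 'E_P[(fun w => `|rhow j w| ^+ 2 * \1_(~` good_event k) w)%R])%E.
Proof.
move=> kN jN; rewrite !unlock; have mr := (rho_sqint H C0 jN).1.
have mbad : measurable_fun setT (fun w => `|rhow j w| ^+ 2 * \1_(~` good_event k) w).
  apply: measurable_funM; first by apply: measurable_funX; exact: measurableT_comp.
  exact: mbadk.
have b0 w : 0 <= `|rhow j w| ^+ 2 * \1_(~` good_event k) w by rewrite mulr_ge0// sqr_ge0.
rewrite -meanD//; apply: eq_integral => w _.
by rewrite -[zetaW _ _ _ _ _ _ _ _ _]/(rhow j w) mulrDl.
Qed.

(** This and [slope_truncation] settle the case I = 1, where no smallness in h
    is claimed for the bias. *)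
Lemma position_truncation k : (k <= N)%N ->
  ('E_P[(fun w => `|Y k w - YMk k w| ^+ 2)%R] <= 9%:E * 'E_P[(fun w => `|rhow k w| ^+ 2)%R])%E.
Proof.
move=> kN; rewrite !unlock; have [mY YE] := coord_Y HC kN; have [ma _] := mab kN.
have mYM : measurable_fun setT (YMk k) by apply: mtrunc => //; exact: measurable_dot _ (mp kN).
have mr : measurable_fun setT (fun w => `|rhow k w| ^+ 2).
  by apply: measurable_funX; apply: measurableT_comp => //; exact: (rho_sqint H C0 kN).1.
rewrite -meanZ//.
apply: ae_ge0_le_integral => //.
- apply/measurable_EFinP; apply: measurable_funX; apply: measurableT_comp => //.
  exact: measurable_funB.
- by apply/measurable_EFinP; exact: measurable_funM.
apply: filterS YE => w /= e _; rewrite e// lee_fin [`|rhow k w| ^+ 2]real_normK ?num_real//.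
exact: (truncation_error_max hxi _ (rho_gt0 k w) (Yball w kN)).
Qed.

Lemma slope_truncation j : (j < N)%N ->
  (h%:E * 'E_P[(fun w => `|Z j w - ZMk j w| ^+ 2)%R] <= 9%:E * 'E_P[(fun w => `|rhow j w| ^+ 2)%R])%E.
Proof.
move=> jN; rewrite !unlock; have [mZ ZE] := coord_Z HC jN; have [_ mb] := mab (ltnW jN).
have [sn0 s2] := mesh_sqrt H; have hw := ltW h0.
have mZM : measurable_fun setT (ZMk j).
  apply: measurable_funM => //; apply: mtrunc; first exact: ltnW.
  by apply: measurable_funM => //; exact: measurable_dot _ (mp (ltnW jN)).
have mr : measurable_fun setT (fun w => `|rhow j w| ^+ 2).
  by apply: measurable_funX; apply: measurableT_comp => //; exact: (rho_sqint H C0 (ltnW jN)).1.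
have mD : measurable_fun setT (fun w => `|Z j w - ZMk j w| ^+ 2).
  by apply: measurable_funX; apply: measurableT_comp => //; exact: measurable_funB.
rewrite -meanZ//.
rewrite -meanZ//.
apply: ae_ge0_le_integral => //.
- by move=> w _; rewrite lee_fin mulr_ge0// sqr_ge0.
- by apply/measurable_EFinP; exact: measurable_funM.
- by apply/measurable_EFinP; exact: measurable_funM.
apply: filterS ZE => w /= e _; rewrite e// lee_fin.
pose x := Num.sqrt h * dot (be j) (p j w).
pose y := Num.sqrt h * dot (beta j I w) (p j w).
have -> : h * `|dot (be j) (p j w) - ZMk j w| ^+ 2 = `|x - truncate xi (rhow j w) y| ^+ 2.
  rewrite /ZM -/y -[zeta _ _ _ _ _ _ _ _]/(rhow j w) !real_normK ?num_real// /x -{1}s2.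
  by rewrite -exprMn mulrBr [Num.sqrt h * (_ / _)]mulrCA divff// mulr1.
rewrite [`|rhow j w| ^+ 2]real_normK ?num_real//.
exact: (truncation_error_max hxi _ (rho_gt0 j w) (Zball w jN)).
Qed.

End comparison.

(** * Assembling the error bound *)
(** Pure bookkeeping, stated for abstract sequences: x and y are the errors of the
    coefficients, r the contribution of the bad event, e the statistical error
    and D >= 1 the sequence that multiplies the bias. *)
Lemma final_combination {R : realType} N k (A x : \bar R) (y r b e D : nat -> \bar R)
    (h G c1 q C1 C2 : R) : (k < N)%N ->
  0 <= h -> 0 <= c1 -> 0 <= q -> 0 <= G -> (0 <= x)%E ->
  (forall j, (j < N)%N -> 0 <= y j)%E -> (forall j, 0 <= r j)%E -> (forall j, 0 <= b j)%E ->
  (forall j, (j < N)%N -> 0 <= e j)%E -> (forall j, (j < N)%N -> 1 <= D j)%E ->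
  (A <= x + 9%:E * r k)%E ->
  (forall j, (k <= j < N)%N -> h%:E * b j <= y j + 9%:E * r j)%E ->
  (x + (2^-1)%:E * \sum_(k <= j < N) y j <= G%:E * \sum_(k <= j < N) (c1%:E * e j + q%:E))%E ->
  2 * G * c1 <= C1 -> 2 * G * q <= C2 ->
  (A + h%:E * \sum_(k <= j < N) b j <=
   16%:E * \sum_(k <= j < N) (r j + r j) + C2%:E * \sum_(k <= j < N) D j + C1%:E * \sum_(k <= j < N) e j)%E.
Proof.
move=> kN h0 c10 q0 G0 x0 y0 r0 b0 e0 D1 Ax by_ xy C1G C2G.
pose Sy := (\sum_(k <= j < N) y j)%E; pose Sr := (\sum_(k <= j < N) r j)%E.
pose Se := (\sum_(k <= j < N) e j)%E; pose SD := (\sum_(k <= j < N) D j)%E.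
have Sy0 : (0 <= Sy)%E.
  by rewrite /Sy big_nat_cond; apply: sume_ge0 => j /andP[/andP[_ jN] _]; exact: y0.
have Sr0 : (0 <= Sr)%E by exact: sume_ge0.
have Se0 : (0 <= Se)%E.
  by rewrite /Se big_nat_cond; apply: sume_ge0 => j /andP[/andP[_ jN] _]; exact: e0.
have rk : (r k <= Sr)%E.
  by rewrite /Sr big_ltn// -[leLHS]adde0; apply: leeD => //; exact: sume_ge0.
have Srr : (\sum_(k <= j < N) (r j + r j) = 2%:E * Sr)%E.
  by rewrite big_split /= -/Sr (_ : 2%:E = 1 + 1)%E ?ge0_muleDl ?mul1e// -EFinD.
have hb : (h%:E * \sum_(k <= j < N) b j <= Sy + 9%:E * Sr)%E.
  rewrite ge0_sume_distrr// /Sr ge0_sume_distrr// /Sy -big_split /=.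
  by rewrite big_nat_cond [leRHS]big_nat_cond; apply: lee_sum => j /andP[kj _]; exact: by_.
have sumq : (\sum_(k <= j < N) (c1%:E * e j + q%:E) <= c1%:E * Se + q%:E * SD)%E.
  have D0 j : (k <= j < N)%N -> (0 <= D j)%E by move=> /andP[_ jN]; exact: le_trans (D1 j jN).
  rewrite big_split /=; apply: leeD.
    rewrite /Se big_nat_cond [X in (_ <= _ * X)%E]big_nat_cond ge0_sume_distrr// => j /andP[/andP[_ jN] _].
    exact: e0.
  rewrite /SD big_nat_cond [X in (_ <= _ * X)%E]big_nat_cond ge0_sume_distrr; last first.
    by move=> j /andP[kj _]; exact: D0.
  apply: lee_sum => j /andP[/andP[_ jN] _].
  by rewrite -[leLHS]mule1; apply: lee_wpmul2l; rewrite ?lee_fin//; exact: D1.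
have SD0 : (0 <= SD)%E.
  by rewrite /SD big_nat_cond; apply: sume_ge0 => j /andP[/andP[_ jN] _]; exact: le_trans (D1 j jN).
have xySy : (x + Sy <= (2 * G * c1)%:E * Se + (2 * G * q)%:E * SD)%E.
  have -> : ((2 * G * c1)%:E * Se + (2 * G * q)%:E * SD = 2%:E * (G%:E * (c1%:E * Se + q%:E * SD)))%E.
    have p1 : (0 <= c1%:E * Se)%E by rewrite mule_ge0.
    have p2 : (0 <= q%:E * SD)%E by rewrite mule_ge0.
    by rewrite (ge0_muleDr _ p1 p2) ge0_muleDr ?mule_ge0// !muleA -!EFinM.
  apply: (@le_trans _ _ (2%:E * (x + (2^-1)%:E * Sy))%E); last first.
    apply: lee_wpmul2l => //; apply: (le_trans xy); apply: lee_wpmul2l => //.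
  have half : (0 <= (2^-1)%:E * Sy)%E by rewrite mule_ge0// lee_fin invr_ge0.
  rewrite (ge0_muleDr _ x0 half) muleA -EFinM divff// mul1e; apply: leeD => //.
  by rewrite -[leLHS]mul1e; apply: lee_wpmul2r => //; rewrite lee_fin ler1n.
apply: (@le_trans _ _ ((x + 9%:E * Sr) + (Sy + 9%:E * Sr))%E).
  apply: leeD => //; apply: (le_trans Ax); apply: leeD => //.
  exact: lee_wpmul2l.
rewrite addeACA addeC; rewrite Srr.
have -> : (9%:E * Sr + 9%:E * Sr = 18%:E * Sr)%E.
  by rewrite -ge0_muleDl// -EFinD; congr (_%:E * _)%E; ring.
rewrite muleA -EFinM -addeA; apply: leeD.
  by apply: lee_wpmul2r => //; rewrite lee_fin -natrM ler_nat.
apply: (le_trans xySy); rewrite addeC; apply: leeD; apply: lee_wpmul2r => //.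
Qed.

Section coordinates.
Context {R : realType} {d : measure_display} {Omega : measurableType d}.
Context {P : probability Omega R} {W B : R -> Omega -> R} {cf : coefs R}.
Context {bs : cell_basis R} {N M : nat} {Ws Bs : 'I_M -> R -> Omega -> R}.
Hypothesis H : regression_setting P W B cf bs N Ws Bs.
Variables (Lf Lg C0 : R) (I : nat) (Y : nat -> nat -> Omega -> R) (Z Yinf : nat -> Omega -> R).
Local Notation h := (mesh cf N).

Lemma eps_ge0 k : (k < N)%N -> (0 <= eps P W B cf bs N C0 k)%E.
Proof.
move=> kN; rewrite (epsE H C0 kN).
have r0 := le_trans ler01 (rho2_ge1 H C0 (ltnW kN)).
have r1 := le_trans ler01 (rho2_ge1 H C0 kN).
have h0 := ltW (mesh_gt0 H).
have D0 w : 0 <= driver_growth (P := P) (W := W) (B := B) (cf := cf) (bs := bs) (N := N) C0 (k := k) w.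
  rewrite /driver_growth; apply: addr_ge0.
    by apply: addr_ge0; [apply: addr_ge0 => //; exact: sqr_ge0|apply: mulr_ge0 => //; exact: dot_ge0].
  by apply: mulr_ge0 => //; apply: mulr_ge0; [rewrite invr_ge0|exact: dot_ge0].
have G0 w : 0 <= forward_growth (P := P) (W := W) (B := B) (cf := cf) (bs := bs) (N := N) C0 (k := k) w.
  exact: le_trans ler01 (forward_growth_ge1 H C0 kN w).
apply: adde_ge0; first apply: adde_ge0; first apply: adde_ge0.
- apply: mule_ge0; first by apply: mean_ge0 => w; exact: sqr_ge0.
  by rewrite lee_fin addr_ge0.
- apply: mule_ge0; last by rewrite lee_fin.
  by apply: mean_ge0 => w; apply: mulr_ge0; exact: dot_ge0.
- apply: mule_ge0; first by rewrite lee_fin sqr_ge0.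
  by apply: mean_ge0 => w; apply: mulr_ge0 => //; exact: dot_ge0.
- apply: mule_ge0; first by rewrite lee_fin.
  apply: mean_ge0 => w; apply: mulr_ge0 => //.
  by apply: addr_ge0; [exact: dot_ge0|exact: sqr_ge0].
Qed.

Hypothesis hf : forall x y z x' y' z',
   `|driver cf x y z - driver cf x' y' z'| ^+ 2 <= Lf * (`|x - x'| ^+ 2 + `|y - y'| ^+ 2 + `|z - z'| ^+ 2).
Hypothesis hg : forall x y x' y',
   `|bdriver cf x y - bdriver cf x' y'| ^+ 2 <= Lg * (`|x - x'| ^+ 2 + `|y - y'| ^+ 2).
Hypothesis I0 : (0 < I)%N.
Hypothesis pic : picard_scheme P W B cf bs N I Y Z.
Hypothesis lim : picard_limit P W B cf bs N I Y Z Yinf.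
Hypothesis bd : (\big[maxe/0]_(k < N.+1) 'E_P[(fun w => `|Y I k w| ^+ 2)%R]
      + \big[maxe/0]_(k < N) 'E_P[(fun w => `|Yinf k w| ^+ 2)%R]
      + \big[maxe/0]_(k < N.+1)
          ((mesh cf N)%:E * 'E_P[(fun w => `|Z k w| ^+ 2)%R])
      <= C0%:E)%E.

Lemma picard_scheme_coordinates : exists al ai be : forall k, 'cV[R]_(pdim bs N k),
  picard_coordinates P W B cf Lf C0 I (Y I) Z al ai be.
Proof.
pose m1 := (\big[maxe/0]_(k < N.+1) 'E_P[(fun w => `|Y I k w| ^+ 2)%R])%E.
pose m2 := (\big[maxe/0]_(k < N) 'E_P[(fun w => `|Yinf k w| ^+ 2)%R])%E.
pose m3 := (\big[maxe/0]_(k < N.+1) ((mesh cf N)%:E * 'E_P[(fun w => `|Z k w| ^+ 2)%R]))%E.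
have [m10 m20 m30] : [/\ (0 <= m1)%E, (0 <= m2)%E & (0 <= m3)%E] by split; exact: bigmax_ge_id.
have bm : (m1 + m2 + m3 <= C0%:E)%E := bd.
have b1 : (m1 <= C0%:E)%E by apply: le_trans bm; rewrite -addeA leeDl// adde_ge0.
have b2 : (m2 <= C0%:E)%E by apply: le_trans bm; rewrite addeAC leeDr// adde_ge0.
have b3 : (m3 <= C0%:E)%E by apply: le_trans bm; rewrite leeDr// adde_ge0.
have bY k : (k <= N)%N -> ('E_P[(fun w => `|Y I k w| ^+ 2)%R] <= C0%:E)%E.
  move=> kN; apply: le_trans b1.
  exact: (le_bigmax 0%E (fun i : 'I_N.+1 => 'E_P[(fun w => `|Y I i w| ^+ 2)%R])%E (Ordinal (kN : (k < N.+1)%N))).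
have bYi k : (k < N)%N -> ('E_P[(fun w => `|Yinf k w| ^+ 2)%R] <= C0%:E)%E.
  move=> kN; apply: le_trans b2.
  exact: (le_bigmax 0%E (fun i : 'I_N => 'E_P[(fun w => `|Yinf i w| ^+ 2)%R])%E (Ordinal kN)).
have bZ k : (k <= N)%N -> (h%:E * 'E_P[(fun w => `|Z k w| ^+ 2)%R] <= C0%:E)%E.
  move=> kN; apply: le_trans b3.
  exact: (le_bigmax 0%E (fun i : 'I_N.+1 => h%:E * 'E_P[(fun w => `|Z i w| ^+ 2)%R])%E (Ordinal (kN : (k < N.+1)%N))).
have sp a := original_basis_sqint H a (leqnn N).
have op a b := original_basis_ortho H a b (leqnn N).
exists (al (P := P) (W := W) (B := B) (cf := cf) I Y), (ai (P := P) (W := W) (B := B) (cf := cf) Yinf),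
  (be (P := P) (W := W) (B := B) (cf := cf) Z); split.
- by move=> k kN; have [[mY _] YE] := picard_Y H I0 pic kN.
- by move=> k kN; have [[mZ _] ZE _ _ _] := picard_Z H pic kN.
- exact: (al_bound H I0 pic bY).
- exact: (ai_bound H hf I0 pic lim bYi).
- exact: (be_bound H pic bZ).
- exact: (picard_contraction_coef H hf I0 pic lim).
- exact: (sqint_full_target H hf hg I0 pic lim).
- exact: (theta_identity H hf hg I0 pic lim).
move=> c cproj; have [_ YN _] := pic.
have cE := orth_proj_coefs sp op cproj.
have YE := orth_proj_coefs sp op (YN I (leqnn I)).
have [mY _] : sqint P (Y I N) by have [_ /Lfun2_sqint] := YN I (leqnn I).
rewrite /al (coefs_of_ae sp mY (sqint_dot sp _).1 YE) (coefs_of_dot sp op).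
by rewrite -(coefs_of_dot sp op c) (coefs_of_ae sp (sqint_dot sp c).1 (sqint_dot sp _).1 cE) (coefs_of_dot sp op).
Qed.

End coordinates.

Lemma error_const_ge0 {R : realType} (cf : coefs R) (Lf Lg C0 : R) :
  0 <= Lf -> 0 <= Lg -> 0 <= C0 -> 0 <= error_const (cf := cf) Lf Lg C0.
Proof.
move=> f0 g0 c0; have := mulr_ge0 f0 c0; have := mulr_ge0 g0 c0.
have := sqr_ge0 (driver cf 0 0 0); have := sqr_ge0 (bdriver cf 0 0).
rewrite /error_const /driver_growth_const /bdriver_growth_const; lra.
Qed.

Section assembly.
Context {R : realType} {d : measure_display} {Omega : measurableType d}.
Context {P : probability Omega R} {W B : R -> Omega -> R} {cf : coefs R}.
Context {bs : cell_basis R} {N M : nat} {Ws Bs : 'I_M -> R -> Omega -> R}.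
Hypothesis H : regression_setting P W B cf bs N Ws Bs.
Variables (Lf Lg C0 : R) (xi : R -> R) (I : nat).
Variables (alpha beta : forall k, nat -> Omega -> 'cV[R]_(pdim bs N k)).
Hypothesis hf : forall x y z x' y' z',
   `|driver cf x y z - driver cf x' y' z'| ^+ 2 <= Lf * (`|x - x'| ^+ 2 + `|y - y'| ^+ 2 + `|z - z'| ^+ 2).
Hypothesis hg : forall x y x' y',
   `|bdriver cf x y - bdriver cf x' y'| ^+ 2 <= Lg * (`|x - x'| ^+ 2 + `|y - y'| ^+ 2).
Hypothesis hxi : truncation_fun xi.
Hypothesis reg : regression_scheme P W B cf C0 xi I Ws Bs alpha beta.
Variables (Y Z : nat -> Omega -> R) (al ai be : forall k, 'cV[R]_(pdim bs N k)).
Hypothesis HC : picard_coordinates P W B cf Lf C0 I Y Z al ai be.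
Hypothesis I0 : (0 < I)%N.
Hypothesis hL : (48 * Lf + 2) * mesh cf N <= 1.
Hypothesis M0 : (0 < M)%N.
Local Notation h := (mesh cf N).
Local Notation rhow k := (rhoW P W B cf bs N C0 k).
Local Notation Er k := ('E_P[(fun w => `|rhow k w| ^+ 2)%R])%E.

Definition total_const : R :=
  2 * expR (recursion_growth Lf Lg I * horizon cf) *
    (recursion_noise (cf := cf) Lf Lg C0 I + recursion_bias Lf C0 I).

Let D (j : nat) := ((h ^+ 2)%:E + h%:E * Er j.+1 + Er j + Er j)%E.

Lemma error_bound (C : R) k : (k < N)%N -> 16 <= C -> total_const <= C ->
  ('E_P[(fun w => `|Y k w - YM P W B cf C0 xi I alpha k w| ^+ 2)%R]
   + h%:E * \sum_(k <= j < N) 'E_P[(fun w => `|Z j w - ZM P W B cf C0 xi I beta j w| ^+ 2)%R]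
   <= 16%:E * \sum_(k <= j < N) 'E_P[(fun w =>
        (`|zetaW P W B cf bs N C0 j w| ^+ 2 + `|rhow j w| ^+ 2)
        * \1_(~` good_event P W cf bs N Ws Bs k) w)%R]
      + (C * h ^+ (I - 1))%:E * \sum_(k <= j < N) D j
      + (C / (h * M%:R))%:E * \sum_(k <= j < N) eps P W B cf bs N C0 j)%E.
Proof.
move=> kN C16 Ctot.
have h0 := mesh_gt0 H; have hw := ltW h0.
have Lf0 := driver_const_ge0 hf; have Lg0 := bdriver_const_ge0 hg.
have C00 : 0 <= C0 := le_trans (dot_ge0 _) (coord_al HC (leqnn N)).
have h1 : h < 1 by have := mulr_ge0 Lf0 hw; have := hL; lra.
have Er1 j : (j <= N)%N -> (1 <= Er j)%E by move=> jN; rewrite (rho2E H)// lee_fin (rho2_ge1 H).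
have D1 j : (j < N)%N -> (1 <= D j)%E.
  move=> jN; have e1 := Er1 j (ltnW jN); have e2 := Er1 j.+1 jN.
  have p1 : (0 <= Er j)%E by exact: le_trans e1.
  have p2 : (0 <= h%:E * Er j.+1)%E by rewrite mule_ge0//; exact: le_trans e2.
  rewrite /D -[leLHS]add0e; apply: leeD => //; apply: adde_ge0 => //; apply: adde_ge0 => //.
  by rewrite lee_fin sqr_ge0.
have EP0 (F : Omega -> R) : (0 <= 'E_P[(fun w => `|F w| ^+ 2)%R])%E.
  by rewrite unlock; apply: mean_ge0 => w; exact: sqr_ge0.
have s0 := step_const_ge0 I Lf0.
have noise0 : 0 <= recursion_noise (cf := cf) Lf Lg C0 I.
  by apply: mulr_ge0; [exact: mulr_ge0|exact: error_const_ge0].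
have bias0 : 0 <= recursion_bias Lf C0 I.
  rewrite /recursion_bias; apply: addr_ge0; apply: mulr_ge0 => //; apply: mulr_ge0 => //.
  exact: exprn_ge0.
have K0 : 0 <= recursion_growth Lf Lg I.
  have := mulr_ge0 s0 Lg0; rewrite /recursion_growth; lra.
have e0 j : (j < N)%N -> (0 <= eps P W B cf bs N C0 j)%E by exact: (eps_ge0 H).
have hq0 : 0 <= h ^+ (I - 1) by exact: exprn_ge0.
have hM : 0 < h * M%:R by rewrite mulr_gt0// ltr0n.
have C0' : 0 <= C by apply: le_trans C16.
have Eb0 j : (0 <= 'E_P[(fun w => `|rhow j w| ^+ 2 * \1_(~` good_event P W cf bs N Ws Bs k) w)%R])%E.
  by rewrite unlock; apply: mean_ge0 => w; rewrite mulr_ge0 ?sqr_ge0// indicE ler0n.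
pose rb j := ('E_P[(fun w => `|rhow j w| ^+ 2 * \1_(~` good_event P W cf bs N Ws Bs k) w)%R])%E.
have -> : (\sum_(k <= j < N) 'E_P[(fun w =>
    (`|zetaW P W B cf bs N C0 j w| ^+ 2 + `|rhow j w| ^+ 2)
    * \1_(~` good_event P W cf bs N Ws Bs k) w)%R] = \sum_(k <= j < N) (rb j + rb j))%E.
  by apply: eq_big_nat => j /andP[_ jN]; exact: (bad_event_mean H _ (ltnW kN) (ltnW jN)).
have [I2|I1] := ltnP 1 I.
  pose x := position_error (P := P) (W := W) (cf := cf) (bs := bs) (N := N) (Ws := Ws) (Bs := Bs) I alpha al.
  pose y := slope_error (P := P) (W := W) (cf := cf) (bs := bs) (N := N) (Ws := Ws) (Bs := Bs) I beta be.
  pose G := expR (recursion_growth Lf Lg I * horizon cf).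
  pose c1 := recursion_noise (cf := cf) Lf Lg C0 I / (h * M%:R).
  pose q := recursion_bias Lf C0 I * h ^+ (I - 1).
  have c10 : 0 <= c1 by rewrite divr_ge0// ltW.
  have q0 : 0 <= q by exact: mulr_ge0.
  have G0 : 0 <= G by exact: expR_ge0.
  have x0 j : (0 <= x j)%E by exact: position_error_ge0.
  have y0 j : (0 <= y j)%E by exact: (slope_error_ge0 H).
  have ee0 j : (j < N)%N -> (0 <= c1%:E * eps P W B cf bs N C0 j + q%:E)%E.
    by move=> jN; apply: adde_ge0; [apply: mule_ge0 => //; exact: e0|rewrite lee_fin].
  have xN : x N = 0%E.
    rewrite /x /position_error -[RHS](mean_cst P 0); apply: eq_integral => w _.
    by rewrite (last_coefficients reg HC I2) subrr dot0l mulr0.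
  have rec j : (j < N)%N -> (x j + (2^-1)%:E * y j <=
      (1 + recursion_growth Lf Lg I * h)%:E * x j.+1 + (c1%:E * eps P W B cf bs N C0 j + q%:E))%E.
    by move=> jN; rewrite addeA; exact: (regression_recursion H hf hg hxi reg HC I2 hL M0 jN).
  have gron := backward_gronwall (mulr_ge0 K0 hw) x0 y0 ee0 xN rec (ltnW kN).
  have GE : (1 + recursion_growth Lf Lg I * h) ^+ (N - k) <= G.
    have g1 : 1 <= 1 + recursion_growth Lf Lg I * h by rewrite lerDl mulr_ge0.
    apply: (@le_trans _ _ ((1 + recursion_growth Lf Lg I * h) ^+ N)).
      by apply: ler_weXn2l => //; exact: leq_subr.
    have -> : G = expR (recursion_growth Lf Lg I * h) ^+ N.
      rewrite /G -expRM_natr /mesh; congr expR.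
      by rewrite -mulrA divfK// pnatr_eq0 -lt0n (steps_gt0 H).
    by apply: lerXn2r; rewrite ?nnegrE ?expR_ge0 ?(le_trans ler01 g1)// expR_ge1Dx.
  apply: (@final_combination _ N k _ (x k) y _ _ _ D h G c1 q) => //.
  - exact: (position_comparison H hf hg hxi reg HC I0 h1 (ltnW kN)).
  - by move=> j /andP[kj jN]; exact: (slope_comparison H hf hg hxi reg HC I0 h1 kj jN).
  - apply: (le_trans gron); apply: lee_wpmul2r; last by rewrite lee_fin.
    by rewrite big_nat_cond; apply: sume_ge0 => j /andP[/andP[_ jN] _]; exact: ee0.
  - rewrite /c1 mulrA ler_pM2r ?invr_gt0//; apply: le_trans Ctot.
    by rewrite /total_const ler_wpM2l ?mulr_ge0// lerDl.
  - rewrite /q mulrA ler_wpM2r//; apply: le_trans Ctot.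
    by rewrite /total_const ler_wpM2l ?mulr_ge0// lerDr.
have IE : I = 1%N by apply/eqP; rewrite eqn_leq I1.
have -> : (I - 1 = 0)%N by rewrite IE.
rewrite expr0 mulr1.
set A := 'E_P[_]%E; set r := (16%:E * _)%E; set t := (_ * \sum_(k <= j < N) eps _ _ _ _ _ _ _ _)%E.
have r0 : (0 <= r)%E by apply: mule_ge0 => //; apply: sume_ge0 => j _; apply: adde_ge0; exact: Eb0.
have t0 : (0 <= t)%E.
  apply: mule_ge0; first by rewrite lee_fin divr_ge0// ltW.
  by rewrite big_nat_cond; apply: sume_ge0 => j /andP[/andP[_ jN] _]; exact: e0.
apply: (@le_trans _ _ (C%:E * \sum_(k <= j < N) D j)%E); last first.
  by rewrite addeAC leeDr// adde_ge0.
have hB : (h%:E * \sum_(k <= j < N) 'E_P[(fun w => `|Z j w - ZM P W B cf C0 xi I beta j w| ^+ 2)%R] <=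
    \sum_(k <= j < N) 9%:E * Er j)%E.
  rewrite ge0_sume_distrr//.
  rewrite big_nat_cond [leRHS]big_nat_cond; apply: lee_sum => j /andP[/andP[_ jN] _].
  exact: (slope_truncation H hxi reg HC jN).
have AB : (A <= \sum_(k <= j < N) 9%:E * Er j)%E.
  apply: (le_trans (position_truncation H hxi reg HC (ltnW kN))).
  rewrite (big_ltn kN) leeDl//; apply: sume_ge0 => j _; apply: mule_ge0 => //; exact: EP0.
apply: (le_trans (leeD AB hB)); rewrite -big_split /=.
rewrite big_nat_cond [X in (_ <= _ * X)%E]big_nat_cond ge0_sume_distrr; last first.
  by move=> j /andP[/andP[_ jN] _]; exact: le_trans (D1 j jN).
apply: lee_sum => j /andP[/andP[_ jN] _].
have p1 : (0 <= Er j)%E by exact: EP0.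
have p2 : (0 <= h%:E * Er j.+1)%E by rewrite mule_ge0//; exact: EP0.
have p3 : (0 <= (h ^+ 2)%:E + h%:E * Er j.+1)%E by rewrite adde_ge0// lee_fin sqr_ge0.
apply: (@le_trans _ _ (C%:E * (Er j + Er j))%E).
  rewrite -ge0_muleDr//; apply: lee_wpmul2r; first exact: adde_ge0.
  by rewrite lee_fin; lra.
by apply: lee_wpmul2l => //; rewrite /D -addeA leeDr.
Qed.

End assembly.

Theorem theorem5p8 (R : realType) (d : measure_display)
  (Omega : measurableType d) (P : probability Omega R)
  (W B : R -> Omega -> R) (cf : coefs R) (Lf Lg : R) (X : R -> Omega -> R)
  (bs : nat -> cell_basis R)
  (Y : nat -> nat -> nat -> nat -> Omega -> R)
  (Z Yinf : nat -> nat -> nat -> Omega -> R)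
  (C0 : R) (xi : R -> R)
  (hT : 0 < horizon cf)
  (hW : brownian P W) (hB : brownian P B)
  (hWB : independent2 P (path_sigma W) (path_sigma B))
  (hb : measurable_fun setT (drift cf))
  (hsigma : measurable_fun setT (diffusion cf))
  (hPhi : measurable_fun setT (terminal cf))
  (hX : sde_solution P W (horizon cf) (start_point cf) (drift cf) (diffusion cf) X)
  (hPhiX : (fun w => terminal cf (X (horizon cf) w)) \in Lfun P 2%:E)
  (hf : forall x y z x' y' z',
     `|driver cf x y z - driver cf x' y' z'| ^+ 2
       <= Lf * (`|x - x'| ^+ 2 + `|y - y'| ^+ 2 + `|z - z'| ^+ 2))
  (hg : forall x y x' y',
     `|bdriver cf x y - bdriver cf x' y'| ^+ 2
       <= Lg * (`|x - x'| ^+ 2 + `|y - y'| ^+ 2))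
  (hbs : forall N, (0 < N)%N -> basis_wf N (bs N))
  (hortho : forall N, (0 < N)%N -> orthonormal_basis P W B cf (bs N) N)
  (hpicard : forall N I, (0 < N)%N -> (0 < I)%N ->
     picard_scheme P W B cf (bs N) N I (Y N I) (Z N I))
  (hlimit : \forall N \near \oo, forall I, (0 < I)%N ->
     picard_limit P W B cf (bs N) N I (Y N I) (Z N I) (Yinf N I))
  (hC0 : \forall N \near \oo, forall I, (0 < I)%N ->
     (\big[maxe/0]_(k < N.+1) 'E_P[(fun w => `|Y N I I k w| ^+ 2)%R]
      + \big[maxe/0]_(k < N) 'E_P[(fun w => `|Yinf N I k w| ^+ 2)%R]
      + \big[maxe/0]_(k < N.+1)
          ((mesh cf N)%:E * 'E_P[(fun w => `|Z N I k w| ^+ 2)%R])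
      <= C0%:E)%E)
  (hxi : truncation_fun xi)
  (I : nat) (hI : (0 < I)%N) :
  exists C h0 : R, 0 < C /\ 0 < h0 /\
  forall N : nat, (0 < N)%N -> mesh cf N <= h0 ->
  forall k : nat, (k < N)%N ->
  forall M : nat, (0 < M)%N ->
  forall (Ws Bs : 'I_M -> R -> Omega -> R)
    (alpha beta : forall k, nat -> Omega -> 'cV[R]_(pdim (bs N) N k)),
  iid_copies P W B Ws Bs ->
  regression_scheme P W B cf C0 xi I Ws Bs alpha beta ->
  ('E_P[(fun w =>
      `|Y N I I k w - YM P W B cf C0 xi I alpha k w| ^+ 2)%R]
   + (mesh cf N)%:E * \sum_(k <= j < N) 'E_P[(fun w =>
       `|Z N I j w - ZM P W B cf C0 xi I beta j w| ^+ 2)%R]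
   <= 16%:E * \sum_(k <= j < N) 'E_P[(fun w =>
        (`|zetaW P W B cf (bs N) N C0 j w| ^+ 2
         + `|rhoW P W B cf (bs N) N C0 j w| ^+ 2)
        * \1_(~` good_event P W cf (bs N) N Ws Bs k) w)%R]
      + (C * mesh cf N ^+ (I - 1))%:E * \sum_(k <= j < N)
          ((mesh cf N ^+ 2)%:E
           + (mesh cf N)%:E
             * 'E_P[(fun w => `|rhoW P W B cf (bs N) N C0 j.+1 w| ^+ 2)%R]
           + 'E_P[(fun w => `|rhoW P W B cf (bs N) N C0 j w| ^+ 2)%R]
           + 'E_P[(fun w => `|zetaW P W B cf (bs N) N C0 j w| ^+ 2)%R])
      + (C / (mesh cf N * M%:R))%:E
        * \sum_(k <= j < N) eps P W B cf (bs N) N C0 j)%E.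
Proof.
have Lf0 := driver_const_ge0 hf.
have [N1 _ lim1] := hlimit; have [N2 _ bd2] := hC0.
pose C := Num.max 16 (total_const (cf := cf) Lf Lg C0 I).
pose n0 : R := (N1 + N2).+1%:R.
pose h0 := Num.min (horizon cf / n0) (48 * Lf + 2)^-1.
have n00 : 0 < n0 by rewrite ltr0n.
have L2 : 0 < 48 * Lf + 2 by rewrite ltr_wpDl// mulr_ge0.
exists C, h0; split; [by rewrite lt_max ltr0n|split].
  by rewrite lt_min invr_gt0 L2 divr_gt0.
move=> N N0 hN k kN M M0 Ws Bs alpha beta iid reg.
have Np : 0 < N%:R :> R by rewrite ltr0n.
have h_gt0 : 0 < mesh cf N by rewrite divr_gt0.
move: hN; rewrite le_min => /andP[hN1 hN2].
have NN : (N1 + N2 < N)%N.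
  rewrite -(ltr_nat R); move: hN1; rewrite /mesh ler_pM2l// lef_pV2 ?posrE// => /(lt_le_trans _); apply.
  by rewrite ltr_nat.
have hL : (48 * Lf + 2) * mesh cf N <= 1 by rewrite mulrC -ler_pdivlMr// div1r.
have [b_N c_N] : (N1 <= N)%N /\ (N2 <= N)%N.
  by split; apply: ltnW; apply: leq_ltn_trans NN; rewrite ?leq_addr ?leq_addl.
have H := RegressionSetting h_gt0 N0 hW hB hWB iid (hbs N N0) hb hsigma (hortho N N0).
have [al [ai [be HC]]] := picard_scheme_coordinates H hf hg hI (hpicard N I N0 hI) (lim1 N b_N I hI) (bd2 N c_N I hI).
apply: (error_bound H hf hg hxi reg HC hI hL M0 kN).
  by rewrite le_max lexx.
by rewrite le_max lexx orbT.
Qed.
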